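(* Let $W$ be a set of at most $k$ ordinary Wang tiles, and suppose at most $c$ colors are used on boundaries of input regions. Then there exists a set $\mathcal{R}$ of at most $8(k+4c)^2$ rectangular tiles with the following property: for every simply connected colored region $\Gamma$ there is a simply connected region $\Gamma'$, computable from $\Gamma$ in linear time, such that $\Gamma$ is $W$-tileable if and only if $\Gamma'$ is $\mathcal{R}$-tileable. Moreover, the reduction is parsimonious: the number of $W$-tilings of $\Gamma$ equals the number of $\mathcal{R}$-tilings of $\Gamma'$.
   Context: Consider $\mathbb{Z}^2$ as a union of closed unit squares with pairwise disjoint interiors. A region is a finite union of such unit squares with connected interior; it is simply connected if it is simply connected as a plane set. An ordinary Wang tile is a unit square with a color assigned to each of its four edges. A colored region is a region with a color assigned to each unit edge of its boundary. A $W$-tiling of a colored region is a tiling by translated copies of tiles from $W$ such that any two incident edges, including edges on the boundary of the region, have the same color. A rectangular tile is a rectangle of unit squares, and an $\mathcal{R}$-tiling of a region is a collection of translated copies of tiles from $\mathcal{R}$ (no rotations) with pairwise disjoint interiors whose union is the region. *)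

(* Defs.v *)
From HB Require Import structures.
From mathcomp Require Import all_boot all_order all_algebra finmap.
From mathcomp Require Import all_classical all_reals all_analysis.

Set Implicit Arguments.
Unset Strict Implicit.
Unset Printing Implicit Defensive.

Import Order.TTheory GRing.Theory Num.Theory.
Import numFieldNormedType.Exports.

Local Open Scope classical_set_scope.
Local Open Scope ring_scope.

(* The cell (x, y) stands for the closed unit square [x, x+1] * [y, y+1]. *)
Definition cell : choiceType := (int * int)%type.

Section PlaneSets.
Variable K : realType.

Definition unit_square (p : cell) : set (K * K) :=
  `[p.1%:~R, (p.1 + 1)%:~R]%classic `*` `[p.2%:~R, (p.2 + 1)%:~R]%classic.

Definition plane_set (G : {fset cell}) : set (K * K) :=
  \bigcup_(p in [set` G]) unit_square p.

Definition region (G : {fset cell}) : Prop :=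
  G != fset0 /\ connected (interior (plane_set G)).

Definition path_connected (T : topologicalType) (X : set T) : Prop :=
  forall x y : T, X x -> X y -> exists f : K -> T,
    [/\ {within `[0, 1]%classic, continuous f},
        f @` `[0, 1]%classic `<=` X, f 0 = x & f 1 = y].

(* The homotopy H contracts the loop f to its base point, keeping the base
   point fixed and staying inside X. *)
Definition null_homotopic (T : topologicalType) (X : set T) (f : K -> T) : Prop :=
  exists H : K * K -> T,
    [/\ {within `[0, 1]%classic `*` `[0, 1]%classic, continuous H},
        H @` (`[0, 1]%classic `*` `[0, 1]%classic) `<=` X,
        forall s, 0 <= s <= 1 -> H (s, 0) = f s,
        forall s, 0 <= s <= 1 -> H (s, 1) = f 0 &
        forall t, 0 <= t <= 1 -> H (0, t) = f 0 /\ H (1, t) = f 0].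

Definition simply_connected (T : topologicalType) (X : set T) : Prop :=
  [/\ X !=set0, path_connected X &
      forall f : K -> T, {within `[0, 1]%classic, continuous f} ->
        f @` `[0, 1]%classic `<=` X -> f 0 = f 1 -> null_homotopic X f].

Definition simply_connected_region (G : {fset cell}) : Prop :=
  region G /\ simply_connected (plane_set G).

End PlaneSets.

Inductive side := East | North | West | South.

Definition side_code (s : side) : bool * bool :=
  match s with
  | East => (false, false) | North => (false, true)
  | West => (true, false) | South => (true, true)
  end.

Definition side_decode (b : bool * bool) : side :=
  match b with
  | (false, false) => East | (false, true) => North
  | (true, false) => West | (true, true) => South
  end.

Lemma side_codeK : cancel side_code side_decode.
Proof. by case. Qed.

HB.instance Definition _ := Finite.copy side (can_type side_codeK).

(* (true, (x, y)) is the horizontal unit edge from (x, y) to (x+1, y);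
   (false, (x, y)) is the vertical unit edge from (x, y) to (x, y+1). *)
Definition edge : choiceType := (bool * cell)%type.

Definition cell_edge (p : cell) (s : side) : edge :=
  match s with
  | East => (false, (p.1 + 1, p.2))
  | North => (true, (p.1, p.2 + 1))
  | West => (false, p)
  | South => (true, p)
  end.

(* A unit edge lies on the boundary iff exactly one of the two cells on its
   sides belongs to G. *)
Definition boundary_edge (G : {fset cell}) (e : edge) : bool :=
  let: (horizontal, (x, y)) := e in
  ((x, y) \in G) (+)
  ((if horizontal then (x, y - 1) else (x - 1, y)) \in G).

Section WangTiles.
Variable C : choiceType.

Record colored_region := ColoredRegion {
  cells : {fset cell};
  color : {fmap edge -> C};
  color_dom : forall e, (e \in domf color) = boundary_edge cells e }.

Definition wang_tile : choiceType := {ffun side -> C}.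

Variables (W : {fset wang_tile}) (G : colored_region).

Definition is_wang_tiling (t : {ffun cells G -> W}) : bool :=
  [forall p : cells G, forall q : cells G, forall s : side, forall s' : side,
     (cell_edge (val p) s == cell_edge (val q) s') ==>
     (val (t p) s == val (t q) s')] &&
  [forall p : cells G, forall s : side,
     if (color G).[? cell_edge (val p) s]%fmap is Some a
     then val (t p) s == a else true].

Definition wang_tileable : Prop :=
  exists t : {ffun cells G -> W}, is_wang_tiling t.

Definition nb_wang_tilings : nat := #|[pred t | is_wang_tiling t]|.

End WangTiles.

(* (a, b) is the rectangle of width a and height b. *)
Definition rect : choiceType := (nat * nat)%type.

Definition rect_tile_set (R : {fset rect}) : Prop :=
  forall r, r \in R -> (0 < r.1)%N && (0 < r.2)%N.

(* (p, r) is the copy of r whose lower left unit square is p. *)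
Definition placement : choiceType := (cell * rect)%type.

Definition placed_cells (P : placement) : {fset cell} :=
  [fset ((P.1.1 + i%:Z)%R, (P.1.2 + j%:Z)%R)
    | i in iota 0 P.2.1, j in iota 0 P.2.2]%fset.

Section RectTilings.
Variables (R : {fset rect}) (G : {fset cell}).

Definition is_rect_tiling (T : {fset placement}) : bool :=
  [&& all (fun P : placement => P.2 \in R) T,
      all (fun P => all (fun Q => (P != Q) ==>
        [disjoint placed_cells P & placed_cells Q]%fset) T) T &
      (\bigcup_(P <- T) placed_cells P)%fset == G].

Definition rect_tileable : Prop := exists T, is_rect_tiling T.

(* When the tiles of R are nonempty, every tiling of G is a subset of G * R,
   because the lower left unit square of each of its tiles lies in G. *)
Definition nb_rect_tilings : nat :=
  #|` [fset T in fpowerset (G `*` R) | is_rect_tiling T]|%fset.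

End RectTilings.

(* Unit-cost random access machines with integer registers indexed by integers,
   addition and subtraction as only arithmetic, and a one-way input and output
   tape. (Multiplication is left out: at unit cost it would make the model
   unreasonably powerful.) *)
Inductive instr :=
| Const of int & int         (* X_i := v *)
| Add of int & int & int     (* X_i := X_j + X_l *)
| Sub of int & int & int     (* X_i := X_j - X_l *)
| Fetch of int & int         (* X_i := X_(X_j) *)
| Store of int & int         (* X_(X_i) := X_j *)
| JumpPos of int & nat       (* if X_i > 0, go to instruction m *)
| Read of int & nat          (* read X_i; on exhausted input go to m *)
| Write of int.              (* print X_i *)

Record ram_state := RamState {
  pc : nat; mem : int -> int; input : seq int; output : seq int }.

Definition upd (M : int -> int) (i v : int) : int -> int :=
  fun j => if j == i then v else M j.

Definition exec (ins : instr) (st : ram_state) : ram_state :=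
  let: RamState n M inp out := st in
  match ins with
  | Const i v => RamState n.+1 (upd M i v) inp out
  | Add i j l => RamState n.+1 (upd M i (M j + M l)) inp out
  | Sub i j l => RamState n.+1 (upd M i (M j - M l)) inp out
  | Fetch i j => RamState n.+1 (upd M i (M (M j))) inp out
  | Store i j => RamState n.+1 (upd M (M i) (M j)) inp out
  | JumpPos i m => RamState (if 0 < M i then m else n.+1) M inp out
  | Read i m =>
      if inp is v :: inp' then RamState n.+1 (upd M i v) inp' out
      else RamState m M inp out
  | Write i => RamState n.+1 M inp (rcons out (M i))
  end.

(* The machine halts by leaving its program. *)
Definition step (P : seq instr) (st : ram_state) : ram_state :=
  if onth P (pc st) is Some ins then exec ins st else st.

Definition outputs_within (P : seq instr) (inp : seq int) (t : nat)
    (out : seq int) : Prop :=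
  let st := iter t (step P) (RamState 0 (fun=> 0) inp [::]) in
  (size P <= pc st)%N /\ output st = out.

(* The colors of B are numbered from 1; 0 marks a side that is not on the
   boundary and hence carries no color. *)
Definition color_code (C : choiceType) (B : {fset C}) (a : option C) : int :=
  if a is Some a then (index a (enum_fset B)).+1%:Z else 0.

Definition encode_colored_cell (C : choiceType) (B : {fset C})
    (G : colored_region C) (p : cell) : seq int :=
  [:: p.1, p.2 &
   [seq color_code B (color G).[? cell_edge p s]%fmap
      | s <- [:: East; North; West; South]]].

Definition encodes_colored_region (C : choiceType) (B : {fset C})
    (G : colored_region C) (w : seq int) : Prop :=
  exists2 s : seq cell, perm_eq s (cells G) &
    w = flatten [seq encode_colored_cell B G p | p <- s].

Definition encodes_region (G : {fset cell}) (w : seq int) : Prop :=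
  exists2 s : seq cell, perm_eq s G & w = flatten [seq [:: p.1; p.2] | p <- s].

Definition input_region (K : realType) (C : choiceType) (B : {fset C})
    (G : colored_region C) : Prop :=
  simply_connected_region K (cells G) /\ (codomf (color G) `<=` B)%fset.

Definition linear_time_computable (C : choiceType) (B : {fset C})
    (D : colored_region C -> Prop) (f : colored_region C -> {fset cell}) : Prop :=
  exists (P : seq instr) (a b : nat), forall G, D G ->
    forall w, encodes_colored_region B G w ->
      exists (t : nat) (w' : seq int),
        [/\ (t <= a * size w + b)%N, outputs_within P w t w' &
            encodes_region (f G) w'].

(* Main.v *)
(** Each cell of the colored region is blown up to a block of 40 by [4 (t + G)]
    unit squares, cut into four vertical slots of widths 8, 9, 12 and 11. The tiles
    are bricks of height [t] covering two adjacent slots and fillers covering one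
    slot, of height close to [G], where [t] is much larger than [G]. In every tiling
    the bricks form a running bond: consecutive rows are offset by one slot. The
    vertical displacement of a brick from its nominal place encodes a state, and
    a filler fitting between two bricks exists exactly when their states are
    compatible. The arithmetic of widths and heights (fillers are 0 modulo 3 with
    a parity depending on the slot, bricks are 1 modulo 3) forces this pattern: the
    only other local possibility is a pile of three fillers in place of a filler and
    a brick, and such a defect propagates sideways until it reaches the boundary,
    where it is impossible. The states of four consecutive rows carry the Wang tile
    chosen in a cell and its colors to the neighboring cells; on the boundary, the
    region is carved along the bricks that would encode the prescribed colors.
    The carving removes unit squares one after the other from the scaled region,
    each time through a retraction, so the region remains simply connected. *)
From Stdlib Require Import ZArith Lia.
From HB Require Import structures.
From mathcomp Require Import all_boot all_order all_algebra finmap.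
From mathcomp Require Import all_classical all_reals all_analysis.
From mathcomp Require Import ssrZ zify ring lra.
Require Import Defs.

Set Implicit Arguments.
Unset Strict Implicit.
Unset Printing Implicit Defensive.

Import Order.TTheory GRing.Theory Num.Theory.
Import numFieldNormedType.Exports.

Local Open Scope classical_set_scope.
Local Open Scope ring_scope.

(** A rectangle reveals only its width and its height, so all information has to sit in filler
    heights. Brick displacements are therefore digits in a base [S] greater than [3 * I], where [I]
    bounds the states: when two fillers end level, three shifts stand on each side of an equation,
    nothing carries, and every digit names its class and state. Tile counts multiply only where two
    unrelated states meet at one filler, a horizontal-edge color below a vertical-edge color; hence
    the quadratic term [nN * nE], all other kinds of fillers being linear in number. Bricks outside
    the region are kept, with a state imposed by the border, so that one induction (rows upwards,
    each row from the left) covers interior and border. A leftmost defect forces another one in the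
    next row, further left, and so climbs out of the bounded region. On the topological side,
    carving near a corner is a retraction only if no two cells of the region touch there at a single
    point. Simple connectedness forbids this: a loop through such a vertex crosses it an odd number
    of times, and that parity is a homotopy invariant. *)

Section Retracts.

(** * Retractions in the plane and the removal of a square *)

Lemma within_compose (T U V : topologicalType) (A : set T) (B : set U) (f : T -> U) (g : U -> V) :
  {within A, continuous f} -> (forall x, A x -> B (f x)) -> {within B, continuous g} ->
  {within A, continuous (g \o f)}.
Proof.
move=> /subspace_continuousP cf fAB /subspace_continuousP cg.
apply/subspace_continuousP => x Ax W /(cg _ (fAB _ Ax)) gW.
have := cf _ Ax _ gW; rewrite /= !nbhs_simpl /within /=.
by apply: filterS => z H Az; apply: H => //; apply: fAB.
Qed.

Lemma within_eq (T U : topologicalType) (A : set T) (f g : T -> U) :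
  (forall x, A x -> f x = g x) -> {within A, continuous f} -> {within A, continuous g}.
Proof.
move=> fg cf; apply: subspace_eq_continuous cf => x /set_mem Ax.
exact: fg.
Qed.

Variable K : realType.

(** A contraction of [i \o f] in [X], followed by [r], contracts [f], since [r] undoes [i] on [Y].
    The map [i] need not be an inclusion, which lets the same lemma serve for changes of scale. *)
Lemma simply_connected_retract (T U : topologicalType) (X : set T) (Y : set U)
    (i : U -> T) (r : T -> U) :
  {within Y, continuous i} -> (forall y, Y y -> X (i y)) ->
  {within X, continuous r} -> (forall x, X x -> Y (r x)) ->
  (forall y, Y y -> r (i y) = y) ->
  simply_connected K X -> simply_connected K Y.
Proof.
move=> ci iX cr rY ri [[x Xx] pc nh]; split.
- by exists (r x); apply: rY.
- move=> y y' Yy Yy'; have [f [cf fX f0 f1]] := pc _ _ (iX _ Yy) (iX _ Yy').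
  exists (r \o f); split=> /=; rewrite ?f0 ?f1 ?ri //.
    by apply: (within_compose cf _ cr) => s Hs; apply: fX; exists s.
  by move=> _ [s Hs <-]; apply: rY; apply: fX; exists s.
- move=> f cf fY f01.
  have fYs s : `[0, 1]%classic s -> Y (f s) by move=> Hs; apply: fY; exists s.
  have [||/=|H [cH HX H0 H1 Hb]] := nh (i \o f).
  + exact: (within_compose cf fYs ci).
  + by move=> _ [s Hs <-]; apply/iX/fYs.
  + by rewrite f01.
  have I0 : `[0, 1]%classic (0 : K) by rewrite /= in_itv /= lexx ler01.
  exists (r \o H); split=> /=.
  + by apply: (within_compose cH _ cr) => s Hs; apply: HX; exists s.
  + by move=> _ [s Hs <-]; apply: rY; apply: HX; exists s.
  + by move=> s Hs; rewrite H0 //= ri //; apply: fYs; rewrite /= in_itv.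
  + by move=> s Hs; rewrite H1 //= ri //; apply: fYs.
  + by move=> s Hs; have [-> ->] := Hb _ Hs; rewrite /= ri //; apply: fYs.
Qed.

Lemma continuous_pair (T U V : topologicalType) (f : T -> U) (g : T -> V) :
  continuous f -> continuous g -> continuous (fun x => (f x, g x)).
Proof. by move=> cf cg x; apply: cvg_pair; [exact: cf | exact: cg]. Qed.

Lemma continuous_fst (U V : topologicalType) : continuous (fst : U * V -> U).
Proof. by move=> x; exact: cvg_fst. Qed.

Lemma continuous_snd (U V : topologicalType) : continuous (snd : U * V -> V).
Proof. by move=> x; exact: cvg_snd. Qed.

Section Arith.
Variables (T : topologicalType) (f g : T -> K).
Hypotheses (cf : continuous f) (cg : continuous g).

Lemma continuous_add : continuous (fun x => f x + g x).
Proof. by move=> x; apply: cvgD; [exact: cf | exact: cg]. Qed.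

Lemma continuous_opp : continuous (fun x => - f x).
Proof. by move=> x; apply: cvgN; exact: cf. Qed.

Lemma continuous_mul : continuous (fun x => f x * g x).
Proof. by move=> x; apply: cvgM; [exact: cf | exact: cg]. Qed.

Lemma continuous_minr : continuous (fun x => Num.min (f x) (g x)).
Proof. by move=> x; apply: continuous_min; [exact: cf | exact: cg]. Qed.

Lemma continuous_maxr : continuous (fun x => Num.max (f x) (g x)).
Proof. by move=> x; apply: continuous_max; [exact: cf | exact: cg]. Qed.

End Arith.

(* Retracts the square [-1,1] * [0,1] onto its bottom, together with its left side
   if [l] and its right side if [r]: a horizontal stretching with clamping pushes
   the square onto three sides, then the unwanted ones are dropped to the bottom. *)
Definition square_retract (l r : bool) (w : K * K) : K * K :=
  let p := w.1 * (1 + w.2) in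
  let a := Num.max (- 1) (Num.min p 1) in
  let b := Num.max 0 (Num.min (Num.max p (- p) - 1) w.2) in
  (a, Num.min b (Num.max (Num.max (l%:R * - a) (r%:R * a)) 0)).

Definition std_square (w : K * K) := -1 <= w.1 <= 1 /\ 0 <= w.2 <= 1.

Definition std_sides (l r : bool) (w : K * K) :=
  [\/ w.2 = 0 /\ -1 <= w.1 <= 1, [/\ l, w.1 = -1 & 0 <= w.2 <= 1] |
      [/\ r, w.1 = 1 & 0 <= w.2 <= 1]].

Lemma clamp_bounds (u y : K) : 0 <= y -> 0 <= Num.max 0 (Num.min u y) <= y.
Proof. by move=> y0; rewrite le_max lexx /= ge_max y0 ge_min lexx orbT. Qed.

(** While the stretched abscissa [p] stays in [-1, 1] the clamped height [b] is 0 and the image is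
    on the bottom. Beyond, the abscissa sticks at -1 or 1; if that side is not wanted, the outer
    minimum is taken with 0. *)
Lemma square_retract_sides l r w : std_square w -> std_sides l r (square_retract l r w).
Proof.
case: w => x y [/= /andP[x1 x2] /andP[y1 y2]]; rewrite /square_retract /=.
set p := x * (1 + y); set u := Num.max p (- p) - 1; rewrite /std_sides /=.
have /andP[] := clamp_bounds u y1; set b := Num.max 0 (Num.min u y) => b1 b2.
have c0 (c : K) : 0 <= Num.max c 0 by rewrite le_max lexx orbT.
have minb (c : K) : 0 <= Num.min b (Num.max c 0) <= 1.
  by rewrite le_min b1 c0 ge_min; apply/andP; split=> //; apply/orP; left; lra.
have min0 (c : K) : c <= 0 -> Num.min b (Num.max c 0) = 0.
  by move=> Hc; rewrite (max_r Hc) min_r.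
case: (boolP (1 < p)) => [pl|]; last rewrite -leNgt => pl.
  have -> : Num.min p 1 = 1 by apply: min_r; exact: ltW.
  have -> : Num.max (-1) 1 = 1 :> K by apply: max_r; lra.
  case: r => /=; first by constructor 3; split=> //; exact: minb.
  constructor 1; split; last by lra.
  by apply: min0; rewrite ge_max; apply/andP; split; case: l => /=; lra.
rewrite (min_l pl); case: (boolP (p < -1)) => [pr|]; last rewrite -leNgt => pr.
  have -> : Num.max (-1) p = -1 by apply: max_l; exact: ltW.
  case: l => /=; first by constructor 2; split=> //; exact: minb.
  constructor 1; split; last by lra.
  by apply: min0; rewrite ge_max; apply/andP; split; case: r => /=; lra.
rewrite (max_r pr); constructor 1; split; last by rewrite pr pl.
have u0 : u <= 0 by rewrite /u subr_le0 ge_max; apply/andP; split; lra.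
have -> : b = 0 by rewrite /b max_l // ge_min u0.
by rewrite min_l.
Qed.

(** This is what the factor [1 + w.2] is chosen for: on a lateral side [|p| - 1] is exactly the
    height, and on the bottom the factor is 1. *)
Lemma square_retract_id l r w : std_sides l r w -> square_retract l r w = w.
Proof.
case: w => x y; rewrite /std_sides /square_retract /=.
case=> [[-> /andP[x1 x2]]|[-> -> /andP[y1 y2]]|[-> -> /andP[y1 y2]]].
- rewrite addr0 mulr1 (min_l x2) (max_r x1).
  have /andP[b1 b2] := clamp_bounds (Num.max x (- x) - 1) (lexx 0).
  have -> : Num.max 0 (Num.min (Num.max x (- x) - 1) 0) = 0 :> K by apply/eqP; rewrite eq_le b2 b1.
  by rewrite min_l // le_max lexx orbT.
- rewrite mulN1r opprK.
  have -> : Num.min (- (1 + y)) 1 = - (1 + y) by apply: min_l; lra.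
  have -> : Num.max (-1) (- (1 + y)) = -1 by apply: max_l; lra.
  have -> : Num.max (- (1 + y)) (1 + y) = 1 + y by apply: max_r; lra.
  have -> : 1 + y - 1 = y by lra.
  rewrite minxx (max_r y1) opprK; congr pair; rewrite min_l // !le_max.
  by apply/orP; left; apply/orP; left; rewrite mul1r.
- rewrite mul1r.
  have -> : Num.min (1 + y) 1 = 1 by apply: min_r; lra.
  have -> : Num.max (-1) 1 = 1 :> K by apply: max_r; lra.
  have -> : Num.max (1 + y) (- (1 + y)) = 1 + y by apply: max_l; lra.
  have -> : 1 + y - 1 = y by lra.
  rewrite minxx (max_r y1); congr pair; rewrite min_l // !le_max.
  by apply/orP; left; apply/orP; right; rewrite mul1r.
Qed.

Lemma square_retract_continuous l r : continuous (square_retract l r).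
Proof.
have cp : continuous (fun w : K * K => w.1 * (1 + w.2)).
  apply: continuous_mul; first exact: continuous_fst.
  by apply: continuous_add; [exact: cst_continuous | exact: continuous_snd].
have ca : continuous (fun w : K * K => Num.max (- 1) (Num.min (w.1 * (1 + w.2)) 1)).
  apply: continuous_maxr; first exact: cst_continuous.
  by apply: continuous_minr => //; exact: cst_continuous.
apply: continuous_pair => //; apply: continuous_minr.
  apply: continuous_maxr; first exact: cst_continuous.
  apply: continuous_minr; last exact: continuous_snd.
  apply: continuous_add; last exact: cst_continuous.
  by apply: continuous_maxr => //; apply: continuous_opp.
apply: continuous_maxr; last exact: cst_continuous.
apply: continuous_maxr; apply: continuous_mul => //; try exact: cst_continuous.
exact: continuous_opp.
Qed.

(** The retraction [rho] is the identity on [Y] and the square retraction, read in the coordinates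
    [phi], on [Q]. Both agree on the overlap, which lies on the retained sides, so they glue along
    two closed sets. *)
Lemma simply_connected_remove (X Q Y : set (K * K)) (l r : bool) (phi psi : K * K -> K * K) :
  closed Q -> closed Y -> X = Y `|` Q ->
  continuous phi -> continuous psi -> (forall z, Q z -> psi (phi z) = z) ->
  (forall z, Q z -> std_square (phi z)) ->
  (forall z, Q z -> Y z -> std_sides l r (phi z)) ->
  (forall w, std_sides l r w -> Y (psi w)) ->
  simply_connected K X -> simply_connected K Y.
Proof.
move=> cQ cY -> cphi cpsi psiphi Qs QY sY.
pose rho z := if `[< Y z >] then z else psi (square_retract l r (phi z)).
have rhoQ z : Q z -> rho z = psi (square_retract l r (phi z)).
  rewrite /rho => Qz; case: asboolP => // Yz.
  by rewrite square_retract_id ?psiphi //; apply: QY.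
have rhoY z : Y z -> rho z = z by rewrite /rho => Yz; case: asboolP.
apply: (@simply_connected_retract _ _ _ _ id rho).
- by apply: continuous_subspaceT => x.
- by move=> z Yz; left.
- apply: withinU_continuous => //.
    apply: (@within_eq _ _ _ id) => [z Yz|]; first by rewrite rhoY.
    by apply: continuous_subspaceT => x.
  apply: (@within_eq _ _ _ (psi \o (square_retract l r \o phi))) => [z Qz|]; first by rewrite rhoQ.
  apply: continuous_subspaceT => x; apply: continuous_comp; last exact: cpsi.
  by apply: continuous_comp; [exact: cphi | exact: square_retract_continuous].
- move=> z; case: (pselect (Y z)) => [Yz _|nYz [//|Qz]]; first by rewrite rhoY.
  by rewrite rhoQ //; apply: sY; apply: square_retract_sides; apply: Qs.
- by move=> z Yz; rewrite rhoY.
Qed.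

End Retracts.

(** * Removal of a single cell from a set of cells *)

Section CellSets.

Definition neighbor (s : side) (p : cell) : cell :=
  match s with
  | East => (p.1 + 1, p.2) | North => (p.1, p.2 + 1)
  | West => (p.1 - 1, p.2) | South => (p.1, p.2 - 1)
  end.

Definition opposite (s : side) : side :=
  match s with East => West | North => South | West => East | South => North end.

Definition lateral (s : side) (b : bool) : side :=
  match s with
  | East | West => if b then North else South
  | North | South => if b then East else West
  end.

Lemma neighborK s p : neighbor (opposite s) (neighbor s p) = p.
Proof. by case: p => x y; case: s => /=; congr pair; lia. Qed.

Lemma neighborC s s' p : neighbor s (neighbor s' p) = neighbor s' (neighbor s p).
Proof. by case: p => x y; case: s; case: s' => /=; congr pair; lia. Qed.

Lemma neighbor_neq s p : neighbor s p != p.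
Proof. by case: p => x y; case: s => /=; rewrite xpair_eqE; lia. Qed.

Lemma side_cases (s s' : side) : [\/ s' = s, s' = opposite s, s' = lateral s false | s' = lateral s true].
Proof. by case: s; case: s'; solve [constructor 1; done | constructor 2; done | constructor 3; done | constructor 4; done]. Qed.

(** Connectedness of the adjacency graph, put as an induction principle so that no path of cells has
    to be represented. *)
Definition edge_connected (Y : {fset cell}) : Prop := forall P : cell -> Prop,
  (exists2 p, p \in Y & P p) ->
  (forall p s, p \in Y -> neighbor s p \in Y -> P p -> P (neighbor s p)) ->
  forall p, p \in Y -> P p.

(** The side [s] is the base on which [q] is pushed, and the opposite side is free. The first
    implication keeps the rest from touching [q] in a far corner alone; the second lets a lateral
    neighbor be reached from the base without passing through [q]. *)
Definition removable (Y : {fset cell}) (q : cell) (s : side) : Prop :=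
  [/\ q \in Y, neighbor s q \in Y, neighbor (opposite s) q \notin Y &
    forall b, (neighbor (lateral s b) (neighbor (opposite s) q) \in Y -> neighbor (lateral s b) q \in Y) /\
      (neighbor (lateral s b) q \in Y -> neighbor (lateral s b) (neighbor s q) \in Y)].

Lemma edge_connected_remove Y q s : removable Y q s -> edge_connected Y ->
  edge_connected (Y `\ q)%fset.
Proof.
move=> [qY bY oY lat] eY P [p0 /fsetD1P[p0q p0Y] Pp0] Pc p /fsetD1P[pq pY].
have bY' : neighbor s q \in (Y `\ q)%fset by rewrite !inE neighbor_neq.
have Pc2 : forall p s, p \in (Y `\ q)%fset -> neighbor s p \in (Y `\ q)%fset -> P p <-> P (neighbor s p).
  move=> p1 s1 H1 H2; split; first exact: Pc.
  by move=> H; rewrite -(neighborK s1 p1); apply: Pc; rewrite ?neighborK.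
have Plat b : neighbor (lateral s b) q \in Y -> P (neighbor (lateral s b) q) <-> P (neighbor s q).
  move=> H; have H' := (lat b).2 H.
  have H1 : neighbor (lateral s b) q \in (Y `\ q)%fset by rewrite !inE neighbor_neq.
  have H2 : neighbor (lateral s b) (neighbor s q) \in (Y `\ q)%fset.
    rewrite !inE H' andbT; case: (q) => x y; case: (s); case: b {H H' H1} => /=; rewrite xpair_eqE; lia.
  rewrite (Pc2 (neighbor s q) (lateral s b)) //.
  by rewrite neighborC; apply: Pc2; rewrite // -neighborC.
(* The predicate is extended to [q], where it speaks of the base neighbor instead; that cell
   replaces [q] in every walk. *)
suff : forall p, p \in Y -> (p != q -> P p) /\ (p = q -> P (neighbor s q)) by move/(_ p pY)=> [H _]; apply: H.
apply: eY.
  by exists p0 => //; split=> // E; rewrite E eqxx in p0q.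
have key s1 : neighbor s1 q \in Y -> P (neighbor s1 q) <-> P (neighbor s q).
  move=> H; case: (side_cases s s1) => E; rewrite E in H *; try exact: Plat; first by [].
  by rewrite H in oY.
move=> p1 s1 p1Y n1Y [H1 H2]; split.
- move=> nq; case: (eqVneq p1 q) => [E|p1q].
    by rewrite E in n1Y *; apply/(key s1) => //; apply: H2.
  by apply/(Pc2 p1 s1); rewrite ?inE ?nq ?p1q ?p1Y ?n1Y //; apply: H1.
- move=> E; have Ep : p1 = neighbor (opposite s1) q by rewrite -E neighborK.
  rewrite Ep in H1 p1Y; apply/(key (opposite s1)) => //.
  by apply: H1; exact: neighbor_neq.
Qed.

Variable K : realType.

Definition in_square (p : cell) (z : K * K) :=
  p.1%:~R <= z.1 <= p.1%:~R + 1 /\ p.2%:~R <= z.2 <= p.2%:~R + 1.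

Lemma unit_squareP p z : unit_square p z <-> in_square p z.
Proof. by rewrite /unit_square /in_square /= !in_itv /= !intrD; split. Qed.

Lemma plane_setP (Y : {fset cell}) z : plane_set Y z <-> exists2 p, p \in Y & in_square p z.
Proof.
split=> [[p pY /unit_squareP H]|[p pY H]]; exists p => //; exact/unit_squareP.
Qed.

Lemma closed_unit_square p : closed (unit_square p : set (K * K)).
Proof.
have -> : unit_square p = (fst @^-1` `[p.1%:~R, (p.1 + 1)%:~R]%classic) `&`
    (snd @^-1` `[p.2%:~R, (p.2 + 1)%:~R]%classic) :> set (K * K) by [].
apply: closedI; apply: closed_comp; try exact: itv_closed.
- by move=> x _; exact: continuous_fst.
- by move=> x _; exact: continuous_snd.
Qed.

Lemma closed_plane_set (Y : {fset cell}) : closed (plane_set Y : set (K * K)).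
Proof. by apply: closed_bigcup => [|p _]; [exact: finite_fset | exact: closed_unit_square]. Qed.

Lemma plane_set_remove (Y : {fset cell}) q : q \in Y ->
  plane_set Y = plane_set (Y `\ q)%fset `|` unit_square q :> set (K * K).
Proof.
move=> qY; apply/seteqP; split=> z.
  move=> /plane_setP[p pY H]; case: (eqVneq p q) => [<-|pq]; first by right; apply/unit_squareP.
  by left; apply/plane_setP; exists p => //; rewrite !inE pq.
case=> [/plane_setP[p /fsetD1P[_ pY] H]|/unit_squareP H]; apply/plane_setP; first by exists p.
by exists q.
Qed.

Lemma square_meet p q z : in_square p z -> in_square q z -> exists i j : int,
  [/\ p = (q.1 + i, q.2 + j),
      [\/ i = -1 /\ z.1 = q.1%:~R, i = 0 | i = 1 /\ z.1 = q.1%:~R + 1] &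
      [\/ j = -1 /\ z.2 = q.2%:~R, j = 0 | j = 1 /\ z.2 = q.2%:~R + 1]].
Proof.
have key (a b : int) (x : K) : a%:~R <= x <= a%:~R + 1 -> b%:~R <= x <= b%:~R + 1 ->
    [\/ a - b = -1 /\ x = b%:~R, a - b = 0 | a - b = 1 /\ x = b%:~R + 1].
  move=> /andP[a1 a2] /andP[b1 b2].
  have H1 : a <= b + 1 by rewrite -(ler_int K) intrD; lra.
  have H2 : b <= a + 1 by rewrite -(ler_int K) intrD; lra.
  have [E|[E|E]] : a = b - 1 \/ a = b \/ a = b + 1 by lia.
  - constructor 1; split; first by lia.
    by move: a2; rewrite E intrB => a2; apply/eqP; rewrite eq_le b1 andbT; lra.
  - by constructor 2; lia.
  - constructor 3; split; first by lia.
    by move: a1; rewrite E intrD => a1; apply/eqP; rewrite eq_le b2 /=; lra.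
move=> [p1 p2] [q1 q2]; exists (p.1 - q.1), (p.2 - q.2); split.
- by case: p {p1 p2} => x y /=; congr pair; lia.
- exact: key.
- exact: key.
Qed.

Lemma simply_connected_remove_cell Y q s : removable Y q s ->
  simply_connected K (plane_set Y : set (K * K)) ->
  simply_connected K (plane_set (Y `\ q)%fset : set (K * K)).
Proof.
move=> [qY bY oY lat].
pose a : K := q.1%:~R; pose b : K := q.2%:~R.
(* The square is turned so that the base [s] becomes the bottom and the lateral neighbors [false]
   and [true] become the left and right sides; [psi] is the inverse map. *)
pose phi (z : K * K) : K * K := match s with
  | South => (2 * (z.1 - a) - 1, z.2 - b) | North => (2 * (z.1 - a) - 1, b + 1 - z.2)
  | West => (2 * (z.2 - b) - 1, z.1 - a) | East => (2 * (z.2 - b) - 1, a + 1 - z.1) end.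
pose psi (w : K * K) : K * K := match s with
  | South => (a + (w.1 + 1) / 2, b + w.2) | North => (a + (w.1 + 1) / 2, b + 1 - w.2)
  | West => (a + w.2, b + (w.1 + 1) / 2) | East => (a + 1 - w.2, b + (w.1 + 1) / 2) end.
pose l := neighbor (lateral s false) q \in Y.
pose r := neighbor (lateral s true) q \in Y.
have cst (x : K) : continuous (fun _ : K * K => x) by exact: cst_continuous.
have c1 : continuous (fst : K * K -> K) by exact: continuous_fst.
have c2 : continuous (snd : K * K -> K) by exact: continuous_snd.
have aff (f : K * K -> K) (u v : K) : continuous f -> continuous (fun z => u * f z + v).
  by move=> cf; apply: continuous_add => //; apply: continuous_mul.
have affE (f g : K * K -> K) : continuous f -> f =1 g -> continuous g.
  by move=> cf /funext <-.
move=> scY; apply: (@simply_connected_remove K _ _ _ l r phi psi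
  (@closed_unit_square q) (@closed_plane_set _) (plane_set_remove qY)) => //.
- rewrite /phi; case: (s); apply: continuous_pair.
  + by apply: (affE _ _ (aff _ 2 (- 2 * b - 1) c2)) => z; ring.
  + by apply: (affE _ _ (aff _ (-1) (a + 1) c1)) => z; ring.
  + by apply: (affE _ _ (aff _ 2 (- 2 * a - 1) c1)) => z; ring.
  + by apply: (affE _ _ (aff _ (-1) (b + 1) c2)) => z; ring.
  + by apply: (affE _ _ (aff _ 2 (- 2 * b - 1) c2)) => z; ring.
  + by apply: (affE _ _ (aff _ 1 (- a) c1)) => z; ring.
  + by apply: (affE _ _ (aff _ 2 (- 2 * a - 1) c1)) => z; ring.
  + by apply: (affE _ _ (aff _ 1 (- b) c2)) => z; ring.
- rewrite /psi; case: (s); apply: continuous_pair.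
  + by apply: (affE _ _ (aff _ (-1) (a + 1) c2)) => z; ring.
  + by apply: (affE _ _ (aff _ (1 / 2) (b + 1 / 2) c1)) => z; field.
  + by apply: (affE _ _ (aff _ (1 / 2) (a + 1 / 2) c1)) => z; field.
  + by apply: (affE _ _ (aff _ (-1) (b + 1) c2)) => z; ring.
  + by apply: (affE _ _ (aff _ 1 a c2)) => z; ring.
  + by apply: (affE _ _ (aff _ (1 / 2) (b + 1 / 2) c1)) => z; field.
  + by apply: (affE _ _ (aff _ (1 / 2) (a + 1 / 2) c1)) => z; field.
  + by apply: (affE _ _ (aff _ 1 b c2)) => z; ring.
- by move=> [x y] _; rewrite /psi /phi; case: (s) => /=; congr pair; field.
- move=> [x y] /unit_squareP[/= /andP[x1 x2] /andP[y1 y2]]; rewrite /std_square /phi /a /b.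
  by case: (s) => /=; split; apply/andP; split; lra.
- move=> [x y] /unit_squareP sq /plane_setP[p /fsetD1P[pq pY] sp].
  have [[/= /andP[x1 x2] /andP[y1 y2]]] := sq.
  have [i [j [Ep Hi Hj]]] := square_meet sp sq; rewrite /= in Hi Hj.
  move: lat oY bY pY pq; rewrite Ep /std_sides /phi /l /r /a /b => lat oY bY pY pq.
  have L := lat false; have R := lat true; clear lat.
  clear phi psi l r aff affE cst c1 c2.
  (* All relative positions of the two squares. A diagonal cell at the far end meets [q] in a
     corner, which lies on a lateral side that is retained thanks to the first implication of
     [removable]. *)
  by case: Hi => [[Ei Ex]|Ei|[Ei Ex]]; case: Hj => [[Ej Ey]|Ej|[Ej Ey]]; subst i j;
    rewrite ?addr0 in pY pq; case: (s) L R oY bY => /= L R oY bY; rewrite ?Ex ?Ey;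
    solve [ by rewrite -surjective_pairing eqxx in pq | by case/negP: oY
    | constructor 2; split; [exact: pY || exact: (L.1 pY) | ((clear -x1 x2 y1 y2; lra) || lra) | apply/andP; split; ((clear -x1 x2 y1 y2; lra) || lra)]
    | constructor 3; split; [exact: pY || exact: (R.1 pY) | ((clear -x1 x2 y1 y2; lra) || lra) | apply/andP; split; ((clear -x1 x2 y1 y2; lra) || lra)]
    | constructor 1; split; [((clear -x1 x2 y1 y2; lra) || lra) | apply/andP; split; ((clear -x1 x2 y1 y2; lra) || lra)]].
- move=> [x y] Hw; apply/plane_setP; case: Hw => /=.
  + move=> [-> /andP[x1 x2]]; exists (neighbor s q); first by rewrite !inE neighbor_neq.
    rewrite /in_square /psi /a /b.
    clear -x1 x2.
    by case: (s) => /=; rewrite ?intrD ?intrB; split; apply/andP; split; lra.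
  + move=> [lY -> /andP[y1 y2]]; exists (neighbor (lateral s false) q); first by rewrite !inE neighbor_neq.
    rewrite /in_square /psi /a /b.
    clear -y1 y2.
    by case: (s) => /=; rewrite ?intrD ?intrB; split; apply/andP; split; lra.
  + move=> [lY -> /andP[y1 y2]]; exists (neighbor (lateral s true) q); first by rewrite !inE neighbor_neq.
    rewrite /in_square /psi /a /b.
    clear -y1 y2.
    by case: (s) => /=; rewrite ?intrD ?intrB; split; apply/andP; split; lra.
Qed.

End CellSets.

(** * Connected interior versus connected adjacency graph *)

Section Regions.
Variable K : realType.

Definition strict_in (p : cell) (z : K * K) :=
  p.1%:~R < z.1 < p.1%:~R + 1 /\ p.2%:~R < z.2 < p.2%:~R + 1.

Definition center (p : cell) : K * K := (p.1%:~R + 2^-1, p.2%:~R + 2^-1).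

Definition toward (z w : K * K) (t : K) : K * K :=
  (z.1 + t * (w.1 - z.1), z.2 + t * (w.2 - z.2)).

Lemma strict_in_square p z : strict_in p z -> in_square p z.
Proof. by case=> /andP[a b] /andP[c d]; split; apply/andP; split; exact: ltW. Qed.

Lemma strict_uniq p q z : strict_in p z -> in_square q z -> q = p.
Proof.
move=> S Q; have [/andP[a b] /andP[c d]] := S.
have [i [j [-> Hi Hj]]] := square_meet Q (strict_in_square S).
have -> : i = 0 by case: Hi => [[_ E]|//|[_ E]]; exfalso; lra.
have -> : j = 0 by case: Hj => [[_ E]|//|[_ E]]; exfalso; lra.
by rewrite !addr0 -surjective_pairing.
Qed.

Lemma center_strict p : strict_in p (center p).
Proof. by split; apply/andP; split=> /=; lra. Qed.

Lemma toward_strict p z t : in_square p z -> 0 < t <= 1 -> strict_in p (toward z (center p) t).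
Proof.
move=> [/andP[a b] /andP[c d]] /andP[t0 t1]; rewrite /strict_in /toward /center /=.
set x := p.1%:~R in a b *; set y := p.2%:~R in c d *.
have key (u v : K) : u <= v -> v <= u + 1 -> u < v + t * (u + 2^-1 - v) < u + 1.
  move=> uv vu; have h1 : 0 <= (1 - t) * (v - u) by apply: mulr_ge0; lra.
  have h2 : 0 <= (1 - t) * (u + 1 - v) by apply: mulr_ge0; lra.
  by apply/andP; split; nra.
by split; apply: key.
Qed.

Lemma toward_continuous z w : continuous (toward z w).
Proof.
have ct (a b : K) : continuous (fun t : K => a + t * b).
  apply: continuous_add; first exact: cst_continuous.
  by apply: continuous_mul; [move=> t; exact: cvg_id | exact: cst_continuous].
by apply: continuous_pair; exact: ct.
Qed.

Lemma nbhs_toward z w (V : set (K * K)) : nbhs z V -> exists2 t, 0 < t <= 1 & V (toward z w t).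
Proof.
move=> zV; have cf : {for (0 : K), continuous (toward z w)}.
  exact: toward_continuous.
have E0 : toward z w 0 = z by case: z {zV cf} => x y; rewrite /toward /= !mul0r !addr0.
have : nbhs (0 : K) (toward z w @^-1` V) by apply: cf; rewrite E0.
case/nbhs_ballP=> e /= e0 He.
exists (Num.min (e / 2) 1).
  by rewrite lt_min ltr01 divr_gt0 //= ge_min lexx orbT.
apply: He; rewrite /ball /= sub0r normrN ger0_norm; last by rewrite le_min ler01 divr_ge0 // ltW.
by rewrite gt_min; apply/orP; left; lra.
Qed.

(** Any neighborhood of [z] contains points strictly inside each square through [z], and such a
    point belongs to no other square. *)
Lemma interior_square (Y : {fset cell}) c z :
  interior (plane_set Y : set (K * K)) z -> in_square c z -> c \in Y.
Proof.
move=> /(nbhs_toward (center c))[t t01 /plane_setP[p pY Hp]] Hc.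
by rewrite -(strict_uniq (toward_strict Hc t01) Hp).
Qed.

Lemma strict_interior (Y : {fset cell}) p z : p \in Y -> strict_in p z ->
  interior (plane_set Y : set (K * K)) z.
Proof.
move=> pY [/andP[a b] /andP[c d]]; apply/nbhs_ballP.
pose e := Num.min (Num.min (z.1 - p.1%:~R) (p.1%:~R + 1 - z.1))
                  (Num.min (z.2 - p.2%:~R) (p.2%:~R + 1 - z.2)).
exists e => /=; first by rewrite !lt_min !subr_gt0 a b c d.
move=> w [/= w1 w2]; apply/plane_setP; exists p => //.
move: w1 w2; rewrite /ball /= /e !lt_min !ltr_norml => /andP[/andP[h1 h2] _] /andP[_ /andP[h3 h4]].
by split; apply/andP; split; lra.
Qed.

(** If [P] failed somewhere, the squares with [P] and those without would be two closed sets
    covering the interior; the point is that they do not meet there. *)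
Lemma region_edge_connected (Y : {fset cell}) : region K Y -> edge_connected Y.
Proof.
case=> _ cU P [p0 p0Y Pp0] Pc p1 p1Y; apply: contrapT => nP1.
have Pc2 p s : p \in Y -> neighbor s p \in Y -> P p <-> P (neighbor s p).
  move=> H1 H2; split; first exact: Pc.
  by move=> H; rewrite -(neighborK s p); apply: Pc; rewrite ?neighborK.
pose U := interior (plane_set Y : set (K * K)).
pose A := [fset p in Y | `[< P p >]]%fset; pose B := [fset p in Y | ~~ `[< P p >]]%fset.
have inA p : p \in A <-> p \in Y /\ P p.
  by rewrite !inE; split=> [/andP[? /asboolP]|[-> /asboolP]].
have inB p : p \in B <-> p \in Y /\ ~ P p.
  rewrite !inE; split=> [/andP[? /negP H]|[-> H]]; first by split=> // /asboolP.
  by apply/negP => /asboolP.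
have E : U `&` plane_set A = U `&` ~` plane_set B.
  apply/seteqP; split=> z [Uz H]; split=> //; last first.
    have /plane_setP[p pY zp] := interior_subset Uz.
    apply/plane_setP; exists p => //; apply/inA; split=> //; apply: contrapT => nP.
    by apply: H; apply/plane_setP; exists p => //; apply/inB.
  move=> /plane_setP[q /inB[qY nPq] zq]; move/plane_setP: H => [p /inA[pY Pp] zp].
  have [i [j [Ep Hi Hj]]] := square_meet zp zq.
  have key (x y : cell) s : y = neighbor s x -> x \in Y -> y \in Y -> P x -> P y.
    by move=> -> xY yY; apply: Pc.
  have key2 (x y : cell) s : x = neighbor s y -> x \in Y -> y \in Y -> P x -> P y.
    by move=> -> xY yY; rewrite -Pc2.
  (* At an interior point all squares around it belong to [Y], so two squares meeting only
     diagonally are joined through a common neighbor. *)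
  have mid : (q.1 + i, q.2) \in Y.
    apply: (@interior_square _ _ z) => //; move: zq zp; rewrite Ep => -[/= z1 z2] [/= z3 z4].
    by split.
  have Pm : P (q.1 + i, q.2).
    case: Hj => [[Ej _]|Ej|[Ej _]]; last 2 first.
    - by move: Pp; rewrite Ep Ej addr0.
    - apply: (@key p _ South) => //; rewrite Ep Ej /=; congr pair; lia.
    - apply: (@key p _ North) => //; rewrite Ep Ej /=; congr pair; lia.
  apply: nPq; case: Hi => [[Ei _]|Ei|[Ei _]].
  - apply: (@key (q.1 + i, q.2) _ East) => //=; rewrite Ei /=.
    by case: (q) => x y /=; congr pair; lia.
  - by move: Pm; rewrite Ei addr0 -surjective_pairing.
  - apply: (@key (q.1 + i, q.2) _ West) => //=; rewrite Ei /=.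
    by case: (q) => x y /=; congr pair; lia.
have UE : U `&` plane_set A = U.
  apply: cU.
  - exists (center p0); split; first exact: (strict_interior p0Y (center_strict p0)).
    by apply/plane_setP; exists p0; [apply/inA | exact/strict_in_square/center_strict].
  - exists (~` plane_set B) => //; apply: closed_openC; exact: closed_plane_set.
  - by exists (plane_set A) => //; exact: closed_plane_set.
have : (U `&` plane_set A) (center p1).
  by rewrite UE; apply: (strict_interior p1Y (center_strict p1)).
rewrite E => -[_]; apply; apply/plane_setP; exists p1; first exact/inB.
exact/strict_in_square/center_strict.
Qed.

(** The trace of [C1] on [U] is open and closed, and a segment inside [U] is connected. *)
Lemma segment_clopen (U C1 C2 : set (K * K)) z w :
  open C1 -> closed C2 -> U `&` C1 = U `&` C2 ->
  (forall t, 0 <= t <= 1 -> U (toward z w t)) -> C1 z -> C1 w.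
Proof.
move=> o1 c2 E HU C1z.
have E0 : toward z w 0 = z by case: (z) => x y; rewrite /toward /= !mul0r !addr0.
have E1 : toward z w 1 = w by case: (z) => x y; case: (w) => x' y'; rewrite /toward /=; congr pair; lra.
pose S := toward z w @` `[0, 1]%classic.
have cS : connected S.
  apply: connected_continuous_connected; first exact: segment_connected.
  by apply: continuous_subspaceT; exact: toward_continuous.
have SU x : S x -> U x by case=> t; rewrite /= in_itv /= => Ht <-; apply: HU.
have Sz : S z by exists 0; rewrite ?E0 //= in_itv /= lexx ler01.
have Sw : S w by exists 1; rewrite ?E1 //= in_itv /= lexx ler01.
have ES : S `&` C1 = S.
  apply: cS; [by exists z | by exists C1 | exists C2 => //].
  apply/seteqP; split=> x [Sx Cx]; split=> //.
    have : (U `&` C2) x by rewrite -E; split=> //; apply: SU.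
    by case.
  have : (U `&` C1) x by rewrite E; split=> //; apply: SU.
  by case.
have : (S `&` C1) w by rewrite ES.
by case.
Qed.

(** A clopen part of the interior contains the whole inside of each square that it meets, passes to
    adjacent squares along the segment of centers, and so contains all insides, of which every
    interior point is a limit. *)
Lemma edge_connected_region (Y : {fset cell}) : Y != fset0 -> edge_connected Y -> region K Y.
Proof.
move=> Y0 eY; split=> // B B0 [C1 o1 EB] [C2 c2 EB'].
pose U := interior (plane_set Y : set (K * K)).
have oU : open U by exact: open_interior.
have E : U `&` C1 = U `&` C2 by rewrite -EB -EB'.
have BC z : U z -> B z <-> C1 z by move=> Uz; rewrite EB; split=> [[]|].
pose P p := forall z, strict_in p z -> C1 z.
have seg_in p z w t : strict_in p z -> strict_in p w -> 0 <= t <= 1 -> strict_in p (toward z w t).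
  move=> [/andP[a b] /andP[c d]] [/andP[a' b'] /andP[c' d']] /andP[t0 t1].
  rewrite /strict_in /toward /=.
  have key (u v x : K) : u < v < u + 1 -> u < x < u + 1 -> u < v + t * (x - v) < u + 1.
    move=> /andP[h1 h2] /andP[h3 h4].
    have g1 : 0 <= t * (x - u) by apply: mulr_ge0; lra.
    have g2 : 0 <= (1 - t) * (v - u) by apply: mulr_ge0; lra.
    have g3 : 0 <= t * (u + 1 - x) by apply: mulr_ge0; lra.
    have g4 : 0 <= (1 - t) * (u + 1 - v) by apply: mulr_ge0; lra.
    case: (ltP 0 t) => [tp|tn].
      have g5 : 0 < t * (x - u) by apply: mulr_gt0; lra.
      have g6 : 0 < t * (u + 1 - x) by apply: mulr_gt0; lra.
      by apply/andP; split; nra.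
    have -> : t = 0 by lra.
    by rewrite mul0r addr0 h1 h2.
  by split; apply: key; apply/andP.
have P1 p z : p \in Y -> strict_in p z -> C1 z -> P p.
  move=> pY Sz Cz w Sw; apply: (segment_clopen o1 c2 E _ Cz) => t t01.
  exact/(strict_interior pY)/seg_in.
have near z (V : set (K * K)) : U z -> nbhs z V -> exists p z', [/\ p \in Y, strict_in p z' & V z'].
  move=> Uz Vz; have /plane_setP[p pY zp] := interior_subset Uz.
  have [t t01 Vt] := nbhs_toward (center p) Vz.
  by exists p, (toward z (center p) t); split=> //; apply: toward_strict.
have allP : forall p, p \in Y -> P p.
  apply: eY.
    have [z Bz] := B0; have [Uz C1z] : (U `&` C1) z by rewrite -EB.
    have [p [z' [pY Sz' C1z']]] := near z C1 Uz (open_nbhs_nbhs (conj o1 C1z)).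
    by exists p => //; apply: P1 Sz' C1z'.
  move=> p s pY nY Pp; apply: (P1 _ _ nY (center_strict _)).
  apply: (segment_clopen o1 c2 E _ (Pp _ (center_strict p))) => t /andP[t0 t1].
  (* Each point of the segment between two adjacent centers is at distance at least 1/2 from the
     outside of the two squares. *)
  apply/nbhs_ballP; exists 2^-1 => //=.
  move=> w [/= w1 w2]; move: w1 w2; rewrite /ball /= !ltr_norml => /andP[h1 h2] /andP[h3 h4].
  apply/plane_setP; case: s nY h1 h2 h3 h4 => /= nY; rewrite ?intrD ?intrB => h1 h2 h3 h4.
  + case: (leP w.1 (p.1%:~R + 1)) => Hw; [exists p => // | exists (p.1 + 1, p.2) => //];
      split=> /=; rewrite ?intrD; apply/andP; split; lra.
  + case: (leP w.2 (p.2%:~R + 1)) => Hw; [exists p => // | exists (p.1, p.2 + 1) => //];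
      split=> /=; rewrite ?intrD; apply/andP; split; lra.
  + case: (leP (p.1%:~R) w.1) => Hw; [exists p => // | exists (p.1 - 1, p.2) => //];
      split=> /=; rewrite ?intrB; apply/andP; split; lra.
  + case: (leP (p.2%:~R) w.2) => Hw; [exists p => // | exists (p.1, p.2 - 1) => //];
      split=> /=; rewrite ?intrB; apply/andP; split; lra.
rewrite EB'; apply/seteqP; split=> [z []//|z Uz]; split=> //; apply: contrapT => nC2.
have [p [z' [pY Sz' [nC2z' Uz']]]] := near z (~` C2 `&` U) Uz
  (filterI (open_nbhs_nbhs (conj (closed_openC c2) nC2)) (open_nbhs_nbhs (conj oU Uz))).
have : (U `&` C1) z' by split=> //; apply: (allP p pY).
by rewrite E => -[].
Qed.

End Regions.

(** * A simply connected set has no pinch at a vertex: parity of crossings *)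

Section Pinch.
Variable K : realType.

(** Heine-Cantor on the unit square. Compactness is used in its filter form, with the radius [d]
    tending to 0 from the right. *)
Lemma uniformly_continuous_square (H : K * K -> K * K) (e : K) : 0 < e ->
  {within `[0, 1]%classic `*` `[0, 1]%classic, continuous H} ->
  exists2 d : K, 0 < d & forall z w : K * K, (`[0, 1]%classic `*` `[0, 1]%classic) z ->
    (`[0, 1]%classic `*` `[0, 1]%classic) w -> ball z d w -> ball (H z) e (H w).
Proof.
set Q := _ `*` _ => e0 /subspace_continuousP cH.
have cQ : compact (Q : set (K * K)) by apply: compact_setX; exact: segment_compact.
have := (compact_near_coveringP Q).1 cQ K (0 : K)^'+
  (fun d z => Q z -> forall w, Q w -> ball z d w -> ball (H z) e (H w)) _.
case=> [x Qx|d /= d0 Hd].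
  have e20 : 0 < e / 2 by rewrite divr_gt0.
  have /nbhs_ballP[r /= r0 Hr] := cH x Qx _ (nbhsx_ballx (H x) _ e20).
  have r20 : 0 < r / 2 by rewrite divr_gt0.
  exists (ball x (r / 2), [set d | d < r / 2]).
    by split; [exact: nbhsx_ballx | exact: nbhs_right_lt].
  - move=> [z d] [/= xz dr] Qz w Qw zw.
    have Hz : ball (H x) (e / 2) (H z).
      by apply: Hr => //; apply: le_ball xz; lra.
    have Hw : ball (H x) (e / 2) (H w).
      apply: Hr => //; rewrite [r]splitr; apply: ball_triangle xz _.
      by apply: le_ball zw; exact: ltW.
    by rewrite [e]splitr; apply: ball_triangle (ball_sym Hz) Hw.
exists (d / 2); first by rewrite divr_gt0.
move=> z w Qz Qw zw; apply: (Hd (d / 2) _ _ z Qz Qz w Qw zw) => /=.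
  by rewrite sub0r normrN ger0_norm ?divr_ge0 ?ltW //; lra.
by rewrite divr_gt0.
Qed.

(** The relations of the squares of one row telescope: two consecutive horizontal lines have the
    same parity because the outer vertical sides vanish, and the last line carries nothing. *)
Lemma grid_parity (n : nat) (h v : nat -> nat -> bool) :
  (forall i j, (i < n)%N -> (j < n)%N -> h i j (+) v i.+1 j (+) h i j.+1 (+) v i j = false) ->
  (forall j, (j < n)%N -> v 0 j = false /\ v n j = false) ->
  (forall i, (i < n)%N -> h i n = false) ->
  \big[addb/false]_(i < n) h i 0 = false.
Proof.
move=> Hsq Hv Hn.
have row j k : (j < n)%N -> (k <= n)%N ->
    \big[addb/false]_(i < k) h i j (+) \big[addb/false]_(i < k) h i j.+1 = v k j (+) v 0 j.
  move=> jn; elim: k => [|k IH] kn; first by rewrite !big_ord0; case: (v 0 j).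
  have := IH (ltnW kn); have := Hsq k j kn jn; rewrite !big_ord_recr /=.
  move: (bigop _ _ _) (bigop _ _ _) => u w.
  by case: u; case: w; case: (h k j); case: (h k j.+1); case: (v k j); case: (v k.+1 j); case: (v 0 j).
have all_rows j : (j <= n)%N -> \big[addb/false]_(i < n) h i 0 = \big[addb/false]_(i < n) h i j.
  elim: j => // j IH jn; rewrite (IH (ltnW jn)).
  have := row j n jn (leqnn n); have [-> ->] := Hv j jn.
  by move: (bigop _ _ _) (bigop _ _ _) => [] [].
rewrite (all_rows n (leqnn n)); apply: big1 => i _; exact: Hn.
Qed.

Section Cross.
Variables (X : set (K * K)) (x y eps : K).
Hypothesis eps1 : eps = 1 \/ eps = -1.

Let eps2 : eps * eps = 1.
Proof. by case: eps1 => ->; rewrite ?mulr1 ?mulrNN ?mulr1. Qed.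

Definition near_vertex (z : K * K) : bool := (`|z.1 - x| < 2^-1) && (`|z.2 - y| < 2^-1).
(** The sign [eps] selects the diagonal on which the two squares touch: up-right and down-left for
    1, down-right and up-left for -1. The vertex itself is on the first side, so a path arriving
    there from the second side crosses once. *)
Definition first_side (z : K * K) : bool := (0 <= z.1 - x) && (0 <= eps * (z.2 - y)).
Definition crosses (z w : K * K) : bool :=
  [&& near_vertex z, near_vertex w & first_side z != first_side w].

Hypothesis Xnear : forall z, X z -> near_vertex z -> ~~ first_side z ->
  z.1 - x <= 0 /\ eps * (z.2 - y) <= 0.

(** Points on different sides have offsets of opposite signs in both coordinates, so each offset is
    bounded by the distance between the points. *)
Lemma crosses_close z w : X z -> X w -> ball z 8^-1 w -> crosses z w ->
  `|z.1 - x| <= 8^-1 /\ `|z.2 - y| <= 8^-1.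
Proof.
wlog Hz : z w / first_side z.
  move=> W Xz Xw zw C; have [nz nw fzw] := and3P C.
  case Ez: (first_side z); first exact: (W z w).
  have Ew : first_side w by move: fzw; rewrite Ez; case: first_side.
  have C' : crosses w z by rewrite /crosses nw nz eq_sym.
  have [z1 z2] := Xnear Xz nz (negbT Ez).
  case/andP: Ew => w1 w2; case: zw => /=; rewrite /ball /= !ltr_norml => /andP[h1 h2] /andP[h3 h4].
  by rewrite !ler_norml; case: eps1 => E; rewrite E in w2 z2; split; apply/andP; split; lra.
move=> Xz Xw zw /and3P[nz nw]; rewrite Hz => fw.
have [w1 w2] := Xnear Xw nw ltac:(by case: first_side fw).
case/andP: Hz => z1 z2; case: zw => /=; rewrite /ball /= !ltr_norml => /andP[h1 h2] /andP[h3 h4].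
by rewrite !ler_norml; case: eps1 => E; rewrite E in w2 z2; split; apply/andP; split; lra.
Qed.

Lemma near_close z w : `|z.1 - x| <= 8^-1 /\ `|z.2 - y| <= 8^-1 -> ball z 4^-1 w -> near_vertex w.
Proof.
rewrite /near_vertex !ler_norml => -[/andP[a b] /andP[c d]] [/=]; rewrite /ball /= !ltr_norml.
by move=> /andP[h1 h2] /andP[h3 h4]; apply/andP; split; apply/andP; split; lra.
Qed.

(** If all four points are near the vertex, a tour changes side an even number of times. Otherwise
    nothing crosses: a crossing puts a point within 1/8 of the vertex, hence all four within 1/8 +
    1/4 < 1/2. *)
Lemma square_crosses z1 z2 z3 z4 : X z1 -> X z2 -> X z3 -> X z4 ->
  ball z1 8^-1 z2 -> ball z2 8^-1 z3 -> ball z4 8^-1 z3 -> ball z1 8^-1 z4 ->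
  crosses z1 z2 (+) crosses z2 z3 (+) crosses z4 z3 (+) crosses z1 z4 = false.
Proof.
move=> X1 X2 X3 X4 b12 b23 b43 b14.
case: (boolP [&& near_vertex z1, near_vertex z2, near_vertex z3 & near_vertex z4]).
  case/and4P=> n1 n2 n3 n4; rewrite /crosses n1 n2 n3 n4 /=.
  by case: (first_side z1); case: (first_side z2); case: (first_side z3); case: (first_side z4).
move=> nn.
have s8 : 8^-1 + 8^-1 = 4^-1 :> K by lra.
have w8 (z w : K * K) : ball z 8^-1 w -> ball z 4^-1 w by apply: le_ball; lra.
have self (z : K * K) : ball z 4^-1 z by apply: ballxx; lra.
have tri (u v w : K * K) : ball u 8^-1 v -> ball v 8^-1 w -> ball u 4^-1 w.
  by move=> H1 H2; rewrite -s8; exact: ball_triangle H1 H2.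
have F (u : K * K) : (`|u.1 - x| <= 8^-1 /\ `|u.2 - y| <= 8^-1) ->
    ball u 4^-1 z1 -> ball u 4^-1 z2 -> ball u 4^-1 z3 -> ball u 4^-1 z4 -> False.
  by move=> Hu u1 u2 u3 u4; case/negP: nn; apply/and4P; split; apply: near_close Hu _.
have -> : crosses z1 z2 = false.
  apply/negP => /(crosses_close X1 X2 b12) C; apply: (F _ C); eauto.
have -> : crosses z2 z3 = false.
  apply/negP => /(crosses_close X2 X3 b23) C; apply: (F _ C); eauto using ball_sym.
have -> : crosses z4 z3 = false.
  apply/negP => /(crosses_close X4 X3 b43) C; apply: (F _ C); eauto using ball_sym.
have -> // : crosses z1 z4 = false.
apply/negP => /(crosses_close X1 X4 b14) C; apply: (F _ C); eauto.
Qed.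

Hypothesis HX : simply_connected K X.
Hypothesis diag1 : forall t, 0 <= t <= 2^-1 -> X (x + t, y + eps * t).
Hypothesis diag2 : forall t, 0 <= t <= 2^-1 -> X (x - t, y - eps * t).
Variable gam : K -> K * K.
Hypotheses (cgam : {within `[0, 1]%classic, continuous gam})
  (gamX : forall s, 0 <= s <= 1 -> X (gam s))
  (gam0 : gam 0 = (x + 2^-1, y + eps * 2^-1)) (gam1 : gam 1 = (x - 2^-1, y - eps * 2^-1))
  (gam_far : forall s, 0 <= s <= 1 -> ~~ near_vertex (gam s)).

Definition pinch_loop (s : K) : K * K :=
  if s <= 4^-1 then (x + 2 * s, y + eps * (2 * s))
  else if s <= 3 / 4 then gam (2 * s - 2^-1)
  else (x - 2 * (1 - s), y - eps * (2 * (1 - s))).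

Lemma loop_mid s : 4^-1 <= s <= 3 / 4 -> pinch_loop s = gam (2 * s - 2^-1).
Proof.
move=> /andP[s1 s2]; rewrite /pinch_loop; case: leP => [s3|_]; last by rewrite s2.
have -> : s = 4^-1 by apply/eqP; rewrite eq_le s3.
have -> : 2 * 4^-1 - 2^-1 = 0 :> K by lra.
by rewrite gam0; congr (_ + _, _ + _ * _); lra.
Qed.

Lemma loop_end s : 3 / 4 <= s -> pinch_loop s = (x - 2 * (1 - s), y - eps * (2 * (1 - s))).
Proof.
move=> s1; rewrite /pinch_loop; case: leP => [s3|_]; first by exfalso; lra.
case: leP => // s2; have -> : s = 3 / 4 by apply/eqP; rewrite eq_le s2.
have -> : 2 * (3 / 4) - 2^-1 = 1 :> K by lra.
by rewrite gam1; congr (_ - _, _ - _ * _); lra.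
Qed.

Lemma loop_in s : 0 <= s <= 1 -> X (pinch_loop s).
Proof.
move=> /andP[s0 s1]; case: (leP s 4^-1) => H1.
  by rewrite /pinch_loop H1; apply: diag1; apply/andP; split; lra.
case: (leP s (3 / 4)) => H2.
  by rewrite loop_mid; [apply: gamX | ]; apply/andP; split; lra.
by rewrite loop_end; [apply: diag2; apply/andP; split | ]; lra.
Qed.

Lemma loop_continuous : {within `[0, 1]%classic, continuous pinch_loop}.
Proof.
have -> : `[0, 1]%classic = `[0, 4^-1]%classic `|` (`[4^-1, 3 / 4]%classic `|` `[3 / 4, 1]%classic) :> set K.
  apply/seteqP; split=> s; rewrite /= !in_itv /=.
    move=> /andP[s0 s1]; case: (leP s 4^-1) => H1; first by left; rewrite s0.
    by right; case: (leP s (3 / 4)) => H2; [left | right]; apply/andP; split=> //; exact: ltW.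
  by case=> [|[]] /andP[h1 h2]; apply/andP; split; lra.
have aff (a b : K) : continuous (fun s : K => a * s + b).
  apply: continuous_add; last exact: cst_continuous.
  by apply: continuous_mul; [exact: cst_continuous | move=> s; exact: cvg_id].
have affE (f g : K -> K) : continuous f -> f =1 g -> continuous g by move=> cf /funext <-.
apply: withinU_continuous; [exact: itv_closed | by apply: closedU; exact: itv_closed | |].
  apply: (@within_eq _ _ _ (fun s : K => (x + 2 * s, y + eps * (2 * s)) : K * K)).
    by move=> s; rewrite /= in_itv /= /pinch_loop => /andP[_ ->].
  apply: continuous_subspaceT; apply: continuous_pair.
    by apply: (affE _ _ (aff 2 x)) => s; ring.
  by apply: (affE _ _ (aff (2 * eps) y)) => s; ring.
apply: withinU_continuous; [exact: itv_closed | exact: itv_closed | |].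
  apply: (@within_eq _ _ _ (gam \o (fun s : K => 2 * s + (- 2^-1)))).
    by move=> s; rewrite /= in_itv /= => Hs; rewrite loop_mid.
  apply: (within_compose _ _ cgam); first by apply: continuous_subspaceT; exact: aff.
  by move=> s; rewrite /= !in_itv /= => /andP[h1 h2]; apply/andP; split; lra.
apply: (@within_eq _ _ _ (fun s : K => (x - 2 * (1 - s), y - eps * (2 * (1 - s))) : K * K)).
  by move=> s; rewrite /= in_itv /= => /andP[h1 h2]; rewrite loop_end.
apply: continuous_subspaceT; apply: continuous_pair.
  by apply: (affE _ _ (aff 2 (x - 2))) => s; ring.
by apply: (affE _ _ (aff (2 * eps) (y - 2 * eps))) => s; ring.
Qed.

(** The first quarter stays on the first side, the middle half is never near the vertex, and the
    last quarter stays on the second side until its final point, the vertex. With [1 < m] the last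
    step is short enough to start near the vertex. *)
Lemma loop_crosses (m i : nat) : (1 < m)%N -> (i < 4 * m)%N ->
  crosses (pinch_loop (i%:R / (4 * m)%:R)) (pinch_loop (i.+1%:R / (4 * m)%:R)) = (i.+1 == 4 * m)%N.
Proof.
move=> m1 im; set n := (4 * m)%:R : K.
have n0 : 0 < n by rewrite ltr0n; lia.
pose s : K := i%:R / n; pose s' : K := i.+1%:R / n.
have ss : s' = s + n^-1 by rewrite /s' /s -natr1 mulrDl mul1r.
have ni : 0 < n^-1 by rewrite invr_gt0.
have n8 : n^-1 <= 8^-1.
  rewrite lef_pV2 ?posrE //.
  by have := ler_nat K 8 (4 * m); rewrite -/n => ->; lia.
have s0 : 0 <= s by rewrite divr_ge0 ?ler0n // ltW.
have s1 : s' <= 1 by rewrite ler_pdivrMr // mul1r ler_nat.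
rewrite -/s -/s'.
have [ia|ia] := leqP (4 * i.+1) (4 * m).
  have h : s' <= 4^-1 by rewrite ler_pdivrMr // /n natrM mulKf ?pnatr_eq0 // ler_nat; lia.
  have -> : (i.+1 == 4 * m)%N = false by lia.
  rewrite /pinch_loop (_ : s <= 4^-1) ?h; last by lra.
  rewrite /crosses /first_side /=.
  have e1 (u : K) : x + 2 * u - x = 2 * u by ring.
  have e2 (u : K) : eps * (y + eps * (2 * u) - y) = (eps * eps) * (2 * u) by ring.
  have p1 : 0 <= 2 * s by lra.
  have p2 : 0 <= 2 * s' by lra.
  by rewrite !e1 !e2 eps2 !mul1r p1 p2 eqxx !andbF.
have [ib|ib] := leqP i (3 * m).
  have h1 : 4^-1 <= s by rewrite ler_pdivlMr // /n natrM mulKf ?pnatr_eq0 // ler_nat; lia.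
  have h2 : s <= 3 / 4.
    rewrite ler_pdivrMr // /n natrM mulrA divfK ?pnatr_eq0 // -natrM ler_nat; lia.
  have -> : (i.+1 == 4 * m)%N = false by lia.
  rewrite /crosses loop_mid ?h1 //; apply/negP => /and3P[nz _ _].
  by have := gam_far (s := 2 * s - 2^-1) ltac:(apply/andP; split; lra); rewrite nz.
have h3 : 3 / 4 <= s.
  rewrite ler_pdivlMr // /n natrM mulrA divfK ?pnatr_eq0 // -natrM ler_nat; lia.
rewrite (loop_end h3) (@loop_end s'); last by lra.
have slt : s < 1 by lra.
rewrite /crosses /first_side /near_vertex /=.
have e1 (u : K) : x - 2 * (1 - u) - x = - (2 * (1 - u)) by ring.
have e2 (u : K) : y - eps * (2 * (1 - u)) - y = - (eps * (2 * (1 - u))) by ring.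
have e3 (u : K) : eps * - (eps * (2 * (1 - u))) = - ((eps * eps) * (2 * (1 - u))) by ring.
rewrite !e1 !e2 !e3 eps2 !mul1r.
have -> : (0 <= - (2 * (1 - s))) = false by apply/negbTE; rewrite -ltNge; lra.
case: (eqVneq i.+1 (4 * m)%N) => [E|Hne].
  have E1 : s' = 1 by rewrite /s' E divff // gt_eqF.
  have -> : 1 - s = n^-1 by rewrite -E1 ss; ring.
  rewrite E1 subrr !mulr0 oppr0 lexx !normrN normr0 /=.
  have ne : `|eps * (2 * n^-1)| = 2 * n^-1.
    have ne1 : `|eps| = 1 by case: eps1 => ->; rewrite ?normrN1 ?normr1.
    by rewrite normrM ne1 mul1r ger0_norm // mulr_ge0 // ltW.
  rewrite ne ger0_norm ?mulr_ge0 ?ltW //.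
  have -> : 2 * n^-1 < 2^-1 by lra.
  by rewrite invr_gt0 ltr0n.
have s'1 : s' < 1 by rewrite ltr_pdivrMr // mul1r ltr_nat; lia.
have -> : (0 <= - (2 * (1 - s'))) = false by apply/negbTE; rewrite -ltNge; lra.
by rewrite eqxx !andbF.
Qed.

(** A contraction of the loop is sampled on a fine grid. The line of the loop has exactly one
    crossing, whereas [grid_parity] makes their number even. *)
Lemma pinch_false : False.
Proof.
have [_ _ /(_ pinch_loop loop_continuous)] := HX.
have E0 : pinch_loop 0 = (x, y).
  by rewrite /pinch_loop (_ : 0 <= 4^-1 :> K) ?mulr0 ?addr0 //; lra.
have E1 : pinch_loop 1 = (x, y).
  by rewrite loop_end ?subrr ?mulr0 ?subr0 //; lra.
case=> [_ [s Hs <-]||H [cH HsX H0 H1 Hb]]; [|by rewrite E0 E1|].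
  by apply: loop_in; move: Hs; rewrite /= in_itv.
have [|d d0 Hd] := @uniformly_continuous_square H 8^-1 _ cH; first by lra.
(* The mesh lies below the modulus of continuity, and the number of steps is a multiple of 4 so that
   the breakpoints of the loop are sampled. *)
have [m m1 md] : exists2 m : nat, (1 < m)%N & ((4 * m)%:R)^-1 < d.
  exists (Num.bound d^-1 + 2)%N; first by lia.
  have := archi_boundP (ltW (_ : 0 < d^-1)); rewrite invr_gt0 => /(_ d0) B.
  rewrite invf_plt ?posrE ?ltr0n ?addn2 //; apply: (lt_le_trans B); rewrite ler_nat; lia.
set n := (4 * m)%N in md.
have n0 : 0 < n%:R :> K by rewrite ltr0n /n; lia.
pose c (i : nat) : K := i%:R / n%:R.
have c01 i : (i <= n)%N -> 0 <= c i <= 1.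
  by move=> Hi; rewrite /c divr_ge0 ?ler0n //= ler_pdivrMr // mul1r ler_nat.
have cS i : c i.+1 = c i + n%:R^-1 by rewrite /c -natr1 mulrDl mul1r.
have ni : 0 < (n%:R : K)^-1 by rewrite invr_gt0.
pose z i j := H (c i, c j).
have inQ i j : (i <= n)%N -> (j <= n)%N -> (`[0, 1]%classic `*` `[0, 1]%classic) (c i, c j).
  by move=> Hi Hj; split; rewrite /= in_itv /=; apply: c01.
have zX i j : (i <= n)%N -> (j <= n)%N -> X (z i j).
  by move=> Hi Hj; apply: HsX; exists (c i, c j) => //; apply: inQ.
have b1 i j : (i < n)%N -> (j <= n)%N -> ball (z i j) 8^-1 (z i.+1 j).
  move=> Hi Hj; apply: Hd; [exact: inQ (ltnW Hi) Hj | exact: inQ |].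
  split=> /=; last exact: ballxx.
  by rewrite cS /ball /= opprD addrA subrr sub0r normrN ger0_norm // ltW.
have b2 i j : (i <= n)%N -> (j < n)%N -> ball (z i j) 8^-1 (z i j.+1).
  move=> Hi Hj; apply: Hd; [exact: inQ Hi (ltnW Hj) | exact: inQ |].
  split=> /=; first exact: ballxx.
  by rewrite cS /ball /= opprD addrA subrr sub0r normrN ger0_norm // ltW.
have cross0 w : crosses w w = false by rewrite /crosses eqxx !andbF.
have c0 : c 0 = 0 by rewrite /c mul0r.
have cn : c n = 1 by rewrite /c divff // gt_eqF.
have : \big[addb/false]_(i < n) crosses (z i 0) (z i.+1 0) = false.
  apply: (@grid_parity n (fun i j => crosses (z i j) (z i.+1 j)) (fun i j => crosses (z i j) (z i j.+1))).
- move=> i j Hi Hj; apply: square_crosses; try apply: zX; try exact: ltnW; try by [].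
  + by apply: b1 => //; exact: ltnW.
  + exact: b2.
  + exact: b1.
  + by apply: b2 => //; exact: ltnW.
- move=> j Hj; rewrite /z c0 cn.
  have [-> ->] := Hb _ (c01 j (ltnW Hj)); have [-> ->] := Hb _ (c01 j.+1 Hj).
  by rewrite cross0.
- move=> i Hi; rewrite /z cn H1; last exact: c01 (ltnW Hi).
  by rewrite H1 ?cross0 //; exact: c01.
have Eb (i : 'I_n) : crosses (z i 0) (z i.+1 0) = (i.+1 == n)%N.
  rewrite /z c0 H0; last exact: c01 (ltnW (ltn_ord i)).
  by rewrite H0; [exact: loop_crosses | exact: c01].
under eq_bigr do rewrite Eb.
have [k Ek] : exists k, n = k.+1 by exists n.-1; rewrite /n; lia.
rewrite Ek big_ord_recr /= eqxx big1 //= => i _.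
by rewrite eqSS ltn_eqF.
Qed.

End Cross.
End Pinch.

(** * Paths away from lattice points, and the absence of pinches in a region *)

Section FarPaths.
Variable K : realType.

Definition far (z : K * K) := forall a b : int, 2^-1 <= `|z.1 - a%:~R| \/ 2^-1 <= `|z.2 - b%:~R|.

Lemma half_far (k a : int) : 2^-1 <= `|(k%:~R + 2^-1 : K) - a%:~R|.
Proof.
have [H|H] : a <= k \/ k + 1 <= a by lia.
  have : a%:~R <= k%:~R :> K by rewrite ler_int.
  by move=> H'; rewrite ger0_norm; lra.
have : (k + 1)%:~R <= a%:~R :> K by rewrite ler_int.
by rewrite intrD => H'; rewrite ler0_norm; lra.
Qed.

Definition far_path (Y : {fset cell}) (p q : cell) := exists g : K -> K * K,
  [/\ {within `[0, 1]%classic, continuous g},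
      forall s, 0 <= s <= 1 -> plane_set Y (g s) /\ far (g s), g 0 = center K p & g 1 = center K q].

Lemma center_segment Y p s t : p \in Y -> neighbor s p \in Y -> 0 <= t <= 1 ->
  plane_set Y (toward (center K p) (center K (neighbor s p)) t) /\
  far (toward (center K p) (center K (neighbor s p)) t).
Proof.
move=> pY nY /andP[t0 t1].
have half (u : K) : u + t * (u - u) = u by ring.
split.
  apply/plane_setP; case: (leP t 2^-1) => Ht; [exists p => // | exists (neighbor s p) => //].
    rewrite /in_square /toward /center.
    by case: s nY => /= nY; rewrite ?intrD ?intrB; split; apply/andP; split; nra.
  rewrite /in_square /toward /center.
  by case: s nY => /= nY; rewrite ?intrD ?intrB; split; apply/andP; split; nra.
by move=> a b; rewrite /toward /center; case: s nY => /= nY; rewrite !half;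
  [right | left | right | left]; exact: half_far.
Qed.

(** On the segment joining the centers of adjacent cells one coordinate is constantly a
    half-integer. The induction principle [edge_connected] appends these segments one by one. *)
Lemma far_path_ex Y p q : edge_connected Y -> p \in Y -> q \in Y -> far_path Y p q.
Proof.
move=> eY pY; move: q; apply: eY.
  exists p => //; exists (fun=> center K p); split=> //.
    by apply: continuous_subspaceT; exact: cst_continuous.
  move=> s _; split.
    by apply/plane_setP; exists p => //; apply/strict_in_square/center_strict.
  by move=> a b; left; exact: half_far.
move=> q s qY nY [g [cg gY g0 g1]].
pose h := toward (center K q) (center K (neighbor s q)).
have h0 : h 0 = center K q by rewrite /h /toward !mul0r !addr0 -surjective_pairing.
have h1 : h 1 = center K (neighbor s q).
  by rewrite /h /toward !mul1r !(addrC (center K q).1) !(addrC (center K q).2) !subrK -surjective_pairing.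
pose f (u : K) := if u <= 2^-1 then g (2 * u) else h (2 * u - 1).
have fl (u : K) : u <= 2^-1 -> f u = g (2 * u) by rewrite /f => ->.
have fr (u : K) : 2^-1 <= u -> f u = h (2 * u - 1).
  move=> u2; rewrite /f; case: (boolP (u <= 2^-1)) => // u1.
  have -> : u = 2^-1 by apply/eqP; rewrite eq_le u1 u2.
  have -> : 2 * 2^-1 = 1 :> K by lra.
  by rewrite subrr h0 g1.
have aff (a b : K) : continuous (fun u : K => a * u + b).
  apply: continuous_add; last exact: cst_continuous.
  by apply: continuous_mul; [exact: cst_continuous | move=> u; exact: cvg_id].
exists f; split.
- have -> : `[0, 1]%classic = `[0, 2^-1]%classic `|` `[2^-1, 1]%classic :> set K.
    apply/seteqP; split=> u; rewrite /= !in_itv /=.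
      move=> /andP[u0 u1]; case: (leP u 2^-1) => H; first by left; rewrite u0.
      by right; apply/andP; split=> //; exact: ltW.
    by case=> /andP[? ?]; apply/andP; split; lra.
  apply: withinU_continuous; [exact: itv_closed | exact: itv_closed | |].
    apply: (@within_eq _ _ _ (g \o (fun u : K => 2 * u + 0))).
      by move=> u; rewrite /= in_itv /= addr0 => /andP[_ H]; rewrite fl.
    apply: (within_compose _ _ cg); first by apply: continuous_subspaceT; exact: aff.
    by move=> u; rewrite /= !in_itv /= => /andP[? ?]; apply/andP; split; lra.
  apply: (@within_eq _ _ _ (h \o (fun u : K => 2 * u + (-1)))).
    by move=> u; rewrite /= in_itv /= => /andP[H _]; rewrite fr.
  apply: continuous_subspaceT => u; apply: continuous_comp; first exact: aff.
  exact: toward_continuous.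
- move=> u /andP[u0 u1]; case: (leP u 2^-1) => H.
    by rewrite fl //; apply: gY; apply/andP; split; lra.
  rewrite fr; last exact: ltW.
  by apply: center_segment => //; apply/andP; split; lra.
- by rewrite fl ?mulr0 //; lra.
- rewrite fr; last lra.
  by have -> : 2 * 1 - 1 = 1 :> K by lra.
Qed.

(** Two cells meeting only at [(x, y)] would be joined by a path staying away from that vertex;
    closing it through the vertex gives the loop excluded by [pinch_false]. *)
Lemma no_pinch (Y : {fset cell}) (x y : int) : simply_connected_region K Y ->
  ((x, y) \in Y -> (x - 1, y - 1) \in Y -> (x - 1, y) \in Y \/ (x, y - 1) \in Y) /\
  ((x, y - 1) \in Y -> (x - 1, y) \in Y -> (x, y) \in Y \/ (x - 1, y - 1) \in Y).
Proof.
move=> [/region_edge_connected eY scY].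
have nearP (z : K * K) : plane_set Y z -> near_vertex x%:~R y%:~R z ->
    [\/ ((x, y) \in Y) /\ (0 <= z.1 - x%:~R) && (0 <= z.2 - y%:~R),
        ((x - 1, y) \in Y) /\ (z.1 - x%:~R <= 0) && (0 <= z.2 - y%:~R),
        ((x, y - 1) \in Y) /\ (0 <= z.1 - x%:~R) && (z.2 - y%:~R <= 0) |
        ((x - 1, y - 1) \in Y) /\ (z.1 - x%:~R <= 0) && (z.2 - y%:~R <= 0)].
  move=> /plane_setP[[a b] pY [/= /andP[h1 h2] /andP[h3 h4]]] /andP[].
  rewrite !ltr_norml => /andP[h5 h6] /andP[h7 h8].
  have A1 : a < x + 1 by rewrite -(ltr_int K) intrD; lra.
  have A2 : x < a + 2 by rewrite -(ltr_int K) intrD; lra.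
  have B1 : b < y + 1 by rewrite -(ltr_int K) intrD; lra.
  have B2 : y < b + 2 by rewrite -(ltr_int K) intrD; lra.
  have [Ea|Ea] : a = x \/ a = x - 1 by lia.
    have [Eb|Eb] : b = y \/ b = y - 1 by lia.
      by subst a b; constructor 1; split=> //; apply/andP; split; lra.
    by subst a b; rewrite intrB in h3 h4; constructor 3; split=> //; apply/andP; split; lra.
  have [Eb|Eb] : b = y \/ b = y - 1 by lia.
    by subst a b; rewrite intrB in h1 h2; constructor 2; split=> //; apply/andP; split; lra.
  by subst a b; rewrite !intrB in h1 h2 h3 h4; constructor 4; split=> //; apply/andP; split; lra.
have notnear (g : K -> K * K) : (forall s, 0 <= s <= 1 -> plane_set Y (g s) /\ far (g s)) ->
    forall s, 0 <= s <= 1 -> ~~ near_vertex x%:~R y%:~R (g s).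
  move=> gY s /gY[_ /(_ x y)]; rewrite /near_vertex negb_and -!leNgt.
  by case=> ->; rewrite ?orbT.
have diag (a b : int) (z : K * K) : (a, b) \in Y ->
    a%:~R <= z.1 <= a%:~R + 1 -> b%:~R <= z.2 <= b%:~R + 1 -> plane_set Y z.
  by move=> H h1 h2; apply/plane_setP; exists (a, b).
split=> Hp Hd; apply: contrapT => /not_orP[n1 n2].
- have [g [cg gY g0 g1]] := far_path_ex eY Hp Hd.
  apply: (@pinch_false K (plane_set Y) x%:~R y%:~R 1 _ _ scY _ _ g cg _ _ _ (notnear g gY)).
  + by left.
  + move=> z Xz nz; rewrite /first_side mul1r.
    by case: (nearP z Xz nz) => -[H //]; rewrite ?H // => /andP[-> ->].
  + by move=> t /andP[t0 t1]; apply: (diag x y) => //=; apply/andP; split; lra.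
  + move=> t /andP[t0 t1]; apply: (diag (x - 1) (y - 1)) => //=; rewrite !intrB;
      apply/andP; split; lra.
  + by move=> s /gY[].
  + by rewrite g0 mul1r.
  + by rewrite g1 /center /= !intrB mul1r; congr pair; lra.
- have [g [cg gY g0 g1]] := far_path_ex eY Hp Hd.
  apply: (@pinch_false K (plane_set Y) x%:~R y%:~R (-1) _ _ scY _ _ g cg _ _ _ (notnear g gY)).
  + by right.
  + move=> z Xz nz; rewrite /first_side mulN1r oppr_ge0 oppr_le0.
    by case: (nearP z Xz nz) => -[H //]; rewrite ?H // => /andP[-> ->].
  + move=> t /andP[t0 t1]; apply: (diag x (y - 1)) => //=; rewrite ?intrB;
      apply/andP; split; lra.
  + move=> t /andP[t0 t1]; apply: (diag (x - 1) y) => //=; rewrite ?intrB;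
      apply/andP; split; lra.
  + by move=> s /gY[].
  + by rewrite g0 /center /= intrB; congr pair; lra.
  + by rewrite g1 /center /= intrB; congr pair; lra.
Qed.

End FarPaths.

(** * Enlarging every cell to a rectangle *)

Section Scaling.
Variables (m1 m2 : int) (Y Y' : {fset cell}).
Hypotheses (m1_gt0 : 0 < m1) (m2_gt0 : 0 < m2).
Hypothesis memY' : forall x y, ((x, y) \in Y') = (((x %/ m1)%Z, (y %/ m2)%Z) \in Y).

Lemma edge_connected_scale : edge_connected Y -> edge_connected Y'.
Proof.
move=> eY P [[x0 y0] p0Y Pp0] Pc [x1 y1] p1Y.
have hor x y n : ((x + n%:Z) %/ m1)%Z = (x %/ m1)%Z -> (x, y) \in Y' -> P (x, y) <-> P (x + n%:Z, y).
  move=> E xY; elim: n E => [|n IH] E; first by rewrite addr0.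
  have E' : ((x + n%:Z) %/ m1)%Z = (x %/ m1)%Z.
    by apply/eqP; rewrite eq_le; apply/andP; split; [rewrite -E|]; apply: lez_pdiv2r; lia.
  have A : (x + n%:Z, y) \in Y' by rewrite memY' E' -memY'.
  have A' : (x + n.+1%:Z, y) \in Y' by rewrite memY' E -memY'.
  have EN : neighbor East (x + n%:Z, y) = (x + n.+1%:Z, y) by rewrite /=; congr pair; lia.
  have EW : neighbor West (x + n.+1%:Z, y) = (x + n%:Z, y) by rewrite /=; congr pair; lia.
  rewrite (IH E'); split=> H.
    by rewrite -EN; apply: Pc; rewrite ?EN.
  by rewrite -EW; apply: Pc; rewrite ?EW.
have ver x y n : ((y + n%:Z) %/ m2)%Z = (y %/ m2)%Z -> (x, y) \in Y' -> P (x, y) <-> P (x, y + n%:Z).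
  move=> E xY; elim: n E => [|n IH] E; first by rewrite addr0.
  have E' : ((y + n%:Z) %/ m2)%Z = (y %/ m2)%Z.
    by apply/eqP; rewrite eq_le; apply/andP; split; [rewrite -E|]; apply: lez_pdiv2r; lia.
  have A : (x, y + n%:Z) \in Y' by rewrite memY' E' -memY'.
  have A' : (x, y + n.+1%:Z) \in Y' by rewrite memY' E -memY'.
  have EN : neighbor North (x, y + n%:Z) = (x, y + n.+1%:Z) by rewrite /=; congr pair; lia.
  have EW : neighbor South (x, y + n.+1%:Z) = (x, y + n%:Z) by rewrite /=; congr pair; lia.
  rewrite (IH E'); split=> H.
    by rewrite -EN; apply: Pc; rewrite ?EN.
  by rewrite -EW; apply: Pc; rewrite ?EW.
(* The lower left cell represents its whole enlarged cell, which reduces the claim to one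
   representative per cell of [Y]. *)
have corner x y : (x, y) \in Y' -> P (x, y) <-> P ((x %/ m1)%Z * m1, (y %/ m2)%Z * m2).
  move=> xY; have Dx := divz_eq x m1; have Dy := divz_eq y m2.
  have Rx := modz_ge0 x (lt0r_neq0 m1_gt0); have Ry := modz_ge0 y (lt0r_neq0 m2_gt0).
  have Ax : x = (x %/ m1)%Z * m1 + `|(x %% m1)%Z|%:Z by lia.
  have Ay : y = (y %/ m2)%Z * m2 + `|(y %% m2)%Z|%:Z by lia.
  have Bx : ((x %/ m1)%Z * m1 %/ m1)%Z = (x %/ m1)%Z by rewrite mulzK // lt0r_neq0.
  have By : ((y %/ m2)%Z * m2 %/ m2)%Z = (y %/ m2)%Z by rewrite mulzK // lt0r_neq0.
  have H1 : ((x %/ m1)%Z * m1, y) \in Y' by rewrite memY' Bx -memY'.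
  have H2 : ((x %/ m1)%Z * m1, (y %/ m2)%Z * m2) \in Y' by rewrite memY' Bx By -memY'.
  have := @hor ((x %/ m1)%Z * m1) y `|(x %% m1)%Z|%N; rewrite -Ax Bx => /(_ erefl H1) <-.
  by have := @ver ((x %/ m1)%Z * m1) ((y %/ m2)%Z * m2) `|(y %% m2)%Z|%N; rewrite -Ay By => /(_ erefl H2) <-.
have inY' X Z i j : (X, Z) \in Y -> 0 <= i < m1 -> 0 <= j < m2 -> (X * m1 + i, Z * m2 + j) \in Y'.
  move=> XY /andP[i0 i1] /andP[j0 j1]; rewrite memY' !divzMDl ?lt0r_neq0 //.
  by rewrite !divz_small ?addr0 // ?i0 ?j0 ?gtz0_abs.
have cornerE X Z i j : (X, Z) \in Y -> 0 <= i < m1 -> 0 <= j < m2 ->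
    P (X * m1 + i, Z * m2 + j) <-> P (X * m1, Z * m2).
  move=> XY Hi Hj; rewrite (corner _ _ (inY' _ _ _ _ XY Hi Hj)).
  case/andP: Hi => i0 i1; case/andP: Hj => j0 j1.
  rewrite !divzMDl ?lt0r_neq0 //.
  by rewrite !divz_small ?addr0 // ?i0 ?j0 ?gtz0_abs.
apply/(corner _ _ p1Y).
have Q : forall p, p \in Y -> P (p.1 * m1, p.2 * m2).
  apply: eY.
    exists ((x0 %/ m1)%Z, (y0 %/ m2)%Z); first by rewrite -memY'.
    exact: ((corner _ _ p0Y).1 Pp0).
  have z1 : (0 : int) <= 0 < m1 by apply/andP.
  have z2 : (0 : int) <= 0 < m2 by apply/andP.
  have l1 : 0 <= m1 - 1 < m1 by apply/andP; split; lia.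
  have l2 : 0 <= m2 - 1 < m2 by apply/andP; split; lia.
  have step p q s : p \in Y' -> neighbor s p = q -> q \in Y' -> P p -> P q.
    by move=> pY <- qY; apply: Pc.
  move=> [X Z] s XY; case: s => /= nY H.
  - apply/(cornerE _ _ _ _ nY z1 z2); apply: (step (X * m1 + (m1 - 1), Z * m2 + 0) _ East).
    + exact: inY'.
    + by rewrite /=; congr pair; lia.
    + exact: inY'.
    + exact/(cornerE _ _ _ _ XY l1 z2).
  - apply/(cornerE _ _ _ _ nY z1 z2); apply: (step (X * m1 + 0, Z * m2 + (m2 - 1)) _ North).
    + exact: inY'.
    + by rewrite /=; congr pair; lia.
    + exact: inY'.
    + exact/(cornerE _ _ _ _ XY z1 l2).
  - apply/(cornerE _ _ _ _ nY l1 z2); apply: (step (X * m1 + 0, Z * m2 + 0) _ West).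
    + exact: inY'.
    + by rewrite /=; congr pair; lia.
    + exact: inY'.
    + exact/(cornerE _ _ _ _ XY z1 z2).
  - apply/(cornerE _ _ _ _ nY z1 l2); apply: (step (X * m1 + 0, Z * m2 + 0) _ South).
    + exact: inY'.
    + by rewrite /=; congr pair; lia.
    + exact: inY'.
    + exact/(cornerE _ _ _ _ XY z1 z2).
by apply: (Q ((x1 %/ m1)%Z, (y1 %/ m2)%Z)); rewrite -memY'.
Qed.

Variable K : realType.

Lemma scale_cell (m a : int) (u : K) : 0 < m -> a%:~R <= u <= a%:~R + 1 ->
  exists2 x, (x %/ m)%Z = a & x%:~R <= m%:~R * u <= x%:~R + 1.
Proof.
move=> m0 /andP[u0 u1]; have mK : 0 < m%:~R :> K by rewrite ltr0z.
(* At the upper end [u = a + 1] the integer part would fall into the next enlarged cell, so the last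
   unit of the current one is taken. *)
case: (ltP u (a%:~R + 1)) => Hu.
  exists (Num.floor (m%:~R * u)); last first.
    by rewrite floor_le /=; apply: ltW; have := floorD1_gt (m%:~R * u); rewrite intrD.
  have f1 : a * m <= Num.floor (m%:~R * u).
    by rewrite floor_ge_int intrM mulrC ler_wpM2l // ltW.
  have f2 : Num.floor (m%:~R * u) < a * m + m.
    by rewrite floor_lt_int intrD intrM -[X in _ + X]mul1r -mulrDl mulrC ltr_pM2r.
  rewrite (_ : Num.floor (m%:~R * u) = a * m + (Num.floor (m%:~R * u) - a * m)); last by lia.
  by rewrite divzMDl ?lt0r_neq0 // divz_small ?addr0 // gtz0_abs //; apply/andP; split; lia.
have -> : u = a%:~R + 1 by apply/eqP; rewrite eq_le u1.
exists (a * m + (m - 1)).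
  by rewrite divzMDl ?lt0r_neq0 // divz_small ?addr0 // gtz0_abs //; apply/andP; split; lia.
by rewrite !intrD intrM intrN; apply/andP; split; nra.
Qed.

(** The dilation and its inverse form a retraction pair, so [simply_connected_retract] applies. *)
Lemma simply_connected_scale : simply_connected K (plane_set Y : set (K * K)) ->
  simply_connected K (plane_set Y' : set (K * K)).
Proof.
have k1 : 0 < m1%:~R :> K by rewrite ltr0z.
have k2 : 0 < m2%:~R :> K by rewrite ltr0z.
have lin (a b : K) : continuous (fun z : K * K => (a * z.1, b * z.2)).
  by apply: continuous_pair; apply: continuous_mul; try exact: cst_continuous;
    [exact: continuous_fst | exact: continuous_snd].
move=> scY; apply: (simply_connected_retract (i := fun z : K * K => (m1%:~R^-1 * z.1, m2%:~R^-1 * z.2))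
  (r := fun z : K * K => (m1%:~R * z.1, m2%:~R * z.2)) _ _ _ _ _ scY).
- by apply: continuous_subspaceT; exact: lin.
- move=> z /plane_setP[[x y] xY [/= /andP[h1 h2] /andP[h3 h4]]]; apply/plane_setP.
  exists ((x %/ m1)%Z, (y %/ m2)%Z); first by rewrite -memY'.
  have key (m w : int) (u : K) : 0 < m -> w%:~R <= u -> u <= w%:~R + 1 ->
      (w %/ m)%Z%:~R <= m%:~R^-1 * u <= (w %/ m)%Z%:~R + 1.
    move=> m0 g1 g2; have mK : 0 < m%:~R :> K by rewrite ltr0z.
    have D := divz_eq w m; have R0 := modz_ge0 w (lt0r_neq0 m0); have R1 := ltz_pmod w m0.
    rewrite ler_pdivlMl // ler_pdivrMl //; apply/andP; split.
      by apply: le_trans g1; rewrite -intrM ler_int; lia.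
    have : w + 1 <= m * ((w %/ m)%Z + 1) by lia.
    by rewrite -(ler_int K) intrM !intrD; exact: le_trans.
  by split; apply: key.
- by apply: continuous_subspaceT; exact: lin.
- move=> z /plane_setP[[a b] abY [/= H1 H2]]; apply/plane_setP.
  have [x Ex Hx] := scale_cell m1_gt0 H1; have [y Ey Hy] := scale_cell m2_gt0 H2.
  by exists (x, y); [rewrite memY' Ex Ey | split].
- by move=> [u v] _ /=; rewrite !mulVKf // gt_eqF.
Qed.

End Scaling.

(* [lia] slows down badly in the presence of membership hypotheses. *)
Ltac ilia := repeat match goal with
  | H : is_true (_ \in _) |- _ => clear H
  | H : is_true (~~ (_ \in _)) |- _ => clear H
  | H : (_ \in _) = _ |- _ => clear H
  | H : forall _, _ |- _ => clear H
  | H : ~ _ |- _ => clear H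
  | H : _ /\ simply_connected _ _ |- _ => clear H
  | H : removable _ _ _ |- _ => clear H
  | H : edge_connected _ |- _ => clear H
  end; lia.

(** * Removal of whole rectangles, cell by cell *)

Section RemoveRectangles.
Variable K : realType.

Definition good (Y : {fset cell}) :=
  edge_connected Y /\ simply_connected K (plane_set Y : set (K * K)%type).

Lemma good_remove Y q s : removable Y q s -> good Y -> good (Y `\ q)%fset.
Proof.
move=> R [e c]; split; first exact: edge_connected_remove R e.
exact: simply_connected_remove_cell R c.
Qed.

(* Coordinates along a side: [j] counts steps away from the direction [s] and [i]
   steps in the lateral direction. *)
Definition pos (s : side) (p : cell) (i j : int) : cell :=
  match s with
  | South => (p.1 + i, p.2 + j) | North => (p.1 + i, p.2 - j)
  | West => (p.1 + j, p.2 + i) | East => (p.1 - j, p.2 + i)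
  end.

Lemma pos_base s p i j : neighbor s (pos s p i j) = pos s p i (j - 1).
Proof. by case: s => /=; congr pair; ilia. Qed.

Lemma pos_opp s p i j : neighbor (opposite s) (pos s p i j) = pos s p i (j + 1).
Proof. by case: s => /=; congr pair; ilia. Qed.

Lemma pos_lat s p b i j :
  neighbor (lateral s b) (pos s p i j) = pos s p (if b then i + 1 else i - 1) j.
Proof. by case: s; case: b => /=; congr pair; ilia. Qed.

Lemma pos_inj s p i j i' j' : pos s p i j = pos s p i' j' -> i = i' /\ j = j'.
Proof. by case: s => /= -[]; ilia. Qed.

Lemma pos_shift s p i j k : pos s (pos s p k 0) i j = pos s p (k + i) j.
Proof. by case: s => /=; congr pair; ilia. Qed.

(** Cells go one at a time with [i] increasing. After each removal the lateral conditions on the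
    emptied side hold vacuously, so only the two flanks of the row need hypotheses. *)
Lemma remove_row (s : side) (w : nat) : forall (Y Y' : {fset cell}) (p : cell) (j : int),
  (forall i : int, 0 <= i < w%:Z -> [/\ pos s p i j \in Y, pos s p i (j - 1) \in Y & pos s p i (j + 1) \notin Y]) ->
  (pos s p (-1) (j + 1) \in Y -> pos s p (-1) j \in Y) ->
  (pos s p (-1) j \in Y -> pos s p (-1) (j - 1) \in Y) ->
  (pos s p w%:Z (j + 1) \in Y -> pos s p w%:Z j \in Y) ->
  (pos s p w%:Z j \in Y -> pos s p w%:Z (j - 1) \in Y) ->
  (forall c, c \in Y' <-> c \in Y /\ ~ exists i : int, 0 <= i < w%:Z /\ c = pos s p i j) ->
  good Y -> good Y'.
Proof.
elim: w => [|w IH] Y Y' p j Hin W1 W2 E1 E2 HY' gY.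
  suff -> : Y' = Y by [].
  apply/fsetP => c; apply/idP/idP => [/HY'[]//|cY]; apply/HY'; split=> // -[i [Hi _]]; ilia.
have E0 : pos s p 0 j \in Y by have [] := Hin 0 ltac:(ilia).
have R : removable Y (pos s p 0 j) s.
  have [h1 h2 h3] := Hin 0 ltac:(ilia).
  split=> //; rewrite ?pos_base ?pos_opp //.
  move=> b; rewrite !pos_lat; case: b; last by rewrite !sub0r.
  rewrite !add0r; case: w {IH Hin E0} (Hin) E1 E2 {HY'} => [|w] Hin1 E1 E2; first by split.
  by have [-> -> _] := Hin1 1 ltac:(ilia).
have gY1 := good_remove R gY.
have mem1 c : c \in (Y `\ pos s p 0 j)%fset = (c != pos s p 0 j) && (c \in Y) by rewrite !inE.
have ne i j' : (i, j') != (0, j) -> pos s p i j' != pos s p 0 j.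
  by move=> H; apply/eqP => /pos_inj[? ?]; subst; rewrite eqxx in H.
apply: (IH (Y `\ pos s p 0 j)%fset Y' (pos s p 1 0) j) gY1.
- move=> i Hi; rewrite !pos_shift !mem1.
  have [h1 h2 h3] := Hin (1 + i) ltac:(ilia).
  by rewrite h1 h2 (negbTE h3) andbF !ne // xpair_eqE; ilia.
- rewrite !pos_shift !mem1 (_ : 1 + (-1) = 0) //.
  by have [_ _ /negbTE->] := Hin 0 ltac:(ilia); rewrite andbF.
- by rewrite !pos_shift !mem1 (_ : 1 + (-1) = 0) // eqxx.
- rewrite !pos_shift !mem1 (_ : 1 + w%:Z = w.+1%:Z); last by ilia.
  by move=> /andP[_ /E1 ->]; rewrite andbT ne // xpair_eqE; ilia.
- rewrite !pos_shift !mem1 (_ : 1 + w%:Z = w.+1%:Z); last by ilia.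
  by move=> /andP[_ /E2 ->]; rewrite andbT ne // xpair_eqE; ilia.
- move=> c; rewrite HY' mem1; split.
    move=> [cY nE]; split.
      rewrite cY andbT; apply/eqP => Ec; apply: nE; exists 0; split=> //; ilia.
    move=> [i [Hi Ec]]; apply: nE; exists (1 + i); split; first ilia.
    by rewrite Ec pos_shift.
  move=> [/andP[c0 cY] nE]; split=> // -[i [Hi Ec]].
  have [Ei|Hi0] : i = 0 \/ 1 <= i by ilia.
    by rewrite Ec Ei eqxx in c0.
  apply: nE; exists (i - 1); split; first ilia.
  by rewrite Ec pos_shift; congr pos; ilia.
Qed.

(** Rows go from the free end towards the row [j = -1], which stays as the base. Flanks closed
    towards the base are what [removable] asks at both ends of each row. *)
Lemma remove_rect (s : side) (w h : nat) : forall (Y Y' : {fset cell}) (p : cell),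
  (forall i j : int, 0 <= i < w%:Z -> -1 <= j < h%:Z -> pos s p i j \in Y) ->
  (forall i : int, 0 <= i < w%:Z -> pos s p i h%:Z \notin Y) ->
  (forall j : int, 0 <= j <= h%:Z -> pos s p (-1) j \in Y -> pos s p (-1) (j - 1) \in Y) ->
  (forall j : int, 0 <= j <= h%:Z -> pos s p w%:Z j \in Y -> pos s p w%:Z (j - 1) \in Y) ->
  (forall c, c \in Y' <-> c \in Y /\ ~ exists i j : int, [/\ 0 <= i < w%:Z, 0 <= j < h%:Z & c = pos s p i j]) ->
  good Y -> good Y'.
Proof.
elim: h => [|h IH] Y Y' p Hin Htop HW HE HY' gY.
  suff -> : Y' = Y by [].
  apply/fsetP => c; apply/idP/idP => [/HY'[]//|cY]; apply/HY'; split=> // -[i [j [_ Hj _]]]; ilia.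
pose Y1 := [fset c in Y | ~~ `[< exists i : int, 0 <= i < w%:Z /\ c = pos s p i h%:Z >]]%fset.
have mem1 c : c \in Y1 <-> c \in Y /\ ~ exists i : int, 0 <= i < w%:Z /\ c = pos s p i h%:Z.
  rewrite !inE; split=> [/andP[? /negP H]|[-> H]]; first by split=> // /asboolP.
  by apply/negP => /asboolP.
have ES : h%:Z + 1 = h.+1%:Z by ilia.
have gY1 : good Y1.
  apply: (@remove_row s w Y Y1 p h%:Z) => //.
  - by move=> i Hi; rewrite ES; split; [apply: Hin; ilia | apply: Hin; ilia | apply: Htop].
  - by rewrite ES => /HW H; have := H ltac:(ilia); rewrite (_ : h.+1%:Z - 1 = h%:Z) //; ilia.
  - by apply: HW; ilia.
  - by rewrite ES => /HE H; have := H ltac:(ilia); rewrite (_ : h.+1%:Z - 1 = h%:Z) //; ilia.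
  - by apply: HE; ilia.
have out i j : (i < 0) || (w%:Z <= i) || (j != h%:Z) -> pos s p i j \in Y1 <-> pos s p i j \in Y.
  move=> Hij; rewrite mem1; split=> [[]//|H]; split=> // -[i' [Hi' /pos_inj[? ?]]]; subst.
  by rewrite eqxx in Hij; ilia.
apply: (IH Y1 Y' p) gY1.
- by move=> i j Hi Hj; apply/out; [ilia | apply: Hin; ilia].
- by move=> i Hi; apply/negP => /mem1[_]; apply; exists i.
- by move=> j Hj /out H; apply/out => //; apply: HW; [ilia | apply: H].
- by move=> j Hj /out H; apply/out; [ilia | apply: HE; [ilia | apply: H; ilia]].
- move=> c; rewrite HY' mem1; split.
    move=> [cY nE]; split; first split=> //.
      by move=> [i [Hi Ec]]; apply: nE; exists i, h%:Z; split=> //; ilia.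
    by move=> [i [j [Hi Hj Ec]]]; apply: nE; exists i, j; split=> //; ilia.
  move=> [[cY n1] n2]; split=> // -[i [j [Hi Hj Ec]]].
  have [Ej|Hj'] : j = h%:Z \/ j < h%:Z by ilia.
    by apply: n1; exists i; rewrite Ec Ej.
  by apply: n2; exists i, j; split=> //; ilia.
Qed.

End RemoveRectangles.

(** * The carved region is simply connected *)

Section BlockShapes.
(** In a block of height [N], the nominal heights of the south cut, the two dents on a vertical side
    and the north cut are [m0], [m1], [m2] and [m3]. The actual ones exceed them by at most [e], and
    a dent is [t] high. *)
Variables (K : realType) (G Om : {fset cell}) (N t m0 m1 m2 m3 e : int).
Variables (hS hN dE dW : cell -> bool -> int).
Hypotheses (e_ge0 : 0 <= e) (t_gt0 : 0 < t).
Hypotheses (hS_b : forall p b, m0 <= hS p b <= m0 + e) (hN_b : forall p b, m3 <= hN p b <= m3 + e)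
  (dE_b : forall p (b : bool), (if b then m2 else m1) <= dE p b <= (if b then m2 else m1) + e)
  (dW_b : forall p (b : bool), (if b then m2 else m1) <= dW p b <= (if b then m2 else m1) + e).
Hypotheses (m0_gt0 : 0 < m0) (m01 : m0 + e + 1 < m1) (m12 : m1 + e + t + 1 < m2)
  (m23 : m2 + e + t + 1 < m3) (m3N : m3 + e + 1 < N).

(* The parts cut off the block of [p] on its boundary side [s]; the coordinates
   [i], [j] are relative to the block. *)
Definition cut (p : cell) (s : side) (b : bool) (i j : int) : bool :=
  match s with
  | South => (if b then 17 <= i < 40 else 0 <= i < 17) && (0 <= j < hS p b)
  | North => (if b then 17 <= i < 40 else 0 <= i < 17) && (hN p b <= j < N)
  | East => (29 <= i < 40) && (dE p b <= j < dE p b + t)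
  | West => (0 <= i < 8) && (dW p b <= j < dW p b + t)
  end.

Definition cut_prop (p : cell) (s : side) (b : bool) (i j : int) : Prop :=
  match s with
  | South => (if b then 17 <= i /\ i < 40 else 0 <= i /\ i < 17) /\ 0 <= j /\ j < hS p b
  | North => (if b then 17 <= i /\ i < 40 else 0 <= i /\ i < 17) /\ hN p b <= j /\ j < N
  | East => (29 <= i /\ i < 40) /\ dE p b <= j /\ j < dE p b + t
  | West => (0 <= i /\ i < 8) /\ dW p b <= j /\ j < dW p b + t
  end.

Lemma cutP p s b i j : reflect (cut_prop p s b i j) (cut p s b i j).
Proof.
apply: (iffP idP); rewrite /cut /cut_prop.
  by case: s; case: b => /andP[/andP[-> ->] /andP[-> ->]].
by case: s; case: b => -[[-> ->] [-> ->]].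
Qed.

Definition block (p : cell) (i j : int) : cell := (40 * p.1 + i, N * p.2 + j).

Hypothesis memOm : forall p i j, 0 <= i < 40 -> 0 <= j < N ->
  block p i j \in Om <-> p \in G /\ forall s b, neighbor s p \notin G -> ~~ cut p s b i j.

(** The scaled region after the cuts of the list [rl] only: the invariant that allows the cuts to be
    made one after the other. *)
Definition cut_set (rl : seq (cell * (side * bool))) (Y : {fset cell}) :=
  forall p i j, 0 <= i < 40 -> 0 <= j < N ->
  block p i j \in Y <-> p \in G /\ forall s b, (p, (s, b)) \in rl -> ~~ cut p s b i j.

Hypothesis scG : simply_connected_region K G.

Lemma block_ex (c : cell) : exists p i j, [/\ c = block p i j, 0 <= i < 40 & 0 <= j < N].
Proof.
case: c => x y; have N0 : N != 0 by ilia.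
exists ((x %/ 40)%Z, (y %/ N)%Z), (x %% 40)%Z, (y %% N)%Z.
have := divz_eq x 40; have := divz_eq y N.
have := modz_ge0 y N0; have := @ltz_pmod y N ltac:(ilia).
by move=> h1 h2 h3 h4; split; [rewrite /block /=; congr pair; ilia | ilia | ilia].
Qed.

Lemma block_inj p i j p' i' j' : 0 <= i < 40 -> 0 <= i' < 40 -> 0 <= j < N -> 0 <= j' < N ->
  block p i j = block p' i' j' -> [/\ p = p', i = i' & j = j'].
Proof.
case: p => x y; case: p' => x' y'; rewrite /block /= => Hi Hi' Hj Hj' -[E1 E2].
have Ey : y = y'.
  have Hy : N * (y - y') = j' - j by rewrite mulrBr; ilia.
  have H1 : (y - y' < 1) by rewrite -(ltr_pM2l (_ : 0 < N)) ?mulr1 ?Hy; ilia.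
  have H2 : (-1 < y - y') by rewrite -(ltr_pM2l (_ : 0 < N)) ?mulrN1 ?Hy; ilia.
  by ilia.
by subst y'; split; [congr pair; ilia | ilia | ilia].
Qed.

Lemma cut_set_ex rl : exists Y, cut_set rl Y.
Proof.
pose S := [seq (i, j) | i <- iota 0 40, j <- iota 0 `|N|%N].
pose sG := [fset block p k.1%:Z k.2%:Z | p in G, k in S]%fset.
have memS p i j : 0 <= i < 40 -> 0 <= j < N -> block p i j \in sG <-> p \in G.
  move=> Hi Hj; split.
    move=> /imfset2P[p' p'G [k /allpairsP[[i' j'] [H1 H2 Ek]] E]].
    rewrite mem_iota in H1; rewrite mem_iota in H2; rewrite Ek in E.
    have Hi1 : 0 <= i'%:Z < 40 by clear - H1; simpl in H1; lia.
    have N0 : 0 < N by ilia.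
    have Hj1 : 0 <= j'%:Z < N by clear - H2 N0; simpl in H2; lia.
    by have [-> _ _] := block_inj Hi Hi1 Hj Hj1 E.
  move=> pG; apply/imfset2P; exists p => //; exists (`|i|%N, `|j|%N).
    by apply/allpairsP; exists (`|i|%N, `|j|%N); split=> //; rewrite mem_iota /=; ilia.
  by rewrite /block /=; congr pair; ilia.
exists [fset c in sG | `[< forall p i j, 0 <= i < 40 -> 0 <= j < N -> c = block p i j ->
  forall s b, (p, (s, b)) \in rl -> ~~ cut p s b i j >]]%fset.
move=> p i j Hi Hj; rewrite !inE; split.
  by move=> /andP[/(memS _ _ _ Hi Hj) pG /asboolP H]; split=> //; apply: H.
move=> [pG H]; apply/andP; split; first exact/memS.
apply/asboolP => p' i' j' Hi' Hj' E; have [Ep Ei Ej] := block_inj Hi Hi' Hj Hj' E.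
by subst; exact: H.
Qed.

Section Step.
Variables (rl : seq (cell * (side * bool))) (Y : {fset cell}).
Hypothesis Hrl : forall k, k \in rl -> k.1 \in G /\ neighbor k.2.1 k.1 \notin G.
Hypothesis HY : cut_set rl Y.

Lemma cut_bounds p : [/\ m0 <= hS p false <= m0 + e /\ m0 <= hS p true <= m0 + e,
  m3 <= hN p false <= m3 + e /\ m3 <= hN p true <= m3 + e,
  m1 <= dE p false <= m1 + e /\ m2 <= dE p true <= m2 + e &
  m1 <= dW p false <= m1 + e /\ m2 <= dW p true <= m2 + e].
Proof.
by split; split=> //; [exact: (dE_b p false) | exact: (dE_b p true) | exact: (dW_b p false) |
  exact: (dW_b p true)].
Qed.

Lemma notin_block p i j : 0 <= i < 40 -> 0 <= j < N -> p \notin G -> block p i j \notin Y.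
Proof. by move=> Hi Hj pG; apply/negP => /(HY _ Hi Hj)[pG' _]; rewrite pG' in pG. Qed.

(** At these heights only north cuts occur, and they extend to the top of the block; what remains of
    a column is closed downwards. *)
Lemma north_closed p i j : 0 <= i < 40 -> m3 <= j < N -> block p i j \in Y -> block p i (j - 1) \in Y.
Proof.
move=> Hi Hj; have Hj2 : 0 <= j < N by ilia.
move=> /(HY _ Hi Hj2)[pG H]; apply/HY => //; first ilia.
split=> // s b /H /cutP nC; apply/cutP => C; apply: nC; move: C.
have [[b1 b2] [b3 b4] [b5 b6] [b7 b8]] := cut_bounds p.
by clear H; rewrite /cut_prop; case: s; case: b; ilia.
Qed.

Lemma south_closed p i j : 0 <= i < 40 -> 0 <= j <= m0 + e -> block p i j \in Y -> block p i (j + 1) \in Y.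
Proof.
move=> Hi Hj; have Hj2 : 0 <= j < N by ilia.
move=> /(HY _ Hi Hj2)[pG H]; apply/HY => //; first ilia.
split=> // s b /H /cutP nC; apply/cutP => C; apply: nC; move: C.
have [[b1 b2] [b3 b4] [b5 b6] [b7 b8]] := cut_bounds p.
by clear H; rewrite /cut_prop; case: s; case: b; ilia.
Qed.

Lemma north_top p i : 0 <= i < 40 -> p \in G -> neighbor North p \in G -> block p i (N - 1) \in Y.
Proof.
move=> Hi pG nG; apply/HY => //; first ilia.
split=> // s b /Hrl[/= _ Hs]; have [[b1 b2] [b3 b4] [b5 b6] [b7 b8]] := cut_bounds p.
apply/cutP => C; case: s Hs C => Hs; case: b => /= C; first [by rewrite nG in Hs | exfalso; ilia].
Qed.

Lemma south_bottom p i : 0 <= i < 40 -> p \in G -> neighbor South p \in G -> block p i 0 \in Y.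
Proof.
move=> Hi pG nG; apply/HY => //; first ilia.
split=> // s b /Hrl[/= _ Hs]; have [[b1 b2] [b3 b4] [b5 b6] [b7 b8]] := cut_bounds p.
apply/cutP => C; case: s Hs C => Hs; case: b => /= C; first [by rewrite nG in Hs | exfalso; ilia].
Qed.

Variables (p : cell) (b : bool).
Hypotheses (pG : p \in G).

(** A horizontal cut has two parts, one for each brick of that row: slots 0 and 1, of width 8 + 9 =
    17, then slots 2 and 3, of width 12 + 11 = 23. *)
Let xl : int := if b then 17 else 0.
Let wl : nat := if b then 23 else 17.

Lemma remove_north (Y' : {fset cell}) : neighbor North p \notin G -> (p, (North, b)) \notin rl ->
  cut_set ((p, (North, b)) :: rl) Y' -> good K Y -> good K Y'.
Proof.
move=> nG nrl HY'; have [[b1 b2] [b3 b4] [b5 b6] [b7 b8]] := cut_bounds p.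
have hb : m3 <= hN p b <= m3 + e by [].
pose h := `|N - hN p b|%N; have Eh : h%:Z = N - hN p b by rewrite /h; ilia.
have E1 i j : pos South (block p xl (hN p b)) i j = block p (xl + i) (hN p b + j).
  by rewrite /block /=; congr pair; ilia.
have E2 c : neighbor North c = (c.1, c.2 + 1) by [].
have top c i : block c i N = block (neighbor North c) i 0 by rewrite /block /=; congr pair; ilia.
have west c i j : block c (i - 40) j = block (neighbor West c) i j by rewrite /block /=; congr pair; ilia.
have east c i j : block c (40 + i) j = block (neighbor East c) i j by rewrite /block /=; congr pair; ilia.
(* The flanks are closed towards the base. The delicate place is the top line of the block: if the
   diagonal block is present although the north one is missing, [no_pinch] supplies the lateral
   block. *)
have closed c i j : 0 <= i < 40 -> 0 <= j <= h%:Z ->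
    [\/ c = p, c = neighbor West p | c = neighbor East p] ->
    block c i (hN p b + j) \in Y -> block c i (hN p b + (j - 1)) \in Y.
  move=> Hi Hj Hc; have [Ej|Hj'] : j = h%:Z \/ j < h%:Z by ilia.
    have -> : hN p b + j = N by ilia.
    have -> : hN p b + (j - 1) = N - 1 by ilia.
    have Z0 : 0 <= (0 : int) < N by ilia.
    rewrite top => /(HY _ Hi Z0)[cG _]; apply: north_top => //.
    case: Hc => Ec; first by rewrite Ec in cG; rewrite cG in nG.
      have [_ np] := no_pinch p.1 (p.2 + 1) scG.
      case: np => //; rewrite ?addrK -?surjective_pairing //.
      - by move: cG; rewrite Ec.
      - by move=> H; rewrite E2 H in nG.
      - by rewrite Ec.
    have [np _] := no_pinch (p.1 + 1) (p.2 + 1) scG.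
    case: np => //; rewrite ?addrK -?surjective_pairing //.
    - by move: cG; rewrite Ec.
    - by move=> H; rewrite E2 H in nG.
    - by rewrite Ec.
  by move=> H; rewrite addrA; apply: north_closed => //; ilia.
apply: (@remove_rect K South wl h Y Y' (block p xl (hN p b))).
- move=> i j Hi Hj; rewrite E1; apply/HY; [rewrite /xl /wl in Hi *; case: (b) Hi; ilia | ilia |].
  split=> // s' b' Hk.
  have Hne : (s', b') <> (North, b) by move=> E; rewrite E in Hk; rewrite Hk in nrl.
  clear Hk; apply/cutP => C; move: C Hne Hi hb; rewrite /xl /wl.
  by case: s'; case: b'; case: (b) => /= C Hne Hi hb; solve [case: Hne; done | exfalso; clear Hne; ilia].
- move=> i Hi; rewrite E1 (_ : hN p b + h%:Z = N); last by ilia.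
  by rewrite top; apply: notin_block => //; rewrite /xl /wl in Hi *; case: (b) Hi; ilia.
- move=> j Hj; rewrite !E1 /xl; case: (b) closed => closed.
    by apply: (closed p 16) => //; constructor 1.
  rewrite (_ : 0 + -1 = 39 - 40 :> int) // !west.
  by apply: (closed _ 39) => //; constructor 2.
- move=> j Hj; rewrite !E1 /xl /wl; case: (b) closed => closed.
    rewrite (_ : 17 + 23%:Z = 40 + 0 :> int) // !east.
    by apply: (closed _ 0) => //; constructor 3.
  by apply: (closed p 17) => //; constructor 1.
- move=> c; have [q [i [j [-> Hi Hj]]]] := block_ex c; rewrite HY' // HY //; split.
    move=> [qG H]; split; first by split=> // s' b' Hk; apply: H; rewrite inE Hk orbT.
    move=> [i' [j' [Hi' Hj' E]]]; rewrite E1 in E.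
    have [||Eq Ei Ej] := block_inj Hi _ Hj _ E; [rewrite /xl /wl in Hi' *; case: (b) Hi'; ilia | ilia |].
    subst q; have /cutP := H North b (mem_head _ _); apply; move: Hi'; rewrite Ei Ej /xl /wl /=.
    by clear H; case: (b) Eh hb Hj' => ? ? ? ? /=; ilia.
  move=> [[qG H] nE]; split=> // s' b'; rewrite inE => /orP[/eqP[Eq -> ->]|]; last exact: H.
  subst q; apply/cutP => C; apply: nE; exists (i - xl), (j - hN p b).
  by move: C; rewrite E1 /xl /wl Eh /= => C; split; [case: (b) C; ilia | ilia | congr block; ilia].
Qed.

Lemma remove_south (Y' : {fset cell}) : neighbor South p \notin G -> (p, (South, b)) \notin rl ->
  cut_set ((p, (South, b)) :: rl) Y' -> good K Y -> good K Y'.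
Proof.
move=> nG nrl HY'; have [[b1 b2] [b3 b4] [b5 b6] [b7 b8]] := cut_bounds p.
have hb : m0 <= hS p b <= m0 + e by [].
pose h := `|hS p b|%N; have Eh : h%:Z = hS p b by rewrite /h; ilia.
have E1 i j : pos North (block p xl (hS p b - 1)) i j = block p (xl + i) (hS p b - 1 - j).
  by rewrite /block /=; congr pair; ilia.
have E2 c : neighbor South c = (c.1, c.2 - 1) by [].
have bot c i : block c i (-1) = block (neighbor South c) i (N - 1) by rewrite /block /=; congr pair; ilia.
have west c i j : block c (i - 40) j = block (neighbor West c) i j by rewrite /block /=; congr pair; ilia.
have east c i j : block c (40 + i) j = block (neighbor East c) i j by rewrite /block /=; congr pair; ilia.
have closed c i j : 0 <= i < 40 -> 0 <= j <= h%:Z ->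
    [\/ c = p, c = neighbor West p | c = neighbor East p] ->
    block c i (hS p b - 1 - j) \in Y -> block c i (hS p b - 1 - (j - 1)) \in Y.
  move=> Hi Hj Hc; have [Ej|Hj'] : j = h%:Z \/ j < h%:Z by ilia.
    have -> : hS p b - 1 - j = -1 by ilia.
    have -> : hS p b - 1 - (j - 1) = 0 by ilia.
    have Z0 : 0 <= N - 1 < N by ilia.
    rewrite bot => /(HY _ Hi Z0)[cG _]; apply: south_bottom => //.
    case: Hc => Ec; first by rewrite Ec in cG; rewrite cG in nG.
      have [np _] := no_pinch p.1 p.2 scG.
      case: np => //; rewrite -?surjective_pairing //.
      - by move: cG; rewrite Ec.
      - by rewrite Ec.
      - by move=> H; rewrite E2 H in nG.
    have [_ np] := no_pinch (p.1 + 1) p.2 scG.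
    case: np => //; rewrite ?addrK -?surjective_pairing //.
    - by move: cG; rewrite Ec.
    - by rewrite Ec.
    - by move=> H; rewrite E2 H in nG.
  move=> H; rewrite (_ : hS p b - 1 - (j - 1) = hS p b - 1 - j + 1); last ilia.
  by apply: south_closed => //; ilia.
apply: (@remove_rect K North wl h Y Y' (block p xl (hS p b - 1))).
- move=> i j Hi Hj; rewrite E1; apply/HY; [rewrite /xl /wl in Hi *; case: (b) Hi; ilia | ilia |].
  split=> // s' b' Hk.
  have Hne : (s', b') <> (South, b) by move=> E; rewrite E in Hk; rewrite Hk in nrl.
  clear Hk; apply/cutP => C; move: C Hne Hi hb; rewrite /xl /wl.
  by case: s'; case: b'; case: (b) => /= C Hne Hi hb; solve [case: Hne; done | exfalso; clear Hne; ilia].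
- move=> i Hi; rewrite E1 (_ : hS p b - 1 - h%:Z = -1); last by ilia.
  by rewrite bot; apply: notin_block => //; [rewrite /xl /wl in Hi *; case: (b) Hi; ilia | ilia].
- move=> j Hj; rewrite !E1 /xl; case: (b) closed => closed.
    by apply: (closed p 16) => //; constructor 1.
  rewrite (_ : 0 + -1 = 39 - 40 :> int) // !west.
  by apply: (closed _ 39) => //; constructor 2.
- move=> j Hj; rewrite !E1 /xl /wl; case: (b) closed => closed.
    rewrite (_ : 17 + 23%:Z = 40 + 0 :> int) // !east.
    by apply: (closed _ 0) => //; constructor 3.
  by apply: (closed p 17) => //; constructor 1.
- move=> c; have [q [i [j [-> Hi Hj]]]] := block_ex c; rewrite HY' // HY //; split.
    move=> [qG H]; split; first by split=> // s' b' Hk; apply: H; rewrite inE Hk orbT.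
    move=> [i' [j' [Hi' Hj' E]]]; rewrite E1 in E.
    have [||Eq Ei Ej] := block_inj Hi _ Hj _ E; [rewrite /xl /wl in Hi' *; case: (b) Hi'; ilia | ilia |].
    subst q; have /cutP := H South b (mem_head _ _); apply; move: Hi'; rewrite Ei Ej /xl /wl /=.
    by clear H; case: (b) Eh hb Hj' => ? ? ? ? /=; ilia.
  move=> [[qG H] nE]; split=> // s' b'; rewrite inE => /orP[/eqP[Eq -> ->]|]; last exact: H.
  subst q; apply/cutP => C; apply: nE; exists (i - xl), (hS p b - 1 - j).
  by move: C; rewrite E1 /xl /wl Eh /= => C; split; [case: (b) C; ilia | ilia | congr block; ilia].
Qed.

Lemma remove_east (Y' : {fset cell}) : neighbor East p \notin G -> (p, (East, b)) \notin rl ->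
  cut_set ((p, (East, b)) :: rl) Y' -> good K Y -> good K Y'.
Proof.
move=> nG nrl HY'; have [[b1 b2] [b3 b4] [b5 b6] [b7 b8]] := cut_bounds p.
pose w := `|t|%N; have Ew : w%:Z = t by rewrite /w; ilia.
have hb : m1 <= dE p b <= m2 + e by case: (b); ilia.
have sep : dE p false + t < dE p true by ilia.
have E1 i j : pos West (block p 29 (dE p b)) i j = block p (29 + j) (dE p b + i).
  by rewrite /block /=; congr pair; ilia.
have east i j : block p (40 + i) j = block (neighbor East p) i j by rewrite /block /=; congr pair; ilia.
(* The rows just below and just above the dent are intact, because the nominal heights keep
   different cuts at least one unit apart. *)
have free i j : 28 <= i < 40 -> j = dE p b - 1 \/ j = dE p b + t -> block p i j \in Y.
  move=> Hi Hj; apply/HY; [ilia | ilia | split=> // s' b' Hk].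
  clear Hk; apply/cutP => C; move: C Hj sep.
  by case: s'; case: b'; case: (b) => /= C Hj sep; exfalso; ilia.
have lat j j' : j' = dE p b - 1 \/ j' = dE p b + t -> 0 <= j <= 11%:Z ->
    block p (29 + j) j' \in Y -> block p (29 + (j - 1)) j' \in Y.
  by move=> Hj' Hj _; apply: free => //; ilia.
apply: (@remove_rect K West w 11 Y Y' (block p 29 (dE p b))).
- move=> i j Hi Hj; rewrite E1; apply/HY; [ilia | ilia |].
  split=> // s' b' Hk.
  have Hne : (s', b') <> (East, b) by move=> E; rewrite E in Hk; rewrite Hk in nrl.
  clear Hk; apply/cutP => C; move: C Hne Hi sep.
  by case: s'; case: b'; case: (b) => /= C Hne Hi sep; solve [case: Hne; done | exfalso; clear Hne; ilia].
- by move=> i Hi; rewrite E1 (_ : 29 + 11%:Z = 40 + 0 :> int) // east; apply: notin_block => //; ilia.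
- by move=> j Hj; rewrite !E1; apply: lat => //; left.
- by move=> j Hj; rewrite !E1 Ew; apply: lat => //; right.
- move=> c; have [q [i [j [-> Hi Hj]]]] := block_ex c; rewrite HY' // HY //; split.
    move=> [qG H]; split; first by split=> // s' b' Hk; apply: H; rewrite inE Hk orbT.
    move=> [i' [j' [Hi' Hj' E]]]; rewrite E1 in E.
    have [||Eq Ei Ej] := block_inj Hi _ Hj _ E; [ilia | ilia |].
    by subst q; have /cutP := H East b (mem_head _ _); apply; rewrite Ei Ej /=; clear H; ilia.
  move=> [[qG H] nE]; split=> // s' b'; rewrite inE => /orP[/eqP[Eq -> ->]|]; last exact: H.
  subst q; apply/cutP => C; apply: nE; exists (j - dE p b), (i - 29).
  by move: C; rewrite E1 Ew /= => C; split; [ilia | ilia | congr block; ilia].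
Qed.

Lemma remove_west (Y' : {fset cell}) : neighbor West p \notin G -> (p, (West, b)) \notin rl ->
  cut_set ((p, (West, b)) :: rl) Y' -> good K Y -> good K Y'.
Proof.
move=> nG nrl HY'; have [[b1 b2] [b3 b4] [b5 b6] [b7 b8]] := cut_bounds p.
pose w := `|t|%N; have Ew : w%:Z = t by rewrite /w; ilia.
have hb : m1 <= dW p b <= m2 + e by case: (b); ilia.
have sep : dW p false + t < dW p true by ilia.
have E1 i j : pos East (block p 7 (dW p b)) i j = block p (7 - j) (dW p b + i).
  by rewrite /block /=; congr pair; ilia.
have west i j : block p (i - 40) j = block (neighbor West p) i j by rewrite /block /=; congr pair; ilia.
have free i j : 0 <= i < 9 -> j = dW p b - 1 \/ j = dW p b + t -> block p i j \in Y.
  move=> Hi Hj; apply/HY; [ilia | ilia | split=> // s' b' Hk].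
  clear Hk; apply/cutP => C; move: C Hj sep.
  by case: s'; case: b'; case: (b) => /= C Hj sep; exfalso; ilia.
have lat j j' : j' = dW p b - 1 \/ j' = dW p b + t -> 0 <= j <= 8%:Z ->
    block p (7 - j) j' \in Y -> block p (7 - (j - 1)) j' \in Y.
  by move=> Hj' Hj _; apply: free => //; ilia.
apply: (@remove_rect K East w 8 Y Y' (block p 7 (dW p b))).
- move=> i j Hi Hj; rewrite E1; apply/HY; [ilia | ilia |].
  split=> // s' b' Hk.
  have Hne : (s', b') <> (West, b) by move=> E; rewrite E in Hk; rewrite Hk in nrl.
  clear Hk; apply/cutP => C; move: C Hne Hi sep.
  by case: s'; case: b'; case: (b) => /= C Hne Hi sep; solve [case: Hne; done | exfalso; clear Hne; ilia].
- by move=> i Hi; rewrite E1 (_ : 7 - 8%:Z = 39 - 40 :> int) // west; apply: notin_block => //; ilia.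
- by move=> j Hj; rewrite !E1; apply: lat => //; left.
- by move=> j Hj; rewrite !E1 Ew; apply: lat => //; right.
- move=> c; have [q [i [j [-> Hi Hj]]]] := block_ex c; rewrite HY' // HY //; split.
    move=> [qG H]; split; first by split=> // s' b' Hk; apply: H; rewrite inE Hk orbT.
    move=> [i' [j' [Hi' Hj' E]]]; rewrite E1 in E.
    have [||Eq Ei Ej] := block_inj Hi _ Hj _ E; [ilia | ilia |].
    by subst q; have /cutP := H West b (mem_head _ _); apply; rewrite Ei Ej /=; clear H; ilia.
  move=> [[qG H] nE]; split=> // s' b'; rewrite inE => /orP[/eqP[Eq -> ->]|]; last exact: H.
  subst q; apply/cutP => C; apply: nE; exists (j - dW p b), (7 - i).
  by move: C; rewrite E1 Ew /= => C; split; [ilia | ilia | congr block; ilia].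
Qed.

End Step.

(** Induction on the list of cuts: no cut is the scaled region, each new cut is the removal of a
    rectangle, and a repeated one removes nothing. *)
Lemma cut_set_good rl Y : (forall k, k \in rl -> k.1 \in G /\ neighbor k.2.1 k.1 \notin G) ->
  cut_set rl Y -> good K Y.
Proof.
have [rG sG] := scG.
elim: rl Y => [|[p [s b]] rl IH] Y Hrl HY.
  have memY x y : ((x, y) \in Y) = (((x %/ 40)%Z, (y %/ N)%Z) \in G).
    have [q [i [j [E Hi Hj]]]] := block_ex (x, y); move: (E) => [E1 E2].
    have -> : (x %/ 40)%Z = q.1.
      by rewrite E1 mulrC divzMDl ?divz_small ?addr0 //.
    have -> : (y %/ N)%Z = q.2.
      by rewrite E2 mulrC divzMDl ?divz_small ?addr0 // ?gtz0_abs; ilia.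
    rewrite E -surjective_pairing; apply/idP/idP => [/(HY _ _ _ Hi Hj)[]//|H].
    by apply/HY.
  split; first by apply: (edge_connected_scale _ _ memY (region_edge_connected rG)); ilia.
  by apply: (simply_connected_scale _ _ memY sG); ilia.
have [Hp Hn] := Hrl (p, (s, b)) (mem_head _ _); rewrite /= in Hp Hn.
have Hrl' k : k \in rl -> k.1 \in G /\ neighbor k.2.1 k.1 \notin G.
  by move=> Hk; apply: Hrl; rewrite inE Hk orbT.
have [Yt HYt] := cut_set_ex rl; have gYt := IH _ Hrl' HYt.
case: (boolP ((p, (s, b)) \in rl)) => [Hin|nrl].
  apply: IH => // q i j Hi Hj; rewrite HY //; split=> -[qG H]; split=> // s' b'.
    by move=> Hk; apply: H; rewrite inE Hk orbT.
  by rewrite inE => /orP[/eqP E|Hk]; apply: H => //; rewrite E.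
case: s Hn nrl HY {Hrl} => Hn nrl HY.
- exact: (remove_east HYt Hp Hn nrl HY gYt).
- exact: (remove_north Hrl' HYt Hp Hn nrl HY gYt).
- exact: (remove_west HYt Hp Hn nrl HY gYt).
- exact: (remove_south Hrl' HYt Hp Hn nrl HY gYt).
Qed.

Lemma block_region : simply_connected_region K Om.
Proof.
have [[G0 cG] sG] := scG.
pose sides := [seq (s, b) | s <- [:: East; North; West; South], b <- [:: false; true]].
pose rl := [seq k <- [seq (p, sb) | p <- enum_fset G, sb <- sides] | neighbor k.2.1 k.1 \notin G].
have memrl p s b : ((p, (s, b)) \in rl) = (neighbor s p \notin G) && (p \in G).
  rewrite mem_filter; congr (_ && _); apply/idP/idP => [|pG].
    by case/allpairsPdep=> p' [sb [H _ [-> _]]].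
  by apply/allpairsPdep; exists p, (s, b); split=> //; case: s; case: b.
have [eO sO] : good K Om.
  apply: (@cut_set_good rl) => [[p [s b]]|p i j Hi Hj]; first by rewrite memrl => /andP[].
  rewrite memOm //; split=> -[pG H]; split=> // s b.
    by rewrite memrl => /andP[nG _]; apply: H.
  by move=> nG; apply: H; rewrite memrl nG.
split=> //; apply: edge_connected_region => //.
by have [[z /plane_setP[p pO _]] _ _] := sO; apply/fset0Pn; exists p.
Qed.

End BlockShapes.

(** * The linear-time program *)

Section Program.

Definition straight (i : instr) : bool :=
  match i with Const _ _ | Add _ _ _ | Sub _ _ _ | Write _ => true | _ => false end.

Definition run (st : ram_state) (seg : seq instr) := foldl (fun st i => exec i st) st seg.

Lemma run_cat st s1 s2 : run st (s1 ++ s2) = run (run st s1) s2.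
Proof. by rewrite /run foldl_cat. Qed.

Lemma onth_cat_at (pre post : seq instr) i : onth (pre ++ i :: post) (size pre) = Some i.
Proof. by elim: pre. Qed.

Lemma run_steps (pre seg post : seq instr) st : all straight seg -> pc st = size pre ->
  iter (size seg) (step (pre ++ seg ++ post)) st = run st seg /\
  pc (run st seg) = (size pre + size seg)%N.
Proof.
elim: seg pre st => [|i seg IH] pre st; first by rewrite addn0.
move=> /= /andP[Hi Hs] Hpc.
have Est : step (pre ++ (i :: seg) ++ post) st = exec i st.
  by rewrite /step Hpc onth_cat_at.
have Epc : pc (exec i st) = size (rcons pre i).
  by rewrite size_rcons -Hpc; case: st {Est Hpc} => n M inp out; case: i Hi => //=.
have [E1 E2] := IH (rcons pre i) (exec i st) Hs Epc.
rewrite -cat_rcons in Est.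
by rewrite -iterS iterSr -cat_rcons Est E1 E2 size_rcons addSnnS.
Qed.

Definition emit_one (o : nat * nat) : seq instr :=
  [:: Const (Posz 9) o.1%:Z; Add (Posz 9) (Posz 6) (Posz 9); Write (Posz 9); Const (Posz 9) o.2%:Z; Add (Posz 9) (Posz 7) (Posz 9); Write (Posz 9)].

Definition emit (os : seq (nat * nat)) : seq instr := flatten [seq emit_one o | o <- os].

Definition same_but (k : seq int) (M M' : int -> int) := forall r, r \notin k -> M' r = M r.

Lemma straight_emit os : all straight (emit os).
Proof. by elim: os => //= o os; rewrite /emit /= all_cat => ->. Qed.

Lemma run_emit os n M inp out : exists M', same_but [:: Posz 9] M M' /\
  run (RamState n M inp out) (emit os) =
  RamState (n + size (emit os)) M' inp
    (out ++ flatten [seq [:: M (Posz 6) + o.1%:Z; M (Posz 7) + o.2%:Z] | o <- os]).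
Proof.
elim: os n M out => [|o os IH] n M out.
  by exists M; split=> //=; rewrite /run /= addn0 cats0.
have Eem : emit (o :: os) = emit_one o ++ emit os by [].
rewrite Eem; pose M1 := upd (upd (upd (upd M (Posz 9) o.1%:Z) (Posz 9) (M (Posz 6) + o.1%:Z)) (Posz 9) o.2%:Z) (Posz 9) (M (Posz 7) + o.2%:Z).
have sM1 : same_but [:: Posz 9] M M1 by move=> r; rewrite inE /M1 /upd => /negbTE ->.
have E : run (RamState n M inp out) (emit_one o ++ emit os) =
  run (RamState (n + 6) M1 inp (out ++ [:: M (Posz 6) + o.1%:Z; M (Posz 7) + o.2%:Z])) (emit os).
  by rewrite run_cat /run /= /upd /= !addnS addn0 -!cats1 -catA.
have [M' [sM' E']] := IH (n + 6)%N M1 (out ++ [:: M (Posz 6) + o.1%:Z; M (Posz 7) + o.2%:Z]).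
exists M'; split; first by move=> r Hr; rewrite sM' // sM1.
by rewrite E E' !sM1 // size_cat -catA addnA.
Qed.

(** Multiplication by a constant unrolled into additions, at a cost that depends on [k] alone. *)
Definition times (k : nat) (d s : int) : seq instr := Const d 0 :: nseq k (Add d d s).

Lemma run_times k d s n M inp out : d != s ->
  exists M', [/\ same_but [:: d] M M', M' d = k%:Z * M s &
    run (RamState n M inp out) (times k d s) = RamState (n + k.+1) M' inp out].
Proof.
move=> ds.
have H (j : nat) (v : int) n0 M0 : M0 d = v -> exists M', [/\ same_but [:: d] M0 M', M' d = v + j%:Z * M0 s &
    run (RamState n0 M0 inp out) (nseq j (Add d d s)) = RamState (n0 + j) M' inp out].
  elim: j v n0 M0 => [|j IH] v n0 M0 Hv.
    by exists M0; split=> //; rewrite ?mul0r ?addr0 // /run /= addn0.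
  have [M' [s1 e1 r1]] := IH (v + M0 s) n0.+1 (upd M0 d (M0 d + M0 s)) ltac:(by rewrite /upd eqxx Hv).
  exists M'; split.
  - by move=> r Hr; rewrite s1 // /upd; move: Hr; rewrite inE => /negbTE ->.
  - by rewrite e1 /upd eq_sym (negbTE ds); lia.
  - by rewrite /run /= in r1 *; rewrite r1 addnS.
have [M' [s1 e1 r1]] := H k 0 n.+1 (upd M d 0) ltac:(by rewrite /upd eqxx).
exists M'; split.
- by move=> r Hr; rewrite s1 // /upd; move: Hr; rewrite inE => /negbTE ->.
- by rewrite e1 /upd eq_sym (negbTE ds) add0r.
- by rewrite /run /= in r1 *; rewrite r1 addnS.
Qed.

Variables (m1 m2 D : nat) (shape : nat -> seq (nat * nat)).

(* Register 8 receives [e + D (n + D (w + D s))]. *)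
Definition prepare : seq instr :=
  times m1 (Posz 6) (Posz 0) ++ times m2 (Posz 7) (Posz 1) ++ times D (Posz 8) (Posz 5) ++ [:: Add (Posz 12) (Posz 8) (Posz 4)] ++ times D (Posz 8) (Posz 12) ++
  [:: Add (Posz 12) (Posz 8) (Posz 3)] ++ times D (Posz 8) (Posz 12) ++ [:: Add (Posz 8) (Posz 8) (Posz 2); Const (Posz 10) 1].

(** On exhausted input the jump goes to [L], which will be the length of the program, so the machine
    halts. *)
Definition reads (L : nat) : seq instr := [seq Read k%:Z L | k <- iota 0 6].

(** A switch on register 8 by repeated decrement, starting at address [a]: entry number [v] is
    reached after [v] positive tests. Register 10 holds 1, so the jump on it is unconditional and
    returns to the reading of the next cell. *)
Fixpoint chain (a : nat) (Ls : seq (seq (nat * nat))) : seq instr :=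
  if Ls is L :: Ls' then
    let n := size (emit L) in
    (JumpPos (Posz 8) (a + n + 2) :: emit L ++ [:: JumpPos (Posz 10) 0]) ++
    Sub (Posz 8) (Posz 8) (Posz 10) :: chain (a + n + 3) Ls'
  else [::].

Definition shapes : seq (seq (nat * nat)) := [seq shape k | k <- iota 0 (D ^ 4)].

Definition prog_start : nat := 6 + size prepare.
Definition prog_len : nat := prog_start + size (chain prog_start shapes).
Definition prog : seq instr := reads prog_len ++ prepare ++ chain prog_start shapes.

Lemma straight_prepare : all straight prepare.
Proof. by rewrite /prepare !all_cat /times /= !all_nseq /= !orbT. Qed.

Lemma run_prepare n M inp out : exists M',
  [/\ M' (Posz 6) = m1%:Z * M (Posz 0), M' (Posz 7) = m2%:Z * M (Posz 1), M' (Posz 10) = 1,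
      M' (Posz 8) = M (Posz 2) + D%:Z * (M (Posz 3) + D%:Z * (M (Posz 4) + D%:Z * M (Posz 5))) &
      run (RamState n M inp out) prepare = RamState (n + size prepare) M' inp out].
Proof.
have T k d s n0 M0 : d != s -> exists M', [/\ same_but [:: d] M0 M', M' d = k%:Z * M0 s &
    run (RamState n0 M0 inp out) (times k d s) = RamState (n0 + size (times k d s)) M' inp out].
  move=> ds; have [M' [h1 h2 h3]] := run_times k n0 M0 inp out ds.
  by exists M'; split=> //; rewrite h3 /= size_nseq.
rewrite /prepare !run_cat.
have [M1 [s1 e1 ->]] := T m1 (Posz 6) (Posz 0) n M isT.
have [M2 [s2 e2 ->]] := T m2 (Posz 7) (Posz 1) (n + size (times m1 (Posz 6) (Posz 0)))%N M1 isT.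
have [M3 [s3 e3 ->]] := T D (Posz 8) (Posz 5) (n + size (times m1 (Posz 6) (Posz 0)) + size (times m2 (Posz 7) (Posz 1)))%N M2 isT.
set n3 := (_ + size (times D (Posz 8) (Posz 5)))%N.
pose M4 := upd M3 (Posz 12) (M3 (Posz 8) + M3 (Posz 4)).
have -> : run (RamState n3 M3 inp out) [:: Add (Posz 12) (Posz 8) (Posz 4)] =
  RamState n3.+1 M4 inp out by [].
have [M5 [s5 e5 ->]] := T D (Posz 8) (Posz 12) n3.+1 M4 isT.
set n5 := (_ + size (times D (Posz 8) (Posz 12)))%N.
pose M6 := upd M5 (Posz 12) (M5 (Posz 8) + M5 (Posz 3)).
have -> : run (RamState n5 M5 inp out) [:: Add (Posz 12) (Posz 8) (Posz 3)] =
  RamState n5.+1 M6 inp out by [].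
have [M7 [s7 e7 ->]] := T D (Posz 8) (Posz 12) n5.+1 M6 isT.
set n7 := (_ + size (times D (Posz 8) (Posz 12)))%N.
have keep k : k \notin [:: Posz 6; Posz 7; Posz 8; Posz 12] -> M7 k = M k.
  rewrite !inE !negb_or => /and4P[k6 k7 k8 k12].
  rewrite s7 ?inE // /M6 /upd (negbTE k12) s5 ?inE // /M4 /upd (negbTE k12).
  by rewrite s3 ?inE // s2 ?inE // s1 ?inE.
have keep5 k : k \notin [:: Posz 6; Posz 7; Posz 8; Posz 12] -> M5 k = M k.
  rewrite !inE !negb_or => /and4P[k6 k7 k8 k12].
  rewrite s5 ?inE // /M4 /upd (negbTE k12).
  by rewrite s3 ?inE // s2 ?inE // s1 ?inE.
have keep3 k : k \notin [:: Posz 6; Posz 7; Posz 8; Posz 12] -> M3 k = M k.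
  rewrite !inE !negb_or => /and4P[k6 k7 k8 k12].
  by rewrite s3 ?inE // s2 ?inE // s1 ?inE.
have keep2 : M2 (Posz 5) = M (Posz 5) by rewrite s2 // s1.
exists (upd (upd M7 (Posz 8) (M7 (Posz 8) + M7 (Posz 2))) (Posz 10) 1); split.
- change (M7 (Posz 6) = m1%:Z * M (Posz 0)); rewrite s7 //.
  change (M5 (Posz 6) = m1%:Z * M (Posz 0)); rewrite s5 //.
  by change (M3 (Posz 6) = m1%:Z * M (Posz 0)); rewrite s3 // s2.
- change (M7 (Posz 7) = m2%:Z * M (Posz 1)); rewrite s7 //.
  change (M5 (Posz 7) = m2%:Z * M (Posz 1)); rewrite s5 //.
  by change (M3 (Posz 7) = m2%:Z * M (Posz 1)); rewrite s3 // e2 s1.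
- by [].
- have E6 : M6 (Posz 12) = M5 (Posz 8) + M5 (Posz 3) by [].
  have E4 : M4 (Posz 12) = M3 (Posz 8) + M3 (Posz 4) by [].
  change (M7 (Posz 8) + M7 (Posz 2) = M (Posz 2) + D%:Z * (M (Posz 3) + D%:Z * (M (Posz 4) + D%:Z * M (Posz 5)))).
  rewrite e7 E6 e5 E4 e3 keep2 !keep // !keep5 // !keep3 //.
  by rewrite addrC; congr (_ + _ * _); rewrite addrC; congr (_ + _ * _); rewrite addrC.
- have -> : run (RamState n7 M7 inp out) [:: Add (Posz 8) (Posz 8) (Posz 2); Const (Posz 10) 1] =
    RamState n7.+2 (upd (upd M7 (Posz 8) (M7 (Posz 8) + M7 (Posz 2))) (Posz 10) 1) inp out by [].
  congr RamState; rewrite /n7 /n5 /n3 /times !size_cat /= !size_nseq; lia.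
Qed.

(** Within one pass control only moves forward until the final jump to 0, so each instruction is
    executed at most once and the size bounds the time. *)
Lemma run_chain (Ls : seq (seq (nat * nat))) pre P n v M inp out :
  P = pre ++ chain (size pre) Ls -> (v < size Ls)%N -> M (Posz 8) = v%:Z -> M (Posz 10) = 1 ->
  n = size pre ->
  exists t M', (t <= size (chain (size pre) Ls))%N /\
    iter t (step P) (RamState n M inp out) =
    RamState 0 M' inp (out ++ flatten [seq [:: M (Posz 6) + o.1%:Z; M (Posz 7) + o.2%:Z] | o <- nth [::] Ls v]).
Proof.
elim: Ls pre P n v M => [|L Ls IH] pre P n v M //= EP Hv H8 H10 En.
set len := size (emit L) in EP *.
case: v Hv H8 => [|v] Hv H8.
  have S1 : step P (RamState n M inp out) = RamState n.+1 M inp out.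
    by rewrite /step EP En onth_cat_at /exec H8.
  have EP2 : P = rcons pre (JumpPos (Posz 8) (size pre + len + 2)) ++ emit L ++
      (JumpPos (Posz 10) 0 :: Sub (Posz 8) (Posz 8) (Posz 10) :: chain (size pre + len + 3) Ls).
    by rewrite EP cat_rcons /= -!catA.
  have [M' [sM' E']] := run_emit L n.+1 M inp out.
  have [E2 E3] := @run_steps (rcons pre (JumpPos (Posz 8) (size pre + len + 2))) (emit L)
    (JumpPos (Posz 10) 0 :: Sub (Posz 8) (Posz 8) (Posz 10) :: chain (size pre + len + 3) Ls)
    (RamState n.+1 M inp out) (straight_emit L) ltac:(by rewrite size_rcons /= En).
  rewrite -EP2 E' in E2.
  exists (len.+2), M'; split; first by rewrite size_cat /= size_cat /= -/len; lia.
  rewrite iterS iterSr S1 E2.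
  have EP3 : P = (rcons pre (JumpPos (Posz 8) (size pre + len + 2)) ++ emit L) ++
      (JumpPos (Posz 10) 0 :: Sub (Posz 8) (Posz 8) (Posz 10) :: chain (size pre + len + 3) Ls) by rewrite EP2 catA.
  have En2 : (n.+1 + size (emit L))%N = size (rcons pre (JumpPos (Posz 8) (size pre + len + 2)) ++ emit L).
    by rewrite size_cat size_rcons En.
  have S3 : onth P (n.+1 + size (emit L)) = Some (JumpPos (Posz 10) 0).
    by rewrite En2 EP3 onth_cat_at.
  by rewrite /step [pc _]/= S3 /exec sM' // H10.
have S1 : step P (RamState n M inp out) = RamState (size pre + len + 2) M inp out.
  by rewrite /step EP En onth_cat_at /exec H8.
pose pre2 := (rcons pre (JumpPos (Posz 8) (size pre + len + 2)) ++ emit L ++ [:: JumpPos (Posz 10) 0]).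
have Spre2 : size pre2 = (size pre + len + 2)%N by rewrite /pre2 !size_cat size_rcons /= -/len; lia.
have EP2 : P = pre2 ++ Sub (Posz 8) (Posz 8) (Posz 10) :: chain (size pre + len + 3) Ls.
  by rewrite EP /pre2 cat_rcons /= -!catA /= -catA.
pose M1 := upd M (Posz 8) (M (Posz 8) - M (Posz 10)).
have S2 : step P (RamState (size pre + len + 2) M inp out) = RamState (size pre + len + 3) M1 inp out.
  have S2' : onth P (size pre + len + 2) = Some (Sub (Posz 8) (Posz 8) (Posz 10)).
    by rewrite -Spre2 EP2 onth_cat_at.
  by rewrite /step [pc _]/= S2' /exec !addnS.
pose pre3 := rcons pre2 (Sub (Posz 8) (Posz 8) (Posz 10)).
have Spre3 : size pre3 = (size pre + len + 3)%N by rewrite size_rcons Spre2 -addnS.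
have [||||t [M' [Ht E]]] := IH pre3 P (size pre + len + 3)%N v M1 _ Hv.
- by rewrite EP2 -cat_rcons -/pre3 Spre3.
- by rewrite /M1 /upd eqxx H8 H10; lia.
- by rewrite /M1 /upd /= H10.
- by rewrite Spre3.
exists t.+2, M'; split; first by rewrite size_cat /= size_cat /= -/len -Spre3; lia.
rewrite iterSr S1 iterSr S2 E.
by rewrite /M1 /upd /=.
Qed.

Definition code (e n w s : nat) : nat := (e + D * (n + D * (w + D * s)))%N.

Lemma code_lt e n w s : (e < D)%N -> (n < D)%N -> (w < D)%N -> (s < D)%N -> (code e n w s < D ^ 4)%N.
Proof.
move=> He Hn Hw Hs; rewrite /code !expnS expn0 muln1.
have h1 : (w + D * s < D * D)%N by nia.
have h2 : (n + D * (w + D * s) < D * (D * D))%N by nia.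
by nia.
Qed.

Lemma prog_size : size prog = prog_len.
Proof. by rewrite /prog /prog_len /prog_start !size_cat /=. Qed.

Lemma prog_cell x y (e n w s : nat) M rest out :
  (e < D)%N -> (n < D)%N -> (w < D)%N -> (s < D)%N ->
  exists t M', (t <= size prog)%N /\
    iter t (step prog) (RamState 0 M ([:: x, y, e%:Z, n%:Z, w%:Z, s%:Z & rest]) out) =
    RamState 0 M' rest (out ++ flatten
      [seq [:: m1%:Z * x + o.1%:Z; m2%:Z * y + o.2%:Z] | o <- shape (code e n w s)]).
Proof.
move=> He Hn Hw Hs.
pose M0 := upd (upd (upd (upd (upd (upd M (Posz 0) x) (Posz 1) y) (Posz 2) e%:Z) (Posz 3) n%:Z) (Posz 4) w%:Z) (Posz 5) s%:Z.
have R6 : iter 6 (step prog) (RamState 0 M ([:: x, y, e%:Z, n%:Z, w%:Z, s%:Z & rest]) out) =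
    RamState 6 M0 rest out by [].
have [M1 [h6 h7 h10 h8 E1]] := run_prepare 6 M0 rest out.
have [E2 _] := @run_steps (reads prog_len) prepare (chain prog_start shapes)
  (RamState 6 M0 rest out) straight_prepare erefl.
rewrite -/prog E1 in E2.
have Sst : size (reads prog_len ++ prepare) = prog_start by rewrite size_cat.
have Hv : (code e n w s < size shapes)%N by rewrite size_map size_iota; apply: code_lt.
have [||||t [M' [Ht E3]]] := @run_chain shapes (reads prog_len ++ prepare) prog prog_start
    (code e n w s) M1 rest out _ Hv.
- by rewrite Sst /prog catA.
- by rewrite h8 /M0 /upd /= /code; lia.
- exact: h10.
- by rewrite Sst.
exists (t + (size prepare + 6))%N, M'; split.
  by rewrite prog_size /prog_len -Sst; move: Ht; rewrite Sst /prog_start; lia.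
rewrite !iterD R6 E2 E3; congr RamState; congr (_ ++ flatten _).
have Hc := code_lt He Hn Hw Hs.
rewrite (nth_map 0%N) ?size_iota // nth_iota //.
by rewrite h6 h7 /M0 /upd.
Qed.

Lemma prog_correct (xs : seq ((int * int) * (nat * nat * nat * nat))) M out :
  (forall k, k \in xs -> let: (e, n, w, s) := k.2 in [/\ (e < D)%N, (n < D)%N, (w < D)%N & (s < D)%N]) ->
  exists t M', (t <= size prog * size xs + 1)%N /\
    iter t (step prog) (RamState 0 M (flatten [seq let: (e, n, w, s) := k.2 in
        [:: k.1.1; k.1.2; e%:Z; n%:Z; w%:Z; s%:Z] | k <- xs]) out) =
    RamState (size prog) M' [::] (out ++ flatten [seq let: (e, n, w, s) := k.2 in flatten
      [seq [:: m1%:Z * k.1.1 + o.1%:Z; m2%:Z * k.1.2 + o.2%:Z] | o <- shape (code e n w s)] | k <- xs]).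
Proof.
elim: xs M out => [|[[x y] [[[e n] w] s]] xs IH] M out Hxs.
  (* The additional step is the [Read] that finds the input exhausted. *)
  exists 1%N, M; split; first by lia.
  by rewrite cats0 prog_size.
have [He Hn Hw Hs] := Hxs _ (mem_head _ _).
have [t [M1 [Ht E]]] := prog_cell x y M (flatten [seq let: (e, n, w, s) := k.2 in
        [:: k.1.1; k.1.2; e%:Z; n%:Z; w%:Z; s%:Z] | k <- xs]) out He Hn Hw Hs.
have [|t' [M2 [Ht' E']]] := IH M1 (out ++ flatten
      [seq [:: m1%:Z * x + o.1%:Z; m2%:Z * y + o.2%:Z] | o <- shape (code e n w s)]).
  by move=> k Hk; apply: Hxs; rewrite inE Hk orbT.
exists (t' + t)%N, M2; split.
  rewrite [size (_ :: _)]/= mulnS; move: Ht Ht'.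
  by move: (size prog) (size prog * size xs)%N => a b; lia.
by rewrite iterD /= E E' -catA.
Qed.

End Program.

Local Close Scope ring_scope.
Local Close Scope classical_set_scope.

(** * Local geometry of bricks and fillers *)

Section Widths.
Local Open Scope Z_scope.

Definition wd (s : Z) : Z :=
  if s mod 4 =? 0 then 8 else if s mod 4 =? 1 then 9
  else if s mod 4 =? 2 then 12 else 11.

End Widths.

Section Columns.
Local Open Scope Z_scope.
Local Ltac Zify.zify_post_hook ::= Z.to_euclidean_division_equations.

Lemma wd_bounds s : 8 <= wd s <= 12.
Proof. by rewrite /wd; repeat case: Z.eqb_spec => ?; lia. Qed.

Lemma wd_mod s s' : wd s = wd s' <-> s mod 4 = s' mod 4.
Proof.
rewrite /wd; have := Z.mod_pos_bound s 4; have := Z.mod_pos_bound s' 4.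
by repeat case: Z.eqb_spec => ?; lia.
Qed.

Lemma wd_brick_bounds s : 17 <= wd s + wd (s + 1) <= 23.
Proof. by rewrite /wd; repeat case: Z.eqb_spec => ?; lia. Qed.

Lemma wd_brick_wd s s' : wd s <> wd s' + wd (s' + 1).
Proof. by have := wd_bounds s; have := wd_bounds s'; have := wd_bounds (s' + 1); lia. Qed.

(* The four widths are chosen so that a brick width splits into two slot widths
   in only one way. *)
Lemma wd_split s a b : wd a + wd b = wd s + wd (s + 1) ->
  (wd a = wd s /\ wd b = wd (s + 1)) \/ (wd a = wd (s + 1) /\ wd b = wd s).
Proof.
have -> : wd (s + 1) = wd (s mod 4 + 1) by apply/wd_mod; lia.
have -> : wd s = wd (s mod 4) by apply/wd_mod; lia.
have : 0 <= s mod 4 < 4 by lia.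
move: (s mod 4) => m Hm.
have : m = 0 \/ m = 1 \/ m = 2 \/ m = 3 by lia.
rewrite {1 2}/wd.
by case=> [->|[->|[->|->]]]; rewrite /wd /=; repeat case: Z.eqb_spec => ?; lia.
Qed.

(** A tile of width [w] and height [h] with lower left cell [(a, b)] is recorded as [Tl a b w h].
    Relations over [Z] turn the geometric arguments into linear arithmetic. *)
Variables (Om : Z -> Z -> Prop) (Tl : Z -> Z -> Z -> Z -> Prop) (t G e : Z).

Definition in_tile a b w h x y := a <= x < a + w /\ b <= y < b + h.

(** Divisibility by 3 distinguishes piles of fillers from piles with one brick, whose height is 1
    modulo 3. The parity keeps fillers of adjacent slots on one floor from ending level. *)
Definition filler_len s h :=
  [/\ h mod 3 = 0, G - e <= h <= G + e & h mod 2 = (s + 1) mod 2].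

Record tiles_ok : Prop := TilesOk {
  tiles_cover : forall x y, Om x y ->
    exists a b w h, Tl a b w h /\ in_tile a b w h x y;
  tiles_sub : forall a b w h x y, Tl a b w h -> in_tile a b w h x y -> Om x y;
  tiles_disj : forall a b w h a' b' w' h' x y, Tl a b w h -> Tl a' b' w' h' ->
    in_tile a b w h x y -> in_tile a' b' w' h' x y ->
    [/\ a = a', b = b', w = w' & h = h'];
  tiles_size : forall a b w h, Tl a b w h ->
    (h = t /\ exists s, w = wd s + wd (s + 1)) \/
    (exists s, w = wd s /\ filler_len s h) }.

Record params_ok : Prop := ParamsOk {
  param_e : 0 < e; param_G : 100 * e <= G; param_t : 20 * G <= t;
  param_t3 : t mod 3 = 1 }.

Hypothesis HT : tiles_ok.
Hypothesis HP : params_ok.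

(** No tile crosses the lower edge of [(x, y)]. This holds vacuously when one side of the edge is
    uncovered, so the border of the region counts as a boundary between tiles; [ncross] does the
    same for the left edge. *)
Definition bd x y := forall a b w h, Tl a b w h ->
  in_tile a b w h x y -> in_tile a b w h x (y - 1) -> False.

Definition ncross x y := forall a b w h, Tl a b w h ->
  in_tile a b w h x y -> in_tile a b w h (x - 1) y -> False.

Let He := param_e HP.
Let HG := param_G HP.
Let Ht := param_t HP.

Lemma tile_filler a b s h : Tl a b (wd s) h -> filler_len s h.
Proof.
case/(tiles_size HT)=> [[_ [s' E]]|[s' [/wd_mod E]]]; first by case: (wd_brick_wd E).
by case=> H1 H2 H3; split=> //; lia.
Qed.

Lemma tile_brick a b s h : Tl a b (wd s + wd (s + 1)) h -> h = t.
Proof.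
by case/(tiles_size HT)=> [[]|[s' [E]]] //; case: (@wd_brick_wd s' s).
Qed.

Lemma tile_pos a b w h : Tl a b w h -> 8 <= w /\ G - e <= h.
Proof.
case/(tiles_size HT)=> [[-> [s ->]]|[s [-> [_ H _]]]]; have := wd_bounds s; last lia.
by have := wd_bounds (s + 1); lia.
Qed.

Lemma bd_bot_eq x y a b w h : bd x y -> Tl a b w h -> in_tile a b w h x y -> b = y.
Proof.
move=> Hb HTl Hin; case: (Z.eq_dec b y) => // Hby.
by case: (Hb _ _ _ _ HTl Hin); move: Hin; rewrite /in_tile; lia.
Qed.

Lemma ncross_left_eq x y a b w h :
  ncross x y -> Tl a b w h -> in_tile a b w h x y -> a = x.
Proof.
move=> Hb HTl Hin; case: (Z.eq_dec a x) => // Hby.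
by case: (Hb _ _ _ _ HTl Hin); move: Hin; rewrite /in_tile; lia.
Qed.

Lemma bd_top x a b w h : Tl a b w h -> a <= x < a + w -> bd x (b + h).
Proof.
move=> H Hx a' b' w' h' H' I1 I2; have [_ Hh] := tile_pos H.
have I3 : in_tile a b w h x (b + h - 1) by rewrite /in_tile; lia.
by have [? ? ? ?] := tiles_disj HT H H' I3 I2; move: I1; rewrite /in_tile; lia.
Qed.

Lemma ncross_tile_left y a b w h : Tl a b w h -> b <= y < b + h -> ncross a y.
Proof.
move=> H Hx a' b' w' h' H' I1 I2; have [Hw Hh] := tile_pos H.
have I3 : in_tile a b w h a y by rewrite /in_tile; lia.
by have [? ? ? ?] := tiles_disj HT H H' I3 I1; move: I2; rewrite /in_tile; lia.
Qed.

Lemma ncross_tile_right y a b w h : Tl a b w h -> b <= y < b + h -> ncross (a + w) y.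
Proof.
move=> H Hx a' b' w' h' H' I1 I2; have [Hw Hh] := tile_pos H.
have I3 : in_tile a b w h (a + w - 1) y by rewrite /in_tile; lia.
by have [? ? ? ?] := tiles_disj HT H H' I3 I2; move: I1; rewrite /in_tile; lia.
Qed.

Lemma ncross_out x y : ~ Om x y -> ncross x y.
Proof. by move=> H a b w h HTl I1 _; exact/H/(tiles_sub HT HTl I1). Qed.

Lemma ncross_outl x y : ~ Om (x - 1) y -> ncross x y.
Proof. by move=> H a b w h HTl _ I1; exact/H/(tiles_sub HT HTl I1). Qed.

Lemma bd_out x y : ~ Om x y -> bd x y.
Proof. by move=> H a b w h HTl I1 _; exact/H/(tiles_sub HT HTl I1). Qed.

Lemma bd_out_below x y : ~ Om x (y - 1) -> bd x y.
Proof. by move=> H a b w h HTl _ I1; exact/H/(tiles_sub HT HTl I1). Qed.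

(* A floor at height [y] cannot extend over a step at height [z] slightly below
   it, as no tile is short enough to fill the gap. *)
Lemma ncross_gap x y z : bd (x - 1) y -> bd x z -> z < y < z + (G - e) ->
  (Om x y -> Om x (y - 1)) -> ncross x y.
Proof.
move=> B1 B2 Hz HO a b w h HTl I1 I2.
have Eb := bd_bot_eq B1 HTl I2.
have /(tiles_cover HT)[a' [b' [w' [h' [H' I']]]]] := HO (tiles_sub HT HTl I1).
have [_ Hh] := tile_pos H'.
have Hbz : z <= b'.
  case: (Z_lt_le_dec b' z) => // Hlt.
  by case: (B2 _ _ _ _ H'); move: I'; rewrite /in_tile; lia.
have I3 : in_tile a' b' w' h' x y by move: I'; rewrite /in_tile; lia.
by have [? ? ? ?] := tiles_disj HT HTl H' I1 I3; move: I'; rewrite /in_tile; lia.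
Qed.

Lemma ncross_no_bd x y : bd (x - 1) y -> ~ bd x y -> ncross x y.
Proof.
move=> B1 B2 a b w h HTl I1 I2; apply: B2 => a' b' w' h' H' J1 J2.
have Eb := bd_bot_eq B1 HTl I2.
by have [? ? ? ?] := tiles_disj HT HTl H' I1 J1; move: J2; rewrite /in_tile; lia.
Qed.

Lemma first_tile x y : Om x y -> bd x y -> ncross x y -> exists w h, Tl x y w h.
Proof.
move=> /(tiles_cover HT)[a [b [w [h [H I]]]]] B N; exists w, h.
by rewrite -(bd_bot_eq B H I) -(ncross_left_eq N H I).
Qed.

Lemma width_le x x' y w h : Tl x y w h -> x < x' -> ncross x' y -> w <= x' - x.
Proof.
move=> H Hx N; case: (Z_le_gt_dec w (x' - x)) => // Hw; have [_ Hh] := tile_pos H.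
by case: (N _ _ _ _ H); rewrite /in_tile; lia.
Qed.

Definition floor x x' y := forall z, x <= z < x' -> Om z y /\ bd z y.

Lemma floor_next x x' y w h : floor x x' y -> ncross x' y -> Tl x y w h ->
  w < x' - x -> exists w' h', Tl (x + w) y w' h' /\ w' <= x' - x - w.
Proof.
move=> F N H Hw; have [Hw8 Hh] := tile_pos H.
have [Ho B] : Om (x + w) y /\ bd (x + w) y by apply: F; lia.
have Nr : ncross (x + w) y by apply: (ncross_tile_right H); lia.
have [w' [h' H']] := first_tile Ho B Nr; exists w', h'; split=> //.
by have := width_le H' _ N; lia.
Qed.

(** A slot is at most 12 wide and a tile at least 8, so two tiles do not fit. *)
Lemma floor_slot x s y : floor x (x + wd s) y -> ncross x y ->
  ncross (x + wd s) y -> exists h, Tl x y (wd s) h.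
Proof.
move=> F N1 N2; have Hs := wd_bounds s.
have [Ho B] : Om x y /\ bd x y by apply: F; lia.
have [w [h H]] := first_tile Ho B N1.
have [Hw8 Hh] := tile_pos H; have Hle := width_le H _ N2.
case: (Z.eq_dec w (wd s)) => [<-|Hne]; first by exists h.
have [|w' [h' [H' Hw']]] := floor_next F N2 H; first lia.
by have := tile_pos H'; lia.
Qed.

(** The width is at most 23, which excludes three tiles, and [wd_split] identifies two tiles up to
    their order. *)
Lemma floor_brick x s y : floor x (x + wd s + wd (s + 1)) y -> ncross x y ->
  ncross (x + wd s + wd (s + 1)) y ->
  [\/ Tl x y (wd s + wd (s + 1)) t,
      exists h h', Tl x y (wd s) h /\ Tl (x + wd s) y (wd (s + 1)) h' |
      exists h h', Tl x y (wd (s + 1)) h /\ Tl (x + wd (s + 1)) y (wd s) h'].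
Proof.
move=> F N1 N2; have Hs := wd_bounds s; have Hs1 := wd_bounds (s + 1).
have [Ho B] : Om x y /\ bd x y by apply: F; lia.
have [w [h H]] := first_tile Ho B N1.
have [Hw8 Hh] := tile_pos H; have Hle := width_le H _ N2.
case: (Z.eq_dec w (wd s + wd (s + 1))) => [E|Hne].
  by rewrite E in H; constructor 1; rewrite -(tile_brick H).
have [|w' [h' [H' Hw']]] := floor_next F N2 H; first lia.
have [Hw8' Hh'] := tile_pos H'.
have Ew : w + w' = wd s + wd (s + 1).
  case: (Z.eq_dec (w + w') (wd s + wd (s + 1))) => // Hn.
  have F' : floor (x + w) (x + wd s + wd (s + 1)) y by move=> z Hz; apply: F; lia.
  have [|w2 [h2 [H2 Hw2]]] := floor_next F' N2 H'; first lia.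
  by have := tile_pos H2; have := wd_brick_bounds s; lia.
have [[_ [q E]]|[q [E _]]] := tiles_size HT H.
  by have := wd_brick_bounds q; have := wd_brick_bounds s; lia.
have [[_ [q' E']]|[q' [E' _]]] := tiles_size HT H'.
  by have := wd_brick_bounds q'; have := wd_brick_bounds s; lia.
have [[E1 E2]|[E1 E2]] := @wd_split s q q' ltac:(lia).
- by constructor 2; exists h, h'; rewrite -E1 -E2 -E -E'.
- by constructor 3; exists h, h'; rewrite -E1 -E2 -E -E'.
Qed.

(** Going up the column, [n] counts the bricks met and [f] adds up the fillers. *)
Lemma stack x y1 y2 : y1 <= y2 -> bd x y1 -> bd x y2 ->
  (forall y, y1 <= y < y2 -> Om x y) ->
  exists n f, [/\ 0 <= n, f mod 3 = 0, f = 0 \/ G - e <= f & y2 - y1 = n * t + f].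
Proof.
have [m Hm] : exists m : nat, (y2 - y1 <= Z.of_nat m) by exists (Z.to_nat (y2 - y1)); lia.
elim: m y1 Hm => [|m IH] y1 Hm Hy B1 B2 HO.
  by exists 0, 0; split=> //; [left | lia].
case: (Z.eq_dec y1 y2) => [->|Hne]; first by exists 0, 0; split=> //; [left | lia].
have /(tiles_cover HT)[a [b [w [h [H I]]]]] := HO y1 ltac:(lia).
have Eb := bd_bot_eq B1 H I; have [_ Hh] := tile_pos H.
have Hle : y1 + h <= y2.
  case: (Z_le_gt_dec (y1 + h) y2) => // Hgt.
  by case: (B2 _ _ _ _ H); move: I; rewrite /in_tile; lia.
have B1' : bd x (y1 + h) by rewrite -Eb; apply: (bd_top H); case: I.
have [||//|//||n [f [Hn Hf Hf' E]]] := IH (y1 + h); [lia | lia | |].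
  by move=> y Hy'; apply: HO; lia.
have [[Eh _]|[q [_ [H3 Hl _]]]] := tiles_size HT H.
  by exists (n + 1), f; split=> //; lia.
by exists n, (f + h); split=> //; lia.
Qed.

(** Below the ceiling there is less room than two shortest fillers need, so the first tile must fill
    it. *)
Lemma pile_ceiling x c a b w h : Tl a b w h -> a <= x < a + w ->
  b < c < b + 2 * (G - e) -> (forall y, b <= y < c -> Om x y) -> ~ Om x c -> b + h = c.
Proof.
move=> H Hx Hc HO HN; have [_ Hh] := tile_pos H.
case: (Z_lt_le_dec c (b + h)) => Hlt.
  by case: HN; apply: (tiles_sub HT H); rewrite /in_tile; lia.
case: (Z.eq_dec (b + h) c) => // Hne.
have /(tiles_cover HT)[a' [b' [w' [h' [H' I']]]]] := HO (b + h) ltac:(lia).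
have Eb := bd_bot_eq (bd_top H Hx) H' I'; have [_ Hh'] := tile_pos H'.
by case: HN; apply: (tiles_sub HT H'); move: I'; rewrite /in_tile; lia.
Qed.

(* A defect at a brick position over the slot [s] starting at [x]: instead of a
   filler and a brick, three fillers are piled up on the floor [y]. *)
Definition defect x s y := exists a1 a2 a3 s',
  [/\ Tl x y (wd s) a1, Tl x (y + a1) (wd s') a2,
      Tl x (y + a1 + a2) (wd s') a3 & s' = s \/ s' = s + 1].

(* The three fillers of a defect can never be completed to a pile of one brick
   and fillers whose parity is that of the neighbouring slot. *)
Lemma defect_no_bd x s y U : defect x s y ->
  U mod 3 = 0 -> U < 3 * (G - e) \/ (U <= 3 * (G + e) /\ U mod 2 = s mod 2) -> 0 <= U ->
  (forall z, y <= z < y + t + U -> Om x z) -> ~ bd x (y + t + U).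
Proof.
move=> [a1 [a2 [a3 [s' [T1 T2 T3 Es']]]]] HU3 HU HU0 HO B.
have [F1 F2 F3] := tile_filler T1; have [F4 F5 F6] := tile_filler T2.
have [F7 F8 F9] := tile_filler T3.
have Hs := wd_bounds s'.
have B3 : bd x (y + a1 + a2 + a3) by apply: (bd_top T3); lia.
have [|//|//||n [f [Hn Hf Hf' E]]] := @stack x (y + a1 + a2 + a3) (y + t + U).
- by lia.
- by move=> z Hz; apply: HO; lia.
have Hn1 : n <= 1.
  case: (Z_le_gt_dec n 1) => // Hn2.
  have : 2 * t <= n * t by apply: Z.mul_le_mono_nonneg_r; lia.
  by lia.
(* With no brick the heights disagree modulo 3. With one brick [U] equals the three fillers plus
   [f]; the bounds leave only [f = 0], and then [U] has the parity of [a1], that of [s + 1], since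
   [a2] and [a3] have equal parity. *)
have [?|?] : n = 0 \/ n = 1 by lia.
- by subst n; have := param_t3 HP; lia.
by subst n; case: Es' => ?; subst s'; lia.
Qed.

Lemma defect_ncross x s y u : defect x s y -> filler_len (s - 1) u ->
  (forall z, y <= z < y + t + u -> Om x z) -> bd (x - 1) (y + t + u) ->
  ncross x (y + t + u).
Proof.
move=> D [F1 F2 F3] HO B; apply: ncross_no_bd => //.
by apply: (defect_no_bd D); lia || by [].
Qed.

(** The column at [x] has no tile boundary at the levels where tiles of slot [s - 1] start, so
    nothing crosses the line [x] there. The wall on the left being given, slot [s - 1] receives a
    filler three times in a row. *)
Lemma defect_step x s y u : defect x s y -> filler_len (s - 1) u ->
  (forall z, y <= z < y + t + 3 * (G + e) -> Om x z) ->
  let x' := x - wd (s - 1) in let y' := y + t + u in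
  (forall z y1, x' <= z < x -> y' <= y1 < y' + t -> Om z y1) ->
  (forall z, x' <= z < x -> bd z y') ->
  (forall y1, y' <= y1 < y' + t -> ncross x' y1) ->
  defect x' (s - 1) y'.
Proof.
move=> D F HO x' y' HO' HB HN; have W := wd_bounds (s - 1).
have [F1 F2 F3] := F.
have Ex : x' + wd (s - 1) = x by rewrite /x'; lia.
(* Applied to [u], [u + d1] and [u + d1 + d2]. The last one may exceed three short fillers, but its
   parity is that of [s], as [d1] and [d2] come from the same slot. *)
have key : forall U, U mod 3 = 0 -> G - e <= U ->
    U <= 2 * (G + e) \/ (U <= 3 * (G + e) /\ U mod 2 = s mod 2) ->
    (forall z, x' <= z < x -> bd z (y + t + U)) -> y' <= y + t + U < y' + t ->
    exists h, Tl x' (y + t + U) (wd (s - 1)) h.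
  move=> U HU1 HU2 HU3 HBU HyU; apply: floor_slot.
  - by rewrite Ex => z Hz; split; [apply: HO'; lia | apply: HBU].
  - by apply: HN; lia.
  - rewrite Ex; apply: ncross_no_bd; first by apply: HBU; lia.
    apply: (defect_no_bd D) => //; try lia.
    by move=> z Hz; apply: HO; lia.
have [|||//||d1 T1] := key u; [lia | lia | lia | lia |].
have [L1 L2 L3] := tile_filler T1.
have [|||||d2 T2] := key (u + d1); [lia | lia | lia | | lia |].
  by move=> z Hz; rewrite Z.add_assoc; apply: (bd_top T1); lia.
have [M1 M2 M3] := tile_filler T2.
have [|||||d3 T3] := key (u + d1 + d2); [lia | lia | lia | | lia |].
  by move=> z Hz; rewrite (Z.add_assoc _ (u + d1)); apply: (bd_top T2); lia.
exists d1, d2, d3, (s - 1); split=> //; last by left.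
- by rewrite /y' -Z.add_assoc.
- by move: T3; congr Tl; rewrite /y'; lia.
Qed.

Section Base.
(** The slots [s] and [s + 1] start at [x0] and [x1]. They rest at heights [he] and [h2] on two
    different bricks of the row below. *)
Variables (x0 s he h2 : Z).
Let x1 := x0 + wd s.
Let x2 := x1 + wd (s + 1).
Let x3 := x2 + wd (s + 2).

Lemma left_first : (forall x y, x0 <= x < x1 -> he <= y < he + (G - e) -> Om x y) ->
  (forall x, x0 <= x < x1 -> bd x he) -> ncross x0 he -> ncross x1 he ->
  exists d, Tl x0 he (wd s) d /\ filler_len s d.
Proof.
move=> HO HB N0 N1; have [|//|//|d H] := @floor_slot x0 s he.
  by move=> z Hz; split; [apply: HO => //; lia | apply: HB].
by exists d; split=> //; apply: tile_filler H.
Qed.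

(** Slot [s + 2] rests on the same brick as slot [s + 1]. It is missing, or open over a height [t],
    or closed after one filler by a brick outside the region. *)
Definition right_side :=
  (forall y, h2 <= y < h2 + t -> ~ Om x2 y) \/
  [/\ forall x, x2 <= x < x3 -> Om x h2 /\ bd x h2, ncross x3 h2 &
      (forall x y, x2 <= x < x3 -> h2 <= y < h2 + t -> Om x y) \/
      (exists c, filler_len (s + 2) (c - h2) /\
         forall x, x2 <= x < x3 -> (forall y, h2 <= y < c -> Om x y) /\
           (forall y, c <= y < c + t -> ~ Om x y))].

(** On the floor [h2] lies a brick placed too early, or a filler of slot [s + 1], or one of slot
    [s + 2] in swapped order. A ceiling over slot [s + 2] excludes the swap, since the filler under
    it would have the wrong parity. *)
Lemma right_first : (forall x y, x1 <= x < x2 -> h2 <= y < h2 + (G - e) -> Om x y) ->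
  (forall x y, x1 <= x < x2 -> h2 < y < h2 + t -> Om x y -> Om x (y - 1)) ->
  (forall x, x1 <= x < x2 -> bd x h2) -> ncross x1 h2 -> right_side ->
  (exists w, Tl x1 h2 w t) \/
  (exists s' h, [/\ s' = s + 1 \/ (s' = s + 2 /\
        forall x y, x2 <= x < x3 -> h2 <= y < h2 + t -> Om x y),
      Tl x1 h2 (wd s') h, filler_len s' h & ncross (x1 + wd s') (h2 + h)]).
Proof.
move=> HO HD HB N1; have W1 := wd_bounds (s + 1); have W2 := wd_bounds (s + 2).
have HGp : 0 < G - e by lia.
case=> [HR|[HR N3 HRc]].
  have [|//||h H] := @floor_slot x1 (s + 1) h2.
  - by move=> z Hz; split; [apply: HO => //; lia | apply: HB].
  - by apply/ncross_out/HR; lia.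
  right; exists (s + 1), h; have F := tile_filler H; split=> //; first by left.
  by apply/ncross_out/HR; case: F; lia.
have Es : s + 1 + 1 = s + 2 by lia.
have HR' : forall x y, x2 <= x < x3 -> h2 < y < h2 + t -> Om x y -> Om x (y - 1).
  move=> x y Hx Hy Hxy; case: HRc => [HRc|[c [[_ Hc _] HRc]]]; first by apply: HRc; lia.
  have [Hl Hu] := HRc x Hx; apply: Hl; split; first by lia.
  by case: (Z_lt_le_dec (y - 1) c) => // Hyc; case: (Hu y) => //; lia.
have HD' : forall x y, x1 <= x < x3 -> h2 < y < h2 + t -> Om x y -> Om x (y - 1).
  move=> x y Hx; case: (Z_lt_le_dec x x2) => Hx2; first by apply: HD; lia.
  by apply: HR'; lia.
have := @floor_brick x1 (s + 1) h2; rewrite Es => /(_ _ N1 N3)[].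
- move=> z Hz; case: (Z_lt_le_dec z x2) => Hz2.
    by split; [apply: HO => //; lia | apply: HB; lia].
  by apply: HR; rewrite /x3 /x2; lia.
- by move=> H; left; eexists; exact: H.
- move=> [h [h' [H H']]]; right; exists (s + 1), h; have F := tile_filler H.
  have [F1 F2 F3] := F; have [F1' F2' F3'] := tile_filler H'.
  split=> //; first by left.
  case: (Z_lt_le_dec h h') => Hh; first by apply: (ncross_tile_left H'); lia.
  apply: (@ncross_gap _ _ (h2 + h')); try lia.
  + by apply: (bd_top H); lia.
  + by apply: (bd_top H'); lia.
  + by apply: HD'; rewrite /x3 /x2; lia.
- move=> [h [h' [H H']]]; right; exists (s + 2), h; have F := tile_filler H.
  have [F1 F2 F3] := F; have [F1' F2' F3'] := tile_filler H'.
  split=> //.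
    right; split=> //; case: HRc => [//|[c [[Hc1 Hc2 Hc3] HRc]]].
    have [Hl Hu] := HRc (x3 - 1) ltac:(rewrite /x3; lia).
    have := @pile_ceiling (x3 - 1) c _ _ _ _ H' ltac:(rewrite /x3 /x2; lia) ltac:(lia) Hl.
    by move/(_ (Hu c ltac:(lia))) => ?; lia.
  case: (Z_lt_le_dec h h') => Hh; first by apply: (ncross_tile_left H'); lia.
  apply: (@ncross_gap _ _ (h2 + h')); try lia.
  + by apply: (bd_top H); lia.
  + by apply: (bd_top H'); lia.
  + by apply: HD'; rewrite /x3 /x2; lia.
Qed.

Lemma brick_or_defect :
  (forall x y, x0 <= x < x1 -> he <= y < he + t -> Om x y) ->
  (forall x y, x1 <= x < x2 -> h2 <= y < h2 + t -> Om x y) ->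
  (forall x, x0 <= x < x1 -> bd x he) -> (forall x, x1 <= x < x2 -> bd x h2) ->
  (forall y, he <= y < he + t -> ncross x0 y) ->
  (he - h2) mod 2 = 1 -> - e <= he - h2 <= e ->
  (he < h2 -> ncross x1 he) -> (h2 < he -> ncross x1 h2) -> right_side ->
  (exists d1 d2, [/\ he + d1 = h2 + d2, Tl x0 he (wd s) d1, Tl x1 h2 (wd (s + 1)) d2 &
     Tl x0 (he + d1) (wd s + wd (s + 1)) t]) \/
  defect x0 s he.
Proof.
move=> HO1 HO2 HB1 HB2 HL Hpar Hdiff HC1 HC2 HR.
have W0 := wd_bounds s; have W1 := wd_bounds (s + 1); have W2 := wd_bounds (s + 2).
have Ex1 : x1 - 1 < x1 by lia.
have N1 : ncross x1 he.
  case: (Z_lt_le_dec he h2) => [/HC1 //|Hle].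
  apply: (@ncross_gap _ _ h2); try lia.
  - by apply: HB1; rewrite /x1; lia.
  - by apply: HB2; rewrite /x2; lia.
  - by move=> _; apply: HO2; rewrite /x2; lia.
have [d1 [T1 [F1 F2 F3]]] : exists d, Tl x0 he (wd s) d /\ filler_len s d.
  apply: left_first => //; last by apply: HL; lia.
  by move=> x y Hx Hy; apply: HO1 => //; lia.
have N2 : ncross x1 h2.
  case: (Z_lt_le_dec h2 he) => [/HC2 //|Hle].
  by apply: (ncross_tile_right T1); lia.
have T1R : forall y, he <= y < he + d1 -> ncross x1 y.
  by move=> y Hy; apply: (ncross_tile_right T1).
have BT1 : forall x, x0 <= x < x1 -> bd x (he + d1) by move=> x Hx; apply: (bd_top T1).
have [||//|//|//|[w Tb]|[s' [g [Es' Tg [G1 G2 G3] Nr]]]] := right_first.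
- by move=> x y Hx Hy; apply: HO2 => //; lia.
- by move=> x y Hx Hy _; apply: HO2 => //; lia.
(* A brick standing directly on [h2] is a wall of height [t] to the right of slot [s], which thus
   holds three fillers. *)
- right.
  have Nb : forall y, h2 <= y < h2 + t -> ncross x1 y.
    by move=> y Hy; apply: (ncross_tile_left Tb).
  have [|||d2 T2] := @floor_slot x0 s (he + d1).
  + by move=> z Hz; split; [apply: HO1; rewrite /x1; lia | apply: BT1].
  + by apply: HL; lia.
  + by apply: Nb; lia.
  have [K1 K2 K3] := tile_filler T2.
  have [|||d3 T3] := @floor_slot x0 s (he + d1 + d2).
  + move=> z Hz; split; first by apply: HO1; rewrite /x1; lia.
    by apply: (bd_top T2).
  + by apply: HL; lia.
  + by apply: Nb; lia.
  by exists d1, d2, d3, s; split=> //; left.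
have Ws' := wd_bounds s'.
case: (Z.eq_dec (he + d1) (h2 + g)) => Hfl.
  (* The two floors differ by an odd number, so fillers that end level have opposite parities, which
     rules out slot [s + 2]. *)
  have ? : s' = s + 1 by case: Es' => [//|[? _]]; subst s'; lia.
  subst s'.
  have [|||Tb|[h [h' [T2 T2']]]|[h [h' [T2 T2']]]] := @floor_brick x0 s (he + d1).
  - move=> z Hz; case: (Z_lt_le_dec z x1) => Hz1.
      by split; [apply: HO1; rewrite /x1; lia | apply: BT1; rewrite /x1; lia].
    rewrite Hfl; split; first by apply: HO2; rewrite /x2; lia.
    by apply: (bd_top Tg); lia.
  - by apply: HL; lia.
  - by rewrite Hfl.
  - by left; exists d1, g.
  (* Two fillers stand where the brick should be. Their unequal tops again prevent a crossing, and a
     third filler completes the defect; the swapped order in the next case gives the variant with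
     [s' = s + 1]. *)
  - have [K1 K2 K3] := tile_filler T2; have [K1' K2' K3'] := tile_filler T2'.
    right.
    have [|||d3 T3] := @floor_slot x0 s (he + d1 + h).
    + move=> z Hz; split; first by apply: HO1; rewrite /x1; lia.
      by apply: (bd_top T2).
    + by apply: HL; lia.
    + case: (Z_lt_le_dec h h') => Hh; first by apply: (ncross_tile_left T2'); lia.
      apply: (@ncross_gap _ _ (he + d1 + h')); try lia.
      * by apply: (bd_top T2); lia.
      * by apply: (bd_top T2'); lia.
      * by move=> _; apply: HO2; rewrite /x2 /x1; lia.
    by exists d1, h, d3, s; split=> //; left.
  - have [K1 K2 K3] := tile_filler T2; have [K1' K2' K3'] := tile_filler T2'.
    have OM : forall x y, x0 <= x < x2 -> he + e <= y < he + t - e -> Om x y.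
      move=> x y Hx Hy; case: (Z_lt_le_dec x x1) => Hz1; first by apply: HO1; lia.
      by apply: HO2; lia.
    right.
    have [|||d3 T3] := @floor_slot x0 (s + 1) (he + d1 + h).
    + move=> z Hz; split; first by apply: OM; rewrite /x2 /x1; lia.
      by apply: (bd_top T2).
    + by apply: HL; lia.
    + case: (Z_lt_le_dec h h') => Hh; first by apply: (ncross_tile_left T2'); lia.
      apply: (@ncross_gap _ _ (he + d1 + h')); try lia.
      * by apply: (bd_top T2); lia.
      * by apply: (bd_top T2'); lia.
      * by move=> _; apply: OM; rewrite /x2 /x1; lia.
    by exists d1, h, d3, (s + 1); split=> //; right.
(* The first fillers are not level. The end of a filler is walled by the neighboring tile if that
   one reaches higher, and by [ncross_gap] otherwise, so slot [s] goes on with fillers. *)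
right.
have [|||d2 T2] := @floor_slot x0 s (he + d1).
- by move=> z Hz; split; [apply: HO1; rewrite /x1; lia | apply: BT1].
- by apply: HL; lia.
- case: (Z_lt_le_dec (he + d1) (h2 + g)) => Hh; first by apply: (ncross_tile_left Tg); lia.
  apply: (@ncross_gap _ _ (h2 + g)); try lia.
  + by apply: BT1; rewrite /x1; lia.
  + by apply: (bd_top Tg); lia.
  + by move=> _; apply: HO2; rewrite /x2; lia.
have [K1 K2 K3] := tile_filler T2.
have T2R : forall y, he + d1 <= y < he + d1 + d2 -> ncross x1 y.
  by move=> y Hy; apply: (ncross_tile_right T2).
have [|||g2 Tg2] := @floor_slot x1 s' (h2 + g).
- move=> z Hz; split; last by apply: (bd_top Tg); lia.
  case: (Z_lt_le_dec z x2) => Hz2; first by apply: HO2; lia.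
  case: Es' => [?|[? HO3]]; subst s'; first by move: Hz2; rewrite /x2; lia.
  by apply: HO3; rewrite /x3 /x2; lia.
- by case: (Z_lt_le_dec (h2 + g) (he + d1)) => Hh; [apply: T1R; lia | apply: T2R; lia].
- by [].
have [L1 L2 L3] := tile_filler Tg2.
have {}Es' : s' = s + 1 \/ s' = s + 2 by case: Es' => [->|[-> _]]; [left|right].
have [|||d3 T3] := @floor_slot x0 s (he + d1 + d2).
+ move=> z Hz; split; first by apply: HO1; rewrite /x1; lia.
  by apply: (bd_top T2).
+ by apply: HL; lia.
+ case: (Z_lt_le_dec (he + d1 + d2) (h2 + g + g2)) => Hh.
    by apply: (ncross_tile_left Tg2); lia.
  apply: (@ncross_gap _ _ (h2 + g + g2)); try lia.
  * by apply: (bd_top T2); lia.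
  * by apply: (bd_top Tg2); lia.
  * by move=> _; apply: HO2; rewrite /x2; lia.
by exists d1, d2, d3, s; split=> //; left.
Qed.

End Base.
End Columns.

(** * Displacements as digits in base [S] *)

Section Digits.
Local Open Scope Z_scope.
Local Ltac Zify.zify_post_hook ::= Z.to_euclidean_division_equations.
Variable S : Z.

Fixpoint horner_num (n : nat) (a : Z -> Z) (k : Z) : Z :=
  if n is Datatypes.S n' then a k + S * horner_num n' a (k + 1) else 0.

Definition digit (c i : Z) : Z -> Z := fun k => if k =? c then i else 0.

Lemma horner_num_inj n a b k : 0 < S -> (forall j, 0 <= a j < S) -> (forall j, 0 <= b j < S) ->
  horner_num n a k = horner_num n b k -> forall j, k <= j < k + Z.of_nat n -> a j = b j.
Proof.
move=> S0 Ha Hb; elim: n k => [|n IH] k /= E j Hj; first by lia.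
have Hak := Ha k; have Hbk := Hb k.
have [E1 E2] : a k = b k /\ horner_num n a (k + 1) = horner_num n b (k + 1).
  move: E; move: (horner_num _ a _) (horner_num _ b _) => u v E.
  have Euv : u = v by nia.
  by subst v; split; lia.
case: (Z.eq_dec j k) => [->//|Hne]; apply: (IH _ E2); lia.
Qed.

Lemma horner_num_add n a b k :
  horner_num n (fun j => a j + b j) k = horner_num n a k + horner_num n b k.
Proof. by elim: n k => [|n IH] k //=; rewrite IH; lia. Qed.

Lemma horner_num_le n a b k : 0 <= S -> (forall j, a j <= b j) ->
  horner_num n a k <= horner_num n b k.
Proof.
move=> S0 H; elim: n k => [|n IH] k //=.
by have := H k; have := Z.mul_le_mono_nonneg_l _ _ _ S0 (IH (k + 1)); lia.
Qed.

Lemma horner_num_ge0 n a k : 0 <= S -> (forall j, 0 <= a j) -> 0 <= horner_num n a k.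
Proof.
move=> S0 H; elim: n k => [|n IH] k //=.
by have := H k; have := Z.mul_nonneg_nonneg _ _ S0 (IH (k + 1)); lia.
Qed.

(* The shift of the bricks of class [c] in state [i]: the classes occupy different
   digits in base [S], so that sums of few shifts determine their terms. *)
Definition shift (c i : Z) : Z := 3 * (2 * S * horner_num 8 (digit c i) 0 + c mod 2).

Definition max_shift (I : Z) : Z := 3 * (2 * S * horner_num 8 (fun=> I) 0 + 1).

Lemma shift_facts I c i : 0 <= S -> 0 <= i <= I ->
  [/\ 0 <= shift c i <= max_shift I, shift c i mod 3 = 0 & shift c i mod 2 = c mod 2].
Proof.
move=> S0 Hi.
have H1 : 0 <= horner_num 8 (digit c i) 0.
  by apply: horner_num_ge0 => // j; rewrite /digit; case: Z.eqb; lia.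
have H2 : horner_num 8 (digit c i) 0 <= horner_num 8 (fun=> I) 0.
  by apply: horner_num_le => // j; rewrite /digit; case: Z.eqb; lia.
rewrite /shift /max_shift; move: H1 H2; set u := horner_num _ _ _; set v := horner_num _ _ _ => H1 H2.
have Hs : 0 <= 2 * S * u <= 2 * S * v.
  by have := Z.mul_le_mono_nonneg_l _ _ _ S0 H2; have := Z.mul_nonneg_nonneg _ _ S0 H1; lia.
have -> : 2 * S * u = 2 * (S * u) by lia.
move: Hs; have -> : 2 * S * u = 2 * (S * u) by lia.
move: (S * u) (2 * S * v) => p q; split; lia.
Qed.

(** As [3 * I < S], adding three digits produces no carry. The parity terms of the two sides differ
    by at most 3, less than [2 * S], so they cannot disturb the comparison. *)
Lemma shift_digits I c1 c2 c3 d1 d2 d3 i1 i2 i3 j1 j2 j3 : 3 * I < S -> 2 <= S ->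
  shift c1 i1 + shift c2 i2 + shift c3 i3 = shift d1 j1 + shift d2 j2 + shift d3 j3 ->
  0 <= i1 <= I -> 0 <= i2 <= I -> 0 <= i3 <= I ->
  0 <= j1 <= I -> 0 <= j2 <= I -> 0 <= j3 <= I ->
  forall k, 0 <= k < 8 ->
  digit c1 i1 k + digit c2 i2 k + digit c3 i3 k =
  digit d1 j1 k + digit d2 j2 k + digit d3 j3 k.
Proof.
move=> SI S2 E Hi1 Hi2 Hi3 Hj1 Hj2 Hj3.
have Hd c i : 0 <= i <= I -> forall j, 0 <= digit c i j <= I.
  by move=> Hi j; rewrite /digit; case: Z.eqb; lia.
pose a k := digit c1 i1 k + digit c2 i2 k + digit c3 i3 k.
pose b k := digit d1 j1 k + digit d2 j2 k + digit d3 j3 k.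
have Ea : horner_num 8 a 0 = horner_num 8 b 0.
  rewrite /a /b !horner_num_add; move: E; rewrite /shift.
  set u1 := horner_num 8 (digit c1 _) 0; set u2 := horner_num 8 (digit c2 _) 0.
  set u3 := horner_num 8 (digit c3 _) 0; set v1 := horner_num 8 (digit d1 _) 0.
  set v2 := horner_num 8 (digit d2 _) 0; set v3 := horner_num 8 (digit d3 _) 0.
  move=> E.
  have E' : 2 * S * (u1 + u2 + u3 - (v1 + v2 + v3)) =
     d1 mod 2 + d2 mod 2 + d3 mod 2 - (c1 mod 2 + c2 mod 2 + c3 mod 2) by lia.
  move: (u1 + u2 + u3) (v1 + v2 + v3) E' => u v E'.
  have : - 3 <= 2 * S * (u - v) <= 3 by rewrite E'; lia.
  by nia.
move=> k Hk; apply: (horner_num_inj _ _ _ Ea); try lia.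
- by move=> j; rewrite /a; have := Hd c1 _ Hi1 j; have := Hd c2 _ Hi2 j; have := Hd c3 _ Hi3 j; lia.
- by move=> j; rewrite /b; have := Hd d1 _ Hj1 j; have := Hd d2 _ Hj2 j; have := Hd d3 _ Hj3 j; lia.
Qed.

End Digits.

(** * Every tiling is a running bond *)

Section Bricks.
Local Open Scope Z_scope.
Local Ltac Zify.zify_post_hook ::= Z.to_euclidean_division_equations.

Definition slot_x (s : Z) : Z :=
  40 * (s / 4) + (if s mod 4 =? 0 then 0 else if s mod 4 =? 1 then 8
                  else if s mod 4 =? 2 then 17 else 29).

Lemma slot_xS s : slot_x (s + 1) = slot_x s + wd s.
Proof. by rewrite /slot_x /wd; repeat case: Z.eqb_spec => ?; lia. Qed.

Lemma slot_exists x : exists s, slot_x s <= x < slot_x s + wd s.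
Proof.
have [H|[H|[H|H]]] : 0 <= x mod 40 < 8 \/ 8 <= x mod 40 < 17 \/ 17 <= x mod 40 < 29 \/
  29 <= x mod 40 < 40 by lia.
- by exists (4 * (x / 40)); rewrite /slot_x /wd; repeat case: Z.eqb_spec => ?; lia.
- by exists (4 * (x / 40) + 1); rewrite /slot_x /wd; repeat case: Z.eqb_spec => ?; lia.
- by exists (4 * (x / 40) + 2); rewrite /slot_x /wd; repeat case: Z.eqb_spec => ?; lia.
- by exists (4 * (x / 40) + 3); rewrite /slot_x /wd; repeat case: Z.eqb_spec => ?; lia.
Qed.

Lemma slot_uniq s s' x : slot_x s <= x < slot_x s + wd s ->
  slot_x s' <= x < slot_x s' + wd s' -> s = s'.
Proof. by rewrite /slot_x /wd; repeat case: Z.eqb_spec => ?; lia. Qed.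

(* The brick of row [r] over the slot [s]. *)
Definition brick_at (r s : Z) : Z := s - (s - r) mod 2.

(** One class for each of the eight kinds of bricks up to the period 4 in both directions.
    Consecutive bricks of a row have classes of opposite parity, so their tops are never level. *)
Definition brick_class (r s : Z) : Z := 2 * (r mod 4) + (s mod 4) / 2.

(** The region contains the space under row [r] in slot [s] when [act r s]. A brick outside the
    region has the state [vidx r s], and [rel r s i' i] admits a filler between a lower brick in
    state [i'] and an upper one in state [i]. *)
Variables (act : Z -> Z -> bool) (vidx : Z -> Z -> Z) (rel : Z -> Z -> Z -> Z -> Prop).
Variables (S I t G Lw e : Z).

Definition real (r s : Z) : bool :=
  [&& act r s, act r (s + 1), act (r + 1) s & act (r + 1) (s + 1)].

Definition valid r s i := 1 <= i <= I /\ (real r s = false -> i = vidx r s).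

Definition bot r s i := r * (t + G) - Lw + shift S (brick_class r s) i.
Definition top r s i := bot r s i + t.

(** The positions of the bricks are not known in advance, so the region is described for all valid
    states at once: bricks, and spaces between them, are entirely inside or entirely outside. *)
Record layout_ok (Om : Z -> Z -> Prop) : Prop := LayoutOk {
  layout_brick : forall r s i x y, valid r (brick_at r s) i ->
    slot_x s <= x < slot_x s + wd s ->
    bot r (brick_at r s) i <= y < top r (brick_at r s) i ->
    (Om x y <-> real r (brick_at r s));
  layout_zone : forall r s i' i x y,
    valid (r - 1) (brick_at (r - 1) s) i' -> valid r (brick_at r s) i ->
    slot_x s <= x < slot_x s + wd s ->
    top (r - 1) (brick_at (r - 1) s) i' <= y < bot r (brick_at r s) i ->
    (Om x y <-> act r s) }.

(** With [G] divisible by 6 the residues of a filler height come from the shifts alone. The bounds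
    make [e] negligible against [G], and [G] against [t]. *)
Record consts_ok : Prop := ConstsOk {
  const_S : 3 * I < S; const_S2 : 2 <= S; const_I : 1 <= I;
  const_e : e = max_shift S I; const_G : 100 * e <= G; const_G6 : G mod 6 = 0;
  const_t : 20 * G <= t; const_t6 : t mod 6 = 4;
  const_vidx : forall r s, 1 <= vidx r s <= I;
  const_rel : forall r s i' i, rel r s i' i -> 1 <= i' <= I /\ 1 <= i <= I;
  const_rel_mod : forall r s r' s' i' i, r mod 4 = r' mod 4 -> s mod 4 = s' mod 4 ->
    rel r s i' i -> rel r' s' i' i }.

Definition filler_height r s i' i :=
  G + shift S (brick_class r (brick_at r s)) i -
  shift S (brick_class (r - 1) (brick_at (r - 1) s)) i'.

Variables (Om : Z -> Z -> Prop) (Tl : Z -> Z -> Z -> Z -> Prop).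

Record tiling_ok : Prop := TilingOk {
  tiling_cover : forall x y, Om x y ->
    exists a b w h, Tl a b w h /\ in_tile a b w h x y;
  tiling_sub : forall a b w h x y, Tl a b w h -> in_tile a b w h x y -> Om x y;
  tiling_disj : forall a b w h a' b' w' h' x y, Tl a b w h -> Tl a' b' w' h' ->
    in_tile a b w h x y -> in_tile a' b' w' h' x y ->
    [/\ a = a', b = b', w = w' & h = h'];
  tiling_size : forall a b w h, Tl a b w h ->
    (h = t /\ exists s, w = wd s + wd (s + 1)) \/
    (exists r s i' i, [/\ w = wd s, h = filler_height r s i' i & rel r s i' i]) }.

Hypotheses (HC : consts_ok) (HO : layout_ok Om) (HT : tiling_ok).

Let S_I := const_S HC.
Let S_2 := const_S2 HC.
Let HI := const_I HC.
Let HG := const_G HC.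
Let Ht := const_t HC.

Lemma shift_ok c i : 1 <= i <= I ->
  [/\ 0 <= shift S c i <= e, shift S c i mod 3 = 0 & shift S c i mod 2 = c mod 2].
Proof. by move=> Hi; rewrite (const_e HC); apply: shift_facts; lia. Qed.

Lemma e_gt0 : 0 < e.
Proof.
rewrite (const_e HC) /max_shift.
have H : 0 <= horner_num S 8 (fun=> I) 0 by apply: horner_num_ge0 => *; lia.
by have := Z.mul_nonneg_nonneg S _ ltac:(lia) H; lia.
Qed.

Lemma class_mod2 r s : brick_class r s mod 2 = (s mod 4) / 2.
Proof. by rewrite /brick_class; lia. Qed.

Lemma class_bounds r s : 0 <= brick_class r s < 8.
Proof. by rewrite /brick_class; lia. Qed.

Lemma filler_height_len r s i' i : 1 <= i' <= I -> 1 <= i <= I ->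
  filler_len G e s (filler_height r s i' i).
Proof.
move=> /shift_ok H' /shift_ok H; rewrite /filler_height.
have [A1 A2] := H' (brick_class (r - 1) (brick_at (r - 1) s)).
have [B1 B2] := H (brick_class r (brick_at r s)).
rewrite !class_mod2 /brick_at => B3 A3; have G6 := const_G6 HC.
move: (shift _ _ _) (shift _ _ _) A1 A2 A3 B1 B2 B3 => u v A1 A2 A3 B1 B2 B3.
by split; lia.
Qed.

Lemma bot_top r s i' i :
  bot r (brick_at r s) i - top (r - 1) (brick_at (r - 1) s) i' = filler_height r s i' i.
Proof. by rewrite /filler_height /top /bot; lia. Qed.

Lemma brick_tiles_ok : tiles_ok Om Tl t G e.
Proof.
split; [exact: (tiling_cover HT) | exact: (tiling_sub HT) | exact: (tiling_disj HT) |].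
move=> a b w h /(tiling_size HT)[|[r [s [i' [i [-> -> Hrel]]]]]]; first by left.
by right; exists s; split=> //; apply: filler_height_len; have := const_rel HC Hrel; lia.
Qed.
Let TO := brick_tiles_ok.

Lemma brick_params_ok : params_ok t G e.
Proof. by split; [exact: e_gt0 | lia | lia | have := const_t6 HC; lia]. Qed.
Let PO := brick_params_ok.
Let e0 := e_gt0.

Lemma class_neq_row r s r' s' : r mod 4 <> r' mod 4 -> brick_class r s <> brick_class r' s'.
Proof. by rewrite /brick_class; lia. Qed.

(** This size is in the set on account of some related pair, a priori from another row and with
    other states; comparing digits identifies that pair with the given one. *)
Lemma tile_rel a b r s i' i : Tl a b (wd s) (filler_height r s i' i) ->
  1 <= i' <= I -> 1 <= i <= I -> rel r s i' i.
Proof.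
move=> /(tiling_size HT)[[_ [s' E]]|[r0 [s0 [j' [j [/wd_mod Es E Hrel]]]]]] Hi' Hi.
  by case: (wd_brick_wd E).
have [Hj' Hj] := const_rel HC Hrel.
have E3 : shift S (brick_class r (brick_at r s)) i +
     shift S (brick_class (r0 - 1) (brick_at (r0 - 1) s0)) j' + shift S 0 0 =
   shift S (brick_class r0 (brick_at r0 s0)) j +
     shift S (brick_class (r - 1) (brick_at (r - 1) s)) i' + shift S 0 0.
  by move: E; rewrite /filler_height; lia.
have D := shift_digits S_I S_2 E3 ltac:(lia) ltac:(lia) ltac:(lia) ltac:(lia)
  ltac:(lia) ltac:(lia).
have D1 := D _ (class_bounds r (brick_at r s)).
have D2 := D _ (class_bounds (r - 1) (brick_at (r - 1) s)).
have NAB := @class_neq_row r (brick_at r s) (r - 1) (brick_at (r - 1) s) ltac:(lia).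
(* In another row, the digit [i] of the upper class, at least 1, would have nothing to match it on
   the other side. *)
have Er : r0 mod 4 = r mod 4.
  apply: contrapT => Hne.
  have NA : brick_class r0 (brick_at r0 s0) <> brick_class r (brick_at r s) by apply: class_neq_row.
  move: D1; rewrite /digit Z.eqb_refl.
  clear - NA NAB Hi Hj Hi' Hj'; move: (brick_class _ _) (brick_class _ _) (brick_class _ _) (brick_class _ _) NA NAB => A B C D NA NAB.
  by repeat case: Z.eqb_spec => ?; lia.
have C1 : brick_class r0 (brick_at r0 s0) = brick_class r (brick_at r s).
  by clear - Er Es; rewrite /brick_class /brick_at; lia.
have C2 : brick_class (r0 - 1) (brick_at (r0 - 1) s0) = brick_class (r - 1) (brick_at (r - 1) s).
  by clear - Er Es; rewrite /brick_class /brick_at; lia.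
have [? ?] : i' = j' /\ i = j.
  move: D1 D2; rewrite C1 C2 /digit !Z.eqb_refl.
  by repeat case: Z.eqb_spec => ?; lia.
by subst; apply: (const_rel_mod HC _ _ Hrel); lia.
Qed.

(** Two adjacent fillers that end level must announce the same brick above them: the digits of the
    lower states cancel against those below, and the digits of the upper class give one common
    state. *)
Lemma tiles_rel a1 b1 a2 b2 r s i1 i2 d1 d2 : (s - r) mod 2 = 0 ->
  1 <= i1 <= I -> 1 <= i2 <= I ->
  Tl a1 b1 (wd s) d1 -> Tl a2 b2 (wd (s + 1)) d2 ->
  top (r - 1) (s - 1) i1 + d1 = top (r - 1) (s + 1) i2 + d2 ->
  exists i, [/\ rel r s i1 i, rel r (s + 1) i2 i, d1 = filler_height r s i1 i &
    d2 = filler_height r (s + 1) i2 i].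
Proof.
move=> Hrs Hi1 Hi2.
move=> /(tiling_size HT)[[_ [s' E]]|[r1 [s1 [j1' [j1 [/wd_mod Es1 E1 Hrel1]]]]]].
  by case: (wd_brick_wd E).
move=> /(tiling_size HT)[[_ [s' Ew]]|[r2 [s2 [j2' [j2 [/wd_mod Es2 E2 Hrel2]]]]]] E.
  by case: (wd_brick_wd Ew).
have [Hj1' Hj1] := const_rel HC Hrel1; have [Hj2' Hj2] := const_rel HC Hrel2.
have E3 : shift S (brick_class (r - 1) (s - 1)) i1 +
     shift S (brick_class r1 (brick_at r1 s1)) j1 +
     shift S (brick_class (r2 - 1) (brick_at (r2 - 1) s2)) j2' =
   shift S (brick_class (r - 1) (s + 1)) i2 +
     shift S (brick_class r2 (brick_at r2 s2)) j2 +
     shift S (brick_class (r1 - 1) (brick_at (r1 - 1) s1)) j1'.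
  by move: E; rewrite E1 E2 /filler_height /top /bot; lia.
have D := shift_digits S_I S_2 E3 ltac:(lia) ltac:(lia) ltac:(lia) ltac:(lia)
  ltac:(lia) ltac:(lia).
have D1 := D (brick_class (r - 1) (s - 1)) (class_bounds _ _).
have D2 := D (brick_class (r - 1) (s + 1)) (class_bounds _ _).
have D3 := D (brick_class r s) (class_bounds _ _).
have NE : brick_class (r - 1) (s - 1) <> brick_class (r - 1) (s + 1).
  by clear - Hrs; rewrite /brick_class; lia.
(* The digit of the lower left class is positive on one side and can be matched only by the lower
   state of the first filler, which fixes the row of that filler. The second filler is treated
   alike. *)
have Er1 : r1 mod 4 = r mod 4.
  apply: contrapT => Hne.
  have NA : brick_class (r1 - 1) (brick_at (r1 - 1) s1) <> brick_class (r - 1) (s - 1).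
    by apply: class_neq_row; clear - Hne; lia.
  have NB : brick_class r2 (brick_at r2 s2) <> brick_class (r - 1) (s - 1).
    by clear - Hrs Es2; rewrite /brick_class /brick_at; lia.
  move: D1; rewrite /digit Z.eqb_refl.
  clear - NA NB NE Hi1 Hj1 Hj2'; move: (brick_class _ _) (brick_class _ _) (brick_class _ _) (brick_class _ _) (brick_class _ _) (brick_class _ _) NA NB NE => A B C D E F NA NB NE.
  by repeat case: Z.eqb_spec => ?; lia.
have Er2 : r2 mod 4 = r mod 4.
  apply: contrapT => Hne.
  have NA : brick_class (r2 - 1) (brick_at (r2 - 1) s2) <> brick_class (r - 1) (s + 1).
    by apply: class_neq_row; clear - Hne; lia.
  have NB : brick_class r1 (brick_at r1 s1) <> brick_class (r - 1) (s + 1).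
    by clear - Hrs Es1; rewrite /brick_class /brick_at; lia.
  move: D2; rewrite /digit Z.eqb_refl.
  clear - NA NB NE Hi2 Hj2 Hj1'; move: (brick_class _ _) (brick_class _ _) (brick_class _ _) (brick_class _ _) (brick_class _ _) (brick_class _ _) NA NB NE => A B C D E F NA NB NE.
  by repeat case: Z.eqb_spec => ?; lia.
have C1 : brick_class r1 (brick_at r1 s1) = brick_class r s.
  by clear - Hrs Er1 Er2 Es1 Es2; rewrite /brick_class /brick_at; lia.
have C2 : brick_class r2 (brick_at r2 s2) = brick_class r s.
  by clear - Hrs Er1 Er2 Es1 Es2; rewrite /brick_class /brick_at; lia.
have C1' : brick_class (r1 - 1) (brick_at (r1 - 1) s1) = brick_class (r - 1) (s - 1).
  by clear - Hrs Er1 Er2 Es1 Es2; rewrite /brick_class /brick_at; lia.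
have C2' : brick_class (r2 - 1) (brick_at (r2 - 1) s2) = brick_class (r - 1) (s + 1).
  by clear - Hrs Er1 Er2 Es1 Es2; rewrite /brick_class /brick_at; lia.
have N1 : brick_class (r - 1) (s - 1) <> brick_class r s.
  by apply: class_neq_row; clear; lia.
have N2 : brick_class (r - 1) (s + 1) <> brick_class r s.
  by apply: class_neq_row; clear; lia.
have [? ? ?] : [/\ i1 = j1', i2 = j2' & j1 = j2].
  move: D1 D2 D3; rewrite C1 C2 C1' C2' /digit !Z.eqb_refl.
  move: (brick_class r s) (brick_class _ _) (brick_class _ _) NE N1 N2 => A B C NE N1 N2.
  clear - NE N1 N2.
  by repeat case: Z.eqb_spec => ?; split; lia.
have B1 : brick_at r s = s by clear - Hrs; rewrite /brick_at; lia.
have B2 : brick_at r (s + 1) = s by clear - Hrs; rewrite /brick_at; lia.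
have B3 : brick_at (r - 1) s = s - 1 by clear - Hrs; rewrite /brick_at; lia.
have B4 : brick_at (r - 1) (s + 1) = s + 1 by clear - Hrs; rewrite /brick_at; lia.
subst j1' j2' j2; exists j1; split.
- by apply: (const_rel_mod HC _ _ Hrel1); lia.
- by apply: (const_rel_mod HC _ _ Hrel2); lia.
- by rewrite E1 /filler_height C1 C1' B1 B3.
- by rewrite E2 /filler_height C2 C2' B2 B4.
Qed.

Lemma brick_atE r s b : (b - r) mod 2 = 0 -> b <= s <= b + 1 -> brick_at r s = b.
Proof. by clear; rewrite /brick_at; lia. Qed.

Lemma lay_brick r b s i x y : (b - r) mod 2 = 0 -> b <= s <= b + 1 -> valid r b i ->
  slot_x s <= x < slot_x s + wd s -> bot r b i <= y < top r b i -> (Om x y <-> real r b).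
Proof.
move=> Hb /(brick_atE Hb) E; rewrite -{1}E => V Hx Hy.
by rewrite -{1}E; apply: (layout_brick HO V Hx); rewrite E.
Qed.

Lemma lay_zone r b' b s i' i x y : (b' - (r - 1)) mod 2 = 0 -> b' <= s <= b' + 1 ->
  (b - r) mod 2 = 0 -> b <= s <= b + 1 -> valid (r - 1) b' i' -> valid r b i ->
  slot_x s <= x < slot_x s + wd s -> top (r - 1) b' i' <= y < bot r b i ->
  (Om x y <-> act r s).
Proof.
move=> Hb' /(brick_atE Hb') E' Hb /(brick_atE Hb) E; rewrite -{1}E' -{1}E => V' V Hx Hy.
by apply: (layout_zone HO V' V Hx); rewrite E E'.
Qed.

Lemma valid_vidx r s : valid r s (vidx r s).
Proof. by split=> //; exact: (const_vidx HC). Qed.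

Lemma bot_bounds r s i : 1 <= i <= I -> r * (t + G) - Lw <= bot r s i <= r * (t + G) - Lw + e.
Proof. by move=> /(shift_ok (brick_class r s))[H _ _]; rewrite /bot; lia. Qed.

Lemma top_odd r s i i' : 1 <= i <= I -> 1 <= i' <= I -> (top r s i - top r (s + 2) i') mod 2 = 1.
Proof.
move=> /(shift_ok (brick_class r s))[_ _]; rewrite class_mod2.
move=> H /(shift_ok (brick_class r (s + 2)))[_ _]; rewrite class_mod2.
by clear - H; rewrite /top /bot; lia.
Qed.

(* The brick [(r, s)] is in state [i]; a brick position outside the region has the
   state prescribed by the boundary. *)
Definition stated r s i := 1 <= i <= I /\
  (if real r s then Tl (slot_x s) (bot r s i) (wd s + wd (s + 1)) t else i = vidx r s).

Definition filled r s i' i :=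
  Tl (slot_x s) (top (r - 1) (brick_at (r - 1) s) i') (wd s) (filler_height r s i' i) /\
  rel r s i' i.

(** The induction hypothesis: the brick is in place, and so are the fillers under its two slots. *)
Definition proper r s := exists i, [/\ stated r s i,
  act r s -> exists i', stated (r - 1) (s - 1) i' /\ filled r s i' i &
  act r (s + 1) -> exists i', stated (r - 1) (s + 1) i' /\ filled r (s + 1) i' i].

Lemma stated_valid r s i : stated r s i -> valid r s i.
Proof. by case=> H1; rewrite /valid; case: real. Qed.

Lemma stated_uniq r s i i' : stated r s i -> stated r s i' -> i = i'.
Proof.
case=> Hi; rewrite /stated; case: real => [Ti|-> [_ ->] //] [Hi' Ti'].
have [_ Hh] := tile_pos TO PO Ti; have W := wd_brick_bounds s.
have B := bot_bounds r s Hi; have B' := bot_bounds r s Hi'.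
have I1 : in_tile (slot_x s) (bot r s i) (wd s + wd (s + 1)) t (slot_x s) (r * (t + G) - Lw + e).
  by rewrite /in_tile; lia.
have I2 : in_tile (slot_x s) (bot r s i') (wd s + wd (s + 1)) t (slot_x s) (r * (t + G) - Lw + e).
  by rewrite /in_tile; lia.
have [_ Eb _ _] := tiles_disj TO Ti Ti' I1 I2.
have E3 : shift S (brick_class r s) i + shift S 0 0 + shift S 0 0 =
          shift S (brick_class r s) i' + shift S 0 0 + shift S 0 0.
  by move: Eb; rewrite /bot; lia.
have := shift_digits S_I S_2 E3 ltac:(lia) ltac:(lia) ltac:(lia) ltac:(lia)
  ltac:(lia) ltac:(lia) (class_bounds r s).
by rewrite /digit Z.eqb_refl; case: Z.eqb_spec; lia.
Qed.

Lemma floor_bd r b s i x : stated r b i -> (b - r) mod 2 = 0 -> b <= s <= b + 1 ->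
  slot_x s <= x < slot_x s + wd s -> bd Tl x (top r b i).
Proof.
move=> Hst Hb Hs Hx; have V := stated_valid Hst; case: Hst => _.
case Er: (real r b) => HTl.
  apply: (bd_top TO PO HTl); have [?|?] : s = b \/ s = b + 1 by lia.
    by subst s; have := wd_bounds (b + 1); lia.
  by subst s; move: Hx; rewrite slot_xS; have := wd_bounds b; lia.
apply: (bd_out_below TO); rewrite (lay_brick Hb Hs V Hx) ?Er //.
by rewrite /top; lia.
Qed.

Lemma cross_low r s i1 i2 : (s - r) mod 2 = 0 -> stated (r - 1) (s - 1) i1 ->
  stated (r - 1) (s + 1) i2 -> top (r - 1) (s - 1) i1 < top (r - 1) (s + 1) i2 ->
  ncross Tl (slot_x (s + 1)) (top (r - 1) (s - 1) i1).
Proof.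
move=> Hrs S1 S2 Hlt; have [Hi1 _] := S1; have [Hi2 Hr] := S2.
have B1 := bot_bounds (r - 1) (s - 1) Hi1; have B2 := bot_bounds (r - 1) (s + 1) Hi2.
have W := wd_bounds (s + 1).
case Er: (real (r - 1) (s + 1)) Hr => Hr.
  by apply: (ncross_tile_left TO PO Hr); move: Hlt; rewrite /top; lia.
apply: (ncross_out TO).
have -> := @lay_brick (r - 1) (s + 1) (s + 1) i2 _ _ _ _ (stated_valid S2); rewrite ?Er //.
all: by move: Hlt; rewrite /top; lia.
Qed.

Lemma cross_low_right r s i1 i2 : (s - r) mod 2 = 0 -> stated (r - 1) (s - 1) i1 ->
  stated (r - 1) (s + 1) i2 -> top (r - 1) (s + 1) i2 < top (r - 1) (s - 1) i1 ->
  ncross Tl (slot_x (s + 1)) (top (r - 1) (s + 1) i2).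
Proof.
move=> Hrs S1 S2 Hlt; have [Hi1 Hr] := S1; have [Hi2 _] := S2.
have B1 := bot_bounds (r - 1) (s - 1) Hi1; have B2 := bot_bounds (r - 1) (s + 1) Hi2.
have W := wd_bounds s; have X := slot_xS s; have X' := slot_xS (s - 1).
rewrite (_ : s - 1 + 1 = s) in X' Hr; last by lia.
case Er: (real (r - 1) (s - 1)) Hr => Hr.
  have -> : slot_x (s + 1) = slot_x (s - 1) + (wd (s - 1) + wd s) by lia.
  by apply: (ncross_tile_right TO PO Hr); move: Hlt; rewrite /top; lia.
apply: (ncross_outl TO).
have -> := @lay_brick (r - 1) (s - 1) s i1 _ _ _ _ (stated_valid S1); rewrite ?Er //.
all: by move: Hlt; rewrite /top; lia.
Qed.

(** The floor makes a step between two bricks, of odd and hence nonzero height at most [e]. On the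
    low side the higher brick blocks; on the high side [ncross_gap] applies. *)
Lemma cross_floor r s i1 i2 : (s - r) mod 2 = 0 -> stated (r - 1) (s - 1) i1 ->
  stated (r - 1) (s + 1) i2 -> ncross Tl (slot_x (s + 1)) (top (r - 1) (s - 1) i1).
Proof.
move=> Hrs S1 S2; have [Hi1 _] := S1; have [Hi2 _] := S2.
have B1 := bot_bounds (r - 1) (s - 1) Hi1; have B2 := bot_bounds (r - 1) (s + 1) Hi2.
have [Hi0 _] := valid_vidx r s; have B0 := bot_bounds r s Hi0.
have W := wd_bounds (s + 1); have W' := wd_bounds s; have X := slot_xS s.
have := top_odd (r - 1) (s - 1) Hi1 Hi2; rewrite (_ : s - 1 + 2 = s + 1); last by lia.
move=> Hodd.
case: (Z_lt_le_dec (top (r - 1) (s - 1) i1) (top (r - 1) (s + 1) i2)) => Hlt.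
  exact: cross_low Hrs S1 S2 Hlt.
have Hz : forall y, top (r - 1) (s + 1) i2 <= y < bot r s (vidx r s) ->
    (Om (slot_x (s + 1)) y <-> act r (s + 1)).
  by move=> y; apply: lay_zone (stated_valid S2) (valid_vidx r s) _; lia.
apply: (ncross_gap TO PO (z := top (r - 1) (s + 1) i2)).
- by apply: (floor_bd (s := s) S1); lia.
- by apply: (floor_bd (s := s + 1) S2); lia.
- by clear - Hlt Hodd B1 B2 e0 HG; rewrite /top in Hlt Hodd *; lia.
- by rewrite !Hz //; clear - Hlt Hodd B0 B1 B2 e0 HG; rewrite /top in Hlt Hodd *; lia.
Qed.

(** The wall consists of the filler in slot [s - 1] and the brick on it, both known because the
    position on the left is proper. Outside the region the border does the same. *)
Lemma left_wall r s i1 : (s - r) mod 2 = 0 -> stated (r - 1) (s - 1) i1 -> proper r (s - 2) ->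
  forall y, top (r - 1) (s - 1) i1 <= y < top (r - 1) (s - 1) i1 + t -> ncross Tl (slot_x s) y.
Proof.
move=> Hrs S1 [i [Si _ HR]] y Hy; have [Hi1 _] := S1; have [Hi Hr] := Si.
have B1 := bot_bounds (r - 1) (s - 1) Hi1; have B := bot_bounds r (s - 2) Hi.
have W := wd_bounds (s - 1); have X := slot_xS (s - 1); have X' := slot_xS (s - 2).
have E1 : s - 1 + 1 = s by lia.
have E2 : s - 2 + 1 = s - 1 by lia.
rewrite E1 in X; rewrite E2 in X' HR Hr.
case: (Z_lt_le_dec y (bot r (s - 2) i)) => Hyb; last first.
  case Er: (real r (s - 2)) Hr => Hr.
    have -> : slot_x s = slot_x (s - 2) + (wd (s - 2) + wd (s - 1)) by lia.
    by apply: (ncross_tile_right TO PO Hr); move: Hy Hyb; rewrite /top; lia.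
  apply: (ncross_outl TO).
  have -> := @lay_brick r (s - 2) (s - 1) i _ _ _ _ (stated_valid Si); rewrite ?Er //;
    by move: Hy Hyb; rewrite /top; lia.
case Ea: (act r (s - 1)) HR => HR.
  have [i' [S' [HF _]]] := HR isT.
  have Ei := stated_uniq S1 S'; subst i'.
  rewrite (brick_atE (b := s - 1)) in HF; try lia.
  have -> : slot_x s = slot_x (s - 1) + wd (s - 1) by lia.
  apply: (ncross_tile_right TO PO HF).
  rewrite -bot_top (brick_atE (b := s - 2)) ?(brick_atE (b := s - 1)); lia.
apply: (ncross_outl TO).
have -> := @lay_zone r (s - 1) (s - 2) (s - 1) i1 i _ _ _ _ _ _ (stated_valid S1) (stated_valid Si).
all: rewrite ?Ea //; lia.
Qed.

Lemma right_side_ok r s i2 : (s - r) mod 2 = 0 -> stated (r - 1) (s + 1) i2 ->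
  (act r (s + 2) -> ncross Tl (slot_x (s + 3)) (top (r - 1) (s + 1) i2)) ->
  right_side Om Tl t G e (slot_x s) s (top (r - 1) (s + 1) i2).
Proof.
move=> Hrs S2 N3; have [Hi2 _] := S2.
have B2 := bot_bounds (r - 1) (s + 1) Hi2.
have V := valid_vidx r (s + 2); have [Hi0 _] := V; have B0 := bot_bounds r (s + 2) Hi0.
have W := wd_bounds (s + 2); have X := slot_xS s; have X1 := slot_xS (s + 1).
have X2 := slot_xS (s + 2).
have E1 : s + 1 + 1 = s + 2 by lia.
have E2 : s + 2 + 1 = s + 3 by lia.
rewrite E1 in X1; rewrite E2 in X2.
have V2 := stated_valid S2.
have Hz : forall x y, slot_x (s + 2) <= x < slot_x (s + 2) + wd (s + 2) ->
    top (r - 1) (s + 1) i2 <= y < bot r (s + 2) (vidx r (s + 2)) -> (Om x y <-> act r (s + 2)).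
  by move=> x y; apply: lay_zone V2 V; lia.
have Hb : forall x y, slot_x (s + 2) <= x < slot_x (s + 2) + wd (s + 2) ->
    bot r (s + 2) (vidx r (s + 2)) <= y < top r (s + 2) (vidx r (s + 2)) ->
    (Om x y <-> real r (s + 2)).
  by move=> x y; apply: lay_brick V; lia.
have Ebt : bot r (s + 2) (vidx r (s + 2)) - top (r - 1) (s + 1) i2 =
    filler_height r (s + 2) i2 (vidx r (s + 2)).
  by rewrite -bot_top (brick_atE (b := s + 2)) ?(brick_atE (b := s + 1)); lia.
have FL := filler_height_len r (s + 2) Hi2 Hi0; rewrite -Ebt in FL.
case: (FL) => _ FB _.
rewrite /right_side.
have -> : slot_x s + wd s + wd (s + 1) = slot_x (s + 2) by lia.
case Ea: (act r (s + 2)) N3 => N3; last first.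
  left=> y Hy; case: (Z_lt_le_dec y (bot r (s + 2) (vidx r (s + 2)))) => Hyb.
    by rewrite Hz ?Ea //; lia.
  by rewrite Hb /real ?Ea //; rewrite /top in FB Hy *; lia.
right; split.
- move=> x Hx; split; first by rewrite Hz ?Ea //; lia.
  by apply: (floor_bd (s := s + 2) S2) => //; lia.
- by rewrite -X2; apply: N3.
case Er: (real r (s + 2)).
  left=> x y Hx Hy; case: (Z_lt_le_dec y (bot r (s + 2) (vidx r (s + 2)))) => Hyb.
    by rewrite Hz ?Ea //; lia.
  by rewrite Hb ?Er //; rewrite /top in FB Hy *; lia.
right; exists (bot r (s + 2) (vidx r (s + 2))); split=> // x Hx; split=> y Hy.
  by rewrite Hz ?Ea //; lia.
by rewrite Hb ?Er.
Qed.

Definition has_defect r s := (s - r) mod 2 = 0 /\ real r s /\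
  exists i1, stated (r - 1) (s - 1) i1 /\
    defect Tl (slot_x s) s (top (r - 1) (s - 1) i1).

Lemma col_brick r s i1 x y : (s - r) mod 2 = 0 -> stated (r - 1) (s - 1) i1 -> real r s ->
  slot_x s <= x < slot_x s + wd s ->
  top (r - 1) (s - 1) i1 <= y < top (r - 1) (s - 1) i1 + t -> Om x y.
Proof.
move=> Hrs S1 Hr Hx Hy; have V := valid_vidx r s; have [Hi0 _] := V; have [Hi1 _] := S1.
have B1 := bot_bounds (r - 1) (s - 1) Hi1; have B0 := bot_bounds r s Hi0.
case: (Z_lt_le_dec y (bot r s (vidx r s))) => Hyb.
  apply/(@lay_zone r (s - 1) s s i1 (vidx r s)) => //; try lia; first exact: stated_valid.
  by case/and4P: Hr.
apply/(@lay_brick r s s (vidx r s)) => //; try lia.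
by rewrite /top in Hy *; lia.
Qed.

Lemma col_brick_right r s i2 x y : (s - r) mod 2 = 0 -> stated (r - 1) (s + 1) i2 -> real r s ->
  slot_x (s + 1) <= x < slot_x (s + 1) + wd (s + 1) ->
  top (r - 1) (s + 1) i2 <= y < top (r - 1) (s + 1) i2 + t -> Om x y.
Proof.
move=> Hrs S1 Hr Hx Hy; have V := valid_vidx r s; have [Hi0 _] := V; have [Hi1 _] := S1.
have B1 := bot_bounds (r - 1) (s + 1) Hi1; have B0 := bot_bounds r s Hi0.
case: (Z_lt_le_dec y (bot r s (vidx r s))) => Hyb.
  apply/(@lay_zone r (s + 1) s (s + 1) i2 (vidx r s)) => //; try lia; first exact: stated_valid.
  by case/and4P: Hr.
apply/(@lay_brick r s (s + 1) (vidx r s)) => //; try lia.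
by rewrite /top in Hy *; lia.
Qed.

Lemma real_step r s i1 i2 : (s - r) mod 2 = 0 -> real r s ->
  stated (r - 1) (s - 1) i1 -> stated (r - 1) (s + 1) i2 -> proper r (s - 2) ->
  (act r (s + 2) -> ncross Tl (slot_x (s + 3)) (top (r - 1) (s + 1) i2)) ->
  proper r s \/ has_defect r s.
Proof.
move=> Hrs Hr S1 S2 PL N3; have [Hi1 _] := S1; have [Hi2 _] := S2.
have B1 := bot_bounds (r - 1) (s - 1) Hi1; have B2 := bot_bounds (r - 1) (s + 1) Hi2.
have X := slot_xS s.
have Hodd := top_odd (r - 1) (s - 1) Hi1 Hi2.
rewrite (_ : s - 1 + 2 = s + 1) in Hodd; last by lia.
have BD : (exists d1 d2, [/\ top (r - 1) (s - 1) i1 + d1 = top (r - 1) (s + 1) i2 + d2,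
    Tl (slot_x s) (top (r - 1) (s - 1) i1) (wd s) d1,
    Tl (slot_x s + wd s) (top (r - 1) (s + 1) i2) (wd (s + 1)) d2 &
    Tl (slot_x s) (top (r - 1) (s - 1) i1 + d1) (wd s + wd (s + 1)) t]) \/
    defect Tl (slot_x s) s (top (r - 1) (s - 1) i1).
  apply: (brick_or_defect TO PO) => //.
  - by move=> x y; apply: col_brick.
  - by rewrite -X => x y; apply: col_brick_right.
  - by move=> x; apply: floor_bd S1 _ _; lia.
  - by rewrite -X => x; apply: floor_bd S2 _ _; lia.
  - exact: left_wall.
  - by rewrite /top; lia.
  - by rewrite -X => H; apply: cross_low H.
  - by rewrite -X => H; apply: cross_low_right H.
  - exact: right_side_ok.
case: BD => [[d1 [d2 [E T1 T2 TB]]]|D]; last by right; do 2!split=> //; exists i1.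
left; have [i [R1 R2 E1 E2]] := tiles_rel Hrs Hi1 Hi2 T1 T2 E.
have [_ Hi] := const_rel HC R1.
have A1 : brick_at r s = s by apply: brick_atE; lia.
have A2 : brick_at (r - 1) s = s - 1 by apply: brick_atE; lia.
have A3 : brick_at (r - 1) (s + 1) = s + 1 by apply: brick_atE; lia.
have Eb : top (r - 1) (s - 1) i1 + d1 = bot r s i.
  by have := bot_top r s i1 i; rewrite E1 A1 A2; lia.
exists i; split.
- by split=> //; rewrite Hr -Eb.
- by move=> _; exists i1; split=> //; split=> //; rewrite A2 -E1.
- by move=> _; exists i2; split=> //; split=> //; rewrite A3 -E2 X.
Qed.

(** A brick outside the region is a ceiling at a prescribed height, so the single filler below it is
    determined. *)
Lemma virtual_left r s i1 i2 : (s - r) mod 2 = 0 -> real r s = false -> act r s ->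
  stated (r - 1) (s - 1) i1 -> stated (r - 1) (s + 1) i2 -> proper r (s - 2) ->
  filled r s i1 (vidx r s).
Proof.
move=> Hrs Hr Ha S1 S2 PL; have [Hi1 _] := S1.
have V := valid_vidx r s; have [Hi0 _] := V; have V1 := stated_valid S1.
have X := slot_xS s; have W := wd_bounds s.
have A1 : brick_at r s = s by apply: brick_atE; lia.
have A2 : brick_at (r - 1) s = s - 1 by apply: brick_atE; lia.
have Ebt := bot_top r s i1 (vidx r s); rewrite A1 A2 in Ebt.
have [_ FB _] := filler_height_len r s Hi1 Hi0; rewrite -Ebt in FB.
have Hz : forall x y, slot_x s <= x < slot_x s + wd s ->
    top (r - 1) (s - 1) i1 <= y < bot r s (vidx r s) -> Om x y.
  by move=> x y Hx Hy; apply/(lay_zone _ _ _ _ V1 V Hx Hy) => //; lia.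
have [||||d [Td _]] := @left_first _ _ _ _ _ TO PO (slot_x s) s (top (r - 1) (s - 1) i1).
- by move=> x y Hx Hy; apply: Hz => //; lia.
- by move=> x; apply: floor_bd S1 _ _; lia.
- by apply: (left_wall Hrs S1 PL); lia.
- by rewrite -X; apply: cross_floor Hrs S1 S2.
have Ed : d = filler_height r s i1 (vidx r s).
  have HcD : ~ Om (slot_x s) (bot r s (vidx r s)).
    by rewrite (lay_brick _ _ V (s := s)) ?Hr //; rewrite /top; lia.
  have := pile_ceiling TO PO Td (c := bot r s (vidx r s)) (x := slot_x s) ltac:(lia) ltac:(lia)
    (fun y => Hz (slot_x s) y ltac:(lia)) HcD.
  by lia.
split; first by rewrite A2 -Ed.
by rewrite Ed in Td; apply: (tile_rel Td).
Qed.

(** As for the left slot, but slot [s + 2] may interfere: a brick would pierce the ceiling, and a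
    filler of slot [s + 2] would have the wrong parity. *)
Lemma virtual_right r s i1 i2 : (s - r) mod 2 = 0 -> real r s = false -> act r (s + 1) ->
  stated (r - 1) (s - 1) i1 -> stated (r - 1) (s + 1) i2 -> proper r (s - 2) ->
  (act r (s + 2) -> ncross Tl (slot_x (s + 3)) (top (r - 1) (s + 1) i2)) ->
  filled r (s + 1) i2 (vidx r s).
Proof.
move=> Hrs Hr Ha S1 S2 PL N3; have [Hi1 _] := S1; have [Hi2 _] := S2.
have B1 := bot_bounds (r - 1) (s - 1) Hi1; have B2 := bot_bounds (r - 1) (s + 1) Hi2.
have V := valid_vidx r s; have [Hi0 _] := V; have V2 := stated_valid S2.
have V1 := stated_valid S1; have B0 := bot_bounds r s Hi0.
have X := slot_xS s; have W := wd_bounds s; have W1 := wd_bounds (s + 1).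
have A1 : brick_at r (s + 1) = s by apply: brick_atE; lia.
have A2 : brick_at (r - 1) (s + 1) = s + 1 by apply: brick_atE; lia.
have Ebt := bot_top r (s + 1) i2 (vidx r s); rewrite A1 A2 in Ebt.
have FL := filler_height_len r (s + 1) Hi2 Hi0; rewrite -Ebt in FL.
have [_ FB FP] := FL.
have Hz : forall x y, slot_x (s + 1) <= x < slot_x (s + 1) + wd (s + 1) ->
    top (r - 1) (s + 1) i2 <= y < bot r s (vidx r s) -> Om x y.
  by move=> x y Hx Hy; apply/(lay_zone _ _ _ _ V2 V Hx Hy) => //; lia.
have Hc : forall x y, slot_x (s + 1) <= x < slot_x (s + 1) + wd (s + 1) ->
    bot r s (vidx r s) <= y < bot r s (vidx r s) + t -> ~ Om x y.
  by move=> x y Hx Hy; rewrite (lay_brick _ _ V Hx) ?Hr //; lia.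
have N1 : ncross Tl (slot_x (s + 1)) (top (r - 1) (s + 1) i2).
  case: (Z_lt_le_dec (top (r - 1) (s + 1) i2) (top (r - 1) (s - 1) i1)) => Hlt.
    exact: cross_low_right Hrs S1 S2 Hlt.
  case Ea: (act r s).
    have [HF _] := virtual_left Hrs Hr Ea S1 S2 PL.
    rewrite X; apply: (ncross_tile_right TO PO HF).
    have A3 : brick_at r s = s by apply: brick_atE; lia.
    have A4 : brick_at (r - 1) s = s - 1 by apply: brick_atE; lia.
    by rewrite -bot_top A3 A4; lia.
  apply: (ncross_outl TO).
  rewrite (@lay_zone r (s - 1) s s i1 (vidx r s)) ?Ea //; lia.
have RS := right_side_ok Hrs S2 N3.
have Hx1 : slot_x (s + 1) <= slot_x (s + 1) < slot_x (s + 1) + wd (s + 1) by lia.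
have HzD := fun y => Hz _ y Hx1.
have HcD := Hc _ (bot r s (vidx r s)) Hx1 ltac:(lia).
have RF : (exists w, Tl (slot_x s + wd s) (top (r - 1) (s + 1) i2) w t) \/
    (exists s' h, [/\ s' = s + 1 \/ (s' = s + 2),
      Tl (slot_x s + wd s) (top (r - 1) (s + 1) i2) (wd s') h & filler_len G e s' h]).
  have [||||[w Tb]|[s' [h [Es' Tg FG _]]]] := right_first TO PO _ _ _ _ RS; rewrite -?X //.
  - by move=> x y Hx Hy; apply: Hz => //; lia.
  - move=> x y Hx Hy Hxy; apply: Hz => //; split; first by lia.
    case: (Z_lt_le_dec (y - 1) (bot r s (vidx r s))) => // Hge.
    by case: (Hc x y) => //; lia.
  - by move=> x Hx; apply: (floor_bd (s := s + 1) S2); lia.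
  - by left; exists w; rewrite X.
  - by right; exists s', h; split; rewrite ?X //; case: Es' => [->|[-> _]]; [left | right].
rewrite -X in RF.
case: RF => [[w Tb]|[s' [h [Es' Tg [G1 G2 G3]]]]].
  case: (HcD); apply: (tiles_sub TO Tb); have := tile_pos TO PO Tb.
  by rewrite /in_tile; lia.
have Ws := wd_bounds s'.
have Eh := pile_ceiling TO PO Tg (c := bot r s (vidx r s)) (x := slot_x (s + 1)) ltac:(lia) ltac:(lia) HzD HcD.
have ? : s' = s + 1 by case: Es' => // ?; subst s'; lia.
subst s'; have {}Eh : h = filler_height r (s + 1) i2 (vidx r s) by lia.
split; first by rewrite A2 -Eh.
by rewrite Eh in Tg; apply: (tile_rel Tg).
Qed.

Lemma proper_or_defect r s i1 i2 : (s - r) mod 2 = 0 ->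
  stated (r - 1) (s - 1) i1 -> stated (r - 1) (s + 1) i2 -> proper r (s - 2) ->
  (act r (s + 2) -> ncross Tl (slot_x (s + 3)) (top (r - 1) (s + 1) i2)) ->
  proper r s \/ has_defect r s.
Proof.
move=> Hrs S1 S2 PL N3; case Hr: (real r s); first exact: (real_step Hrs Hr S1 S2 PL N3).
left; exists (vidx r s); split.
- by split; [exact: (const_vidx HC) | rewrite Hr].
- by move=> Ha; exists i1; split=> //; exact: (virtual_left Hrs Hr Ha S1 S2 PL).
- by move=> Ha; exists i2; split=> //; exact: (virtual_right Hrs Hr Ha S1 S2 PL N3).
Qed.

Lemma proper_inactive r s : act r s = false -> act r (s + 1) = false -> proper r s.
Proof.
move=> H1 H2; exists (vidx r s); rewrite H1 H2; split=> //.
by split; [exact: (const_vidx HC) | rewrite /real H1].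
Qed.

Lemma proper_stated r s : proper r s -> exists i, stated r s i.
Proof. by case=> i [H _ _]; exists i. Qed.

Definition left_proper r s := forall s', (s' - r) mod 2 = 0 -> s' < s -> proper r s'.

Variable bound : Z.
Hypothesis Hbound : forall r s, act r s -> - bound < r < bound /\ - bound < s < bound.

Lemma act_out r s : ~ (- bound < r < bound /\ - bound < s < bound) -> act r s = false.
Proof. by case E: (act r s) => // /(_ (Hbound E)). Qed.

(** The scan starts far to the left, where all positions are inactive and therefore proper. *)
Lemma leftmost_defect r s0 : (forall s, (s - r) mod 2 = 0 -> s < s0 -> left_proper r s ->
    proper r s \/ has_defect r s) ->
  left_proper r s0 \/ exists s, s < s0 /\ has_defect r s /\ left_proper r s.
Proof.
move=> Hstep.
have [m Hm] : exists m : nat, s0 <= - bound - 3 + Z.of_nat m.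
  by exists (Z.to_nat (s0 + bound + 3)); clear; lia.
elim: m s0 Hm Hstep => [|m IH] s0 Hm Hstep.
  left=> s _ Hs; apply: proper_inactive; apply: act_out; clear - Hm Hs; lia.
case: (IH (s0 - 1)).
- by clear - Hm; lia.
- by move=> s Hs Hlt; apply: Hstep => //; clear - Hlt; lia.
- move=> LP; case: (Z.eq_dec ((s0 - 1 - r) mod 2) 0) => Hpar; last first.
    left=> s Hs Hlt; apply: LP => //; case: (Z.eq_dec s (s0 - 1)) => [E|]; last by clear - Hlt; lia.
    by subst s; case: Hpar.
  case: (Hstep (s0 - 1) Hpar ltac:(clear; lia) LP) => [PP|DD].
    left=> s Hs Hlt; case: (Z.eq_dec s (s0 - 1)) => [->//|Hne].
    by apply: LP => //; clear - Hne Hlt; lia.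
  by right; exists (s0 - 1); split=> //; clear; lia.
- by case=> s [Hs H]; right; exists s; split=> //; clear - Hs; lia.
Qed.

Lemma proper_cross r s i2 : (s - r) mod 2 = 0 -> stated (r - 1) (s + 1) i2 ->
  proper (r - 1) (s + 3) -> ncross Tl (slot_x (s + 3)) (top (r - 1) (s + 1) i2).
Proof.
move=> Hrs S2 /proper_stated[i3 S3].
have := @cross_floor r (s + 2) i2 i3.
rewrite (_ : s + 2 - 1 = s + 1) 1?(_ : s + 2 + 1 = s + 3); try (clear; lia).
by apply=> //; clear - Hrs; lia.
Qed.

Lemma row_up r : (forall s, (s - (r - 1)) mod 2 = 0 -> proper (r - 1) s) ->
  (forall s, (s - r) mod 2 = 0 -> proper r s) \/ exists s, has_defect r s /\ left_proper r s.
Proof.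
move=> Hrow; have [|LP|[s [_ H]]] := @leftmost_defect r (bound + 1).
- move=> s Hs Hlt LP.
  have /proper_stated[i1 S1] := Hrow (s - 1) ltac:(clear - Hs; lia).
  have /proper_stated[i2 S2] := Hrow (s + 1) ltac:(clear - Hs; lia).
  apply: (proper_or_defect Hs S1 S2) => //; first by apply: LP; clear - Hs; lia.
  by move=> _; apply: (proper_cross Hs S2); apply: Hrow; clear - Hs; lia.
- left=> s Hs; case: (Z_lt_le_dec s (bound + 1)) => Hlt; first exact: LP.
  by apply: proper_inactive; apply: act_out; clear - Hlt; lia.
- by right; exists s.
Qed.

(** The defect leaves no tile boundary where the next row would need one. Hence the position
    [(r + 1, s - 1)] lies in the region and is defective too, unless a defect appears further to its
    left. *)
Lemma defect_up r s : has_defect r s -> left_proper r s ->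
  exists s', has_defect (r + 1) s' /\ left_proper (r + 1) s'.
Proof.
move=> [Hrs [Hr [i1 [S1 D]]]] LP; have [Hi1 _] := S1; have V1 := stated_valid S1.
have Ha : act (r + 1) s by case/and4P: Hr.
have E1 : r + 1 - 1 = r by clear; lia.
have X := slot_xS (s - 1); rewrite (_ : s - 1 + 1 = s) in X; last by clear; lia.
have Ws := wd_bounds s; have Wl := wd_bounds (s - 1).
have V := valid_vidx r s; have [Hi0 _] := V; have B0 := bot_bounds r s Hi0.
have V' := valid_vidx (r + 1) (s - 1); have [Hi' _] := V'.
have B' := bot_bounds (r + 1) (s - 1) Hi'.
have B1 := bot_bounds (r - 1) (s - 1) Hi1.
have Col : forall y, top (r - 1) (s - 1) i1 <= y < bot (r + 1) (s - 1) (vidx (r + 1) (s - 1)) ->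
    Om (slot_x s) y.
  move=> y Hy; case: (Z_lt_le_dec y (top r s (vidx r s))) => Hyt.
    case: (Z_lt_le_dec y (bot r s (vidx r s))) => Hyb.
      apply/(@lay_zone r (s - 1) s s i1 (vidx r s)) => //; try lia.
      by case/and4P: Hr.
    by apply/(@lay_brick r s s (vidx r s)) => //; lia.
  by apply/(@lay_zone (r + 1) s (s - 1) s (vidx r s) (vidx (r + 1) (s - 1))); rewrite ?E1 //; lia.
have [H1 H2 H3] := shift_ok (brick_class (r - 1) (s - 1)) Hi1.
have G6 := const_G6 HC.
case Er: (real (r + 1) (s - 1)); last first.
  have [H1' H2' H3'] := shift_ok (brick_class (r + 1) (s - 1)) Hi'.
  (* If [(r + 1, s - 1)] were outside, its bottom would be a boundary above the defect with [U]
     about [2 * G], below three fillers; [defect_no_bd] excludes it. *)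
  pose U := 2 * G + shift S (brick_class (r + 1) (s - 1)) (vidx (r + 1) (s - 1)) -
    shift S (brick_class (r - 1) (s - 1)) i1.
  have EU : top (r - 1) (s - 1) i1 + t + U = bot (r + 1) (s - 1) (vidx (r + 1) (s - 1)).
    by rewrite /U /top /bot; lia.
  exfalso; apply: (defect_no_bd TO PO D (U := U)).
  - by rewrite /U; clear - H2 H2' G6; lia.
  - by left; rewrite /U; clear - H1 H1' HG e0; lia.
  - by rewrite /U; clear - H1 H1' HG e0; lia.
  - by rewrite EU.
  - rewrite EU; apply: (bd_out TO).
    by rewrite (@lay_brick (r + 1) (s - 1) s (vidx (r + 1) (s - 1))) ?Er //; rewrite ?/top; lia.
have /proper_stated[i2 S2] := LP (s - 2) ltac:(clear - Hrs; lia) ltac:(clear; lia).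
have [Hi2 _] := S2; have B2 := bot_bounds r (s - 2) Hi2.
have [H1' H2' H3'] := shift_ok (brick_class r (s - 2)) Hi2.
pose u := G + shift S (brick_class r (s - 2)) i2 - shift S (brick_class (r - 1) (s - 1)) i1.
have Eu : top (r - 1) (s - 1) i1 + t + u = top r (s - 2) i2.
  by rewrite /u /top /bot; lia.
have FU : filler_len G e (s - 1) u.
  rewrite class_mod2 in H3; rewrite class_mod2 in H3'.
  by rewrite /u; clear - H1 H2 H3 H1' H2' H3' G6; split; lia.
have Bd : forall x, slot_x (s - 1) <= x < slot_x (s - 1) + wd (s - 1) -> bd Tl x (top r (s - 2) i2).
  by move=> x Hx; apply: (floor_bd (s := s - 1) S2) => //; lia.
have Nx : ncross Tl (slot_x s) (top r (s - 2) i2).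
  rewrite -Eu; apply: (defect_ncross TO PO D FU); last by rewrite Eu; apply: Bd; lia.
  by rewrite Eu => y Hy; apply: Col; move: Hy; rewrite /top; lia.
have [|LP'|[s' [_ H]]] := @leftmost_defect (r + 1) (s - 1).
- move=> s' Hs' Hlt LP'.
  have /proper_stated[j1 T1] := LP (s' - 1) ltac:(clear - Hs'; lia) ltac:(clear - Hlt; lia).
  have /proper_stated[j2 T2] := LP (s' + 1) ltac:(clear - Hs'; lia) ltac:(clear - Hlt Hs' Hrs; lia).
  apply: (@proper_or_defect (r + 1) s' j1 j2); rewrite ?E1 //.
    by apply: LP'; clear - Hs'; lia.
  (* For the last position before the defect, the brick that should end the floor is the defective
     one; the wall [Nx] on its left replaces it. *)
  move=> _; case: (Z.eq_dec (s' + 3) s) => Es.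
    have E2 : s' + 1 = s - 2 by clear - Es; lia.
    by rewrite Es; move: T2; rewrite E2 => T2; rewrite (stated_uniq T2 S2).
  have := @proper_cross (r + 1) s' j2; rewrite !E1; apply=> //.
  by apply: LP; clear - Hs' Hlt Hrs Es; lia.
- exists (s - 1); split=> //; split; first by clear - Hrs; lia.
  split=> //; exists i2; rewrite E1 (_ : s - 1 - 1 = s - 2); last by clear; lia.
  split=> //; rewrite -Eu.
  have -> : slot_x (s - 1) = slot_x s - wd (s - 1) by lia.
  have E3 : slot_x s - wd (s - 1) = slot_x (s - 1) by lia.
  have CB : forall x y, slot_x (s - 1) <= x < slot_x (s - 1) + wd (s - 1) ->
      top r (s - 2) i2 <= y < top r (s - 2) i2 + t -> Om x y.
    have := @col_brick (r + 1) (s - 1) i2; rewrite E1 (_ : s - 1 - 1 = s - 2); last by clear; lia.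
    by move=> H x y; apply: H => //; clear - Hrs; lia.
  apply: (defect_step TO PO D FU); rewrite ?E3 ?Eu.
  + move=> y Hy; case: (Z_lt_le_dec y (bot (r + 1) (s - 1) (vidx (r + 1) (s - 1)))) => Hyb.
      by apply: Col; lia.
    apply/(@lay_brick (r + 1) (s - 1) s (vidx (r + 1) (s - 1))) => //; try lia.
    by rewrite /top in Hy *; lia.
  + by rewrite X.
  + by rewrite X.
  + have := @left_wall (r + 1) (s - 1) i2; rewrite E1 (_ : s - 1 - 1 = s - 2); last by clear; lia.
    by apply=> //; [clear - Hrs; lia | apply: LP'; clear - Hrs; lia].
- by exists s'.
Qed.

(** A defect would climb one row at a time, whereas its position must be [real] and rows of the
    region are bounded. *)
Lemma no_defect r s : has_defect r s -> ~ left_proper r s.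
Proof.
have [m Hm] : exists m : nat, bound <= r + Z.of_nat m.
  by exists (Z.to_nat (bound - r)); clear; lia.
elim: m r s Hm => [|m IH] r s Hm D LP.
  have /and4P[/Hbound Hb _ _ _] := D.2.1.
  by clear - Hb Hm; lia.
have [s' [D' LP']] := defect_up D LP.
by apply: (IH (r + 1) s' _ D' LP'); clear - Hm; lia.
Qed.

Theorem all_proper r s : (s - r) mod 2 = 0 -> proper r s.
Proof.
have [m Hm] : exists m : nat, r <= - bound + Z.of_nat m.
  by exists (Z.to_nat (r + bound)); clear; lia.
elim: m r s Hm => [|m IH] r s Hm.
  by move=> _; apply: proper_inactive; apply: act_out; clear - Hm; lia.
move: s; case: (row_up (r := r)) => [s Hs|//|[s [D LP]]]; last by case: (no_defect D LP).
by apply: IH => //; clear - Hm; lia.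
Qed.

End Bricks.

(** * Tilings correspond to assignments of states *)

Section Standard.
Local Open Scope Z_scope.
Local Ltac Zify.zify_post_hook ::= Z.to_euclidean_division_equations.

Variables (act : Z -> Z -> bool) (vidx : Z -> Z -> Z) (rel : Z -> Z -> Z -> Z -> Prop).
Variables (S I t G Lw e : Z) (Om : Z -> Z -> Prop).
Hypothesis HC : consts_ok vidx rel S I t G e.
Hypothesis HO : layout_ok act vidx S I t G Lw Om.

Section State.
Variable st : Z -> Z -> Z.

Definition low r s := bot S t G Lw r (brick_at r s) (st r (brick_at r s)).

Definition standard (a b w h : Z) : Prop :=
  (exists r s, [/\ (s - r) mod 2 = 0, real act r s &
     [/\ a = slot_x s, b = low r s, w = wd s + wd (s + 1) & h = t]]) \/
  (exists r s, act r s /\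
     [/\ a = slot_x s, b = low (r - 1) s + t, w = wd s & h = low r s - low (r - 1) s - t]).

Definition state_ok :=
  (forall r s, (s - r) mod 2 = 0 -> valid act vidx I r s (st r s)) /\
  (forall r s, act r s -> rel r s (st (r - 1) (brick_at (r - 1) s)) (st r (brick_at r s))).

Hypothesis Hst : state_ok.

Lemma brick_at_par r s : (brick_at r s - r) mod 2 = 0.
Proof. by rewrite /brick_at; lia. Qed.

Lemma brick_at_id r s : (s - r) mod 2 = 0 -> brick_at r s = s.
Proof. by rewrite /brick_at; lia. Qed.

Lemma brick_atS r s : (s - r) mod 2 = 0 -> brick_at r (s + 1) = s.
Proof. by rewrite /brick_at; lia. Qed.

Lemma low_bounds r s : r * (t + G) - Lw <= low r s <= r * (t + G) - Lw + e.
Proof.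
have [Hi _] := Hst.1 r (brick_at r s) (brick_at_par r s).
by rewrite /low /bot; have [H _ _] := shift_ok HC (brick_class r (brick_at r s)) Hi; lia.
Qed.

Lemma row_lt r r' : r < r' -> r * (t + G) + (t + G) <= r' * (t + G).
Proof.
move=> H; have e0 := e_gt0 HC; have HG := const_G HC; have Ht := const_t HC.
have -> : r * (t + G) + (t + G) = (r + 1) * (t + G) by lia.
by apply: Z.mul_le_mono_nonneg_r; lia.
Qed.

Lemma column_cases s y : exists r,
  low r s <= y < low r s + t \/ low (r - 1) s + t <= y < low r s.
Proof.
have e0 := e_gt0 HC; have HG := const_G HC; have Ht := const_t HC.
pose r := (y + Lw) / (t + G).
have Hr : r * (t + G) <= y + Lw < r * (t + G) + (t + G).
  have := Z.div_mod (y + Lw) (t + G) ltac:(lia).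
  have := Z.mod_pos_bound (y + Lw) (t + G) ltac:(lia).
  by rewrite -/r; lia.
have B := low_bounds r s; have B1 := low_bounds (r - 1) s; have B2 := low_bounds (r + 1) s.
case: (Z_lt_le_dec y (low r s)) => H1; first by exists r; right; lia.
case: (Z_lt_le_dec y (low r s + t)) => H2; first by exists r; left; lia.
by exists (r + 1); right; rewrite (_ : r + 1 - 1 = r); lia.
Qed.

Lemma brick_row_uniq r r' s y : low r s <= y < low r s + t -> low r' s <= y < low r' s + t -> r = r'.
Proof.
have e0 := e_gt0 HC; have HG := const_G HC; have Ht := const_t HC.
have B := low_bounds r s; have B' := low_bounds r' s.
case: (Z.lt_trichotomy r r') => [/row_lt H|[//|/row_lt H]]; lia.
Qed.

Lemma zone_row_uniq r r' s y : low (r - 1) s + t <= y < low r s ->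
  low (r' - 1) s + t <= y < low r' s -> r = r'.
Proof.
have e0 := e_gt0 HC; have HG := const_G HC; have Ht := const_t HC.
have B := low_bounds r s; have B' := low_bounds r' s.
have C := low_bounds (r - 1) s; have C' := low_bounds (r' - 1) s.
case: (Z.lt_trichotomy r r') => [/row_lt H|[//|/row_lt H]]; lia.
Qed.

Lemma brick_zone_disj r r' s y : low r s <= y < low r s + t ->
  low (r' - 1) s + t <= y < low r' s -> False.
Proof.
have e0 := e_gt0 HC; have HG := const_G HC; have Ht := const_t HC.
have B := low_bounds r s; have B' := low_bounds r' s; have C' := low_bounds (r' - 1) s.
case: (Z.lt_trichotomy r r') => [H|[->|/row_lt H]]; [|lia|lia].
case: (Z.eq_dec r (r' - 1)) => [->|Hn]; first by lia.
by have := @row_lt r (r' - 1) ltac:(lia); lia.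
Qed.

Lemma standard_band a b w h x y : standard a b w h -> in_tile a b w h x y ->
  exists s r, slot_x s <= x < slot_x s + wd s /\
    ((low r s <= y < low r s + t /\ real act r (brick_at r s) /\
       [/\ a = slot_x (brick_at r s), b = low r s,
           w = wd (brick_at r s) + wd (brick_at r s + 1) & h = t]) \/
     (low (r - 1) s + t <= y < low r s /\ act r s /\
       [/\ a = slot_x s, b = low (r - 1) s + t, w = wd s & h = low r s - low (r - 1) s - t])).
Proof.
move=> [[r [s [Hrs Hr [-> -> -> ->]]]]|[r [s [Ha [-> -> -> ->]]]]] [Hx Hy]; last first.
  by exists s, r; split=> //; right; split; [lia|].
have X := slot_xS s.
case: (Z_lt_le_dec x (slot_x (s + 1))) => Hx1.
  by exists s, r; split; [lia | left; rewrite !(brick_at_id Hrs)].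
exists (s + 1), r; split; first by lia.
by left; rewrite !(brick_atS Hrs) /low !(brick_atS Hrs); move: Hy; rewrite /low (brick_at_id Hrs).
Qed.

(** Over one slot, the bottoms [low] cut the vertical line into alternating bricks and spaces; the
    layout tells which of them belong to the region. *)
Lemma standard_tiling : tiling_ok rel S t G Om standard.
Proof.
have e0 := e_gt0 HC; have HG := const_G HC; have Ht := const_t HC.
split.
- move=> x y; have [s Hx] := slot_exists x; have [r Hr] := column_cases s y.
  case: Hr => Hy.
    have V := Hst.1 r _ (brick_at_par r s).
    move/(layout_brick HO V Hx) => Hreal.
    have {}Hreal := Hreal Hy.
    exists (slot_x (brick_at r s)), (low r s), (wd (brick_at r s) + wd (brick_at r s + 1)), t.
    split.
      left; exists r, (brick_at r s); split=> //; first exact: brick_at_par.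
      by split=> //; rewrite /low (@brick_at_id r (brick_at r s)) //; exact: brick_at_par.
    split=> //; have [E|E] : brick_at r s = s \/ brick_at r s = s - 1 by rewrite /brick_at; lia.
      by rewrite E; have := wd_bounds (s + 1); lia.
    by rewrite E; have := slot_xS (s - 1); have := wd_bounds (s - 1); rewrite (_ : s - 1 + 1 = s); lia.
  have V := Hst.1 r _ (brick_at_par r s); have V' := Hst.1 (r - 1) _ (brick_at_par (r - 1) s).
  move/(layout_zone HO V' V Hx) => Hact.
  have {}Hact := Hact Hy.
  exists (slot_x s), (low (r - 1) s + t), (wd s), (low r s - low (r - 1) s - t).
  by split; [right; exists r, s | rewrite /in_tile; lia].
- move=> a b w h x y Ht1 Hin; have [s [r [Hx [[Hy [Hr _]]|[Hy [Ha _]]]]]] := standard_band Ht1 Hin.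
    by apply/(layout_brick HO (Hst.1 r _ (brick_at_par r s)) Hx).
  by apply/(layout_zone HO (Hst.1 _ _ (brick_at_par (r - 1) s)) (Hst.1 r _ (brick_at_par r s)) Hx).
- move=> a b w h a' b' w' h' x y T1 T2 I1 I2.
  have [s [r [Hx H]]] := standard_band T1 I1; have [s' [r' [Hx' H']]] := standard_band T2 I2.
  have Es := slot_uniq Hx Hx'; subst s'.
  case: H => [[Hy [_ [-> -> -> ->]]]|[Hy [_ [-> -> -> ->]]]];
  case: H' => [[Hy' [_ [-> -> -> ->]]]|[Hy' [_ [-> -> -> ->]]]].
  + by rewrite (brick_row_uniq Hy Hy').
  + by case: (brick_zone_disj Hy Hy').
  + by case: (brick_zone_disj Hy' Hy).
  + by rewrite (zone_row_uniq Hy Hy').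
- move=> a b w h [[r [s [_ _ [_ _ -> ->]]]]|[r [s [Ha [_ _ -> ->]]]]]; first by left; split=> //; exists s.
  right; exists r, s, (st (r - 1) (brick_at (r - 1) s)), (st r (brick_at r s)).
  split=> //; last exact: Hst.2.
  by rewrite /low -(bot_top S t G Lw) /top; lia.
Qed.

End State.

Lemma standard_state_inj st st' r s : state_ok st -> state_ok st' ->
  (forall a b w h, standard st a b w h -> standard st' a b w h) ->
  (s - r) mod 2 = 0 -> real act r s -> st r s = st' r s.
Proof.
move=> H H' Hsub Hrs Hr; have HT := standard_tiling H'.
have St : forall st1, state_ok st1 -> (forall a b w h, standard st1 a b w h -> standard st' a b w h) ->
    stated act vidx S I t G Lw (standard st') r s (st1 r s).
  move=> st1 H1 Hs1; split; first by have [] := H1.1 r s Hrs.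
  rewrite Hr; apply: Hs1; left; exists r, s; split=> //.
  by split=> //; rewrite /low (brick_at_id Hrs).
by apply: (stated_uniq HC HT (St _ H Hsub) (St _ H' (fun _ _ _ _ => id))).
Qed.

(** Every tile of [T2] shares a cell with a tile of [T1], which is also a tile of [T2], hence the
    same one. *)
Lemma tiling_sub_eq (T1 T2 : Z -> Z -> Z -> Z -> Prop) :
  tiling_ok rel S t G Om T1 -> tiling_ok rel S t G Om T2 ->
  (forall a b w h, T1 a b w h -> T2 a b w h) -> forall a b w h, T2 a b w h -> T1 a b w h.
Proof.
move=> O1 O2 Hsub a b w h H2.
have [Hw Hh] := tile_pos (brick_tiles_ok HC O2) (brick_params_ok HC) H2.
have e0 := e_gt0 HC; have HG := const_G HC.
have Hin : in_tile a b w h a b by rewrite /in_tile; lia.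
have /(tiling_cover O1)[a' [b' [w' [h' [H1 Hin']]]]] := tiling_sub O2 H2 Hin.
by have [-> -> -> ->] := tiling_disj O2 H2 (Hsub _ _ _ _ H1) Hin Hin'.
Qed.

(** Each position has a state by [all_proper]. The states quoted by neighboring positions agree by
    [stated_uniq], so they form one assignment. *)
Lemma tiling_standard (bound : Z) (Tl : Z -> Z -> Z -> Z -> Prop) :
  (forall r s, act r s -> - bound < r < bound /\ - bound < s < bound) ->
  tiling_ok rel S t G Om Tl ->
  exists st, state_ok st /\ forall a b w h, Tl a b w h <-> standard st a b w h.
Proof.
move=> Hb HT.
have P := all_proper HC HO HT Hb.
have Hex : forall rs : Z * Z, exists i, (rs.2 - rs.1) mod 2 = 0 ->
    stated act vidx S I t G Lw Tl rs.1 rs.2 i.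
  move=> [r s] /=; case: (pselect ((s - r) mod 2 = 0)) => Hrs; last by exists 0.
  by have [i [Hi _ _]] := P r s Hrs; exists i.
have [f Hf] := choice Hex.
pose st r s := f (r, s).
have Hst : forall r s, (s - r) mod 2 = 0 -> stated act vidx S I t G Lw Tl r s (st r s).
  by move=> r s; apply: (Hf (r, s)).
have HF : forall r s, act r s -> filled rel S t G Lw Tl r s (st (r - 1) (brick_at (r - 1) s))
    (st r (brick_at r s)).
  move=> r s Ha; case: (Z.eq_dec ((s - r) mod 2) 0) => Hrs.
    have [i [Si HL _]] := P r s Hrs; have [i' [Si' Fi]] := HL Ha.
    have -> : brick_at (r - 1) s = s - 1 by rewrite /brick_at; lia.
    have E1 := stated_uniq HC HT Si' (Hst (r - 1) (s - 1) ltac:(lia)).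
    have E2 := stated_uniq HC HT Si (Hst r s Hrs).
    by rewrite (brick_at_id Hrs) -E1 -E2.
  have Hrs1 : (s - 1 - r) mod 2 = 0 by lia.
  have [i [Si _]] := P r (s - 1) Hrs1; rewrite (_ : s - 1 + 1 = s); last by lia.
  move=> HR; have [i' [Si' Fi]] := HR Ha.
  have -> : brick_at r s = s - 1 by rewrite /brick_at; lia.
  have -> : brick_at (r - 1) s = s by rewrite /brick_at; lia.
  have E1 := stated_uniq HC HT Si' (Hst (r - 1) s ltac:(lia)).
  have E2 := stated_uniq HC HT Si (Hst r (s - 1) Hrs1).
  by rewrite -E1 -E2.
have SO : state_ok st.
  split; first by move=> r s /Hst/stated_valid.
  by move=> r s /HF[].
have Hsub : forall a b w h, standard st a b w h -> Tl a b w h.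
  move=> a b w h [[r [s [Hrs Hr [-> -> -> ->]]]]|[r [s [Ha [-> -> -> ->]]]]].
    by have [_] := Hst r s Hrs; rewrite Hr /low (brick_at_id Hrs).
  have [HTl _] := HF r s Ha; move: HTl; rewrite -(bot_top S t G Lw) /low /top.
  by congr Tl; lia.
exists st; split=> // a b w h; split; last exact: Hsub.
exact: (tiling_sub_eq (standard_tiling SO) HT Hsub).
Qed.

End Standard.

(** * Wang tiles encoded as states of bricks *)

Section Zones.
Local Open Scope Z_scope.
Local Ltac Zify.zify_post_hook ::= Z.to_euclidean_division_equations.
Variable g : Z -> Z -> bool.

(** The spaces under the rows [4 q + 1] to [4 q + 4] belong to cells of height [q], whence the
    [r - 1]. Bricks of row [4 q] lie across horizontal edges, those over the slots [4 x + 3] and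
    [4 x + 4] across vertical ones. *)
Definition zone_act r s := g (s / 4) ((r - 1) / 4).

Lemma zone_actE x q k j : 0 <= k < 4 -> 1 <= j <= 4 -> zone_act (4 * q + j) (4 * x + k) = g x q.
Proof. by move=> Hk Hj; rewrite /zone_act; congr g; lia. Qed.

Lemma mod4E x k : 0 <= k < 4 -> (4 * x + k) mod 4 = k.
Proof. by lia. Qed.

Lemma div4E x k : 0 <= k < 4 -> (4 * x + k) / 4 = x.
Proof. by lia. Qed.

Lemma real_Y q x k : k = 0 \/ k = 2 -> real zone_act (4 * q) (4 * x + k) = g x (q - 1) && g x q.
Proof.
move=> Hk; rewrite /real.
have -> : 4 * q = 4 * (q - 1) + 4 by lia.
rewrite zone_actE; try lia.
rewrite -Z.add_assoc zone_actE; try lia.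
have -> : 4 * (q - 1) + 4 + 1 = 4 * q + 1 by lia.
rewrite !zone_actE; try lia.
by case: g; case: g.
Qed.

Lemma real_in q x j k : j = 1 \/ j = 2 \/ j = 3 -> 0 <= k < 3 -> real zone_act (4 * q + j) (4 * x + k) = g x q.
Proof.
move=> Hj Hk; rewrite /real -!(Z.add_assoc _ _ 1) !zone_actE; try lia.
by case: g.
Qed.

Lemma real_X q x j : j = 1 \/ j = 3 -> real zone_act (4 * q + j) (4 * x + 3) = g x q && g (x + 1) q.
Proof.
move=> Hj; rewrite /real (_ : 4 * x + 3 + 1 = 4 * (x + 1) + 0); last by lia.
rewrite -!(Z.add_assoc _ _ 1) !zone_actE; try lia.
by case: g; case: g.
Qed.

Variables (hb vb : Z -> Z -> Z).

(** Two kinds of bricks carry colors: [(4 q, 4 x + 2)] that of the lower edge of the cell [(x, q)],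
    and [(4 q + 1, 4 x + 3)] that of its right edge. The other border bricks are neutral, in state
    1. *)
Definition boundary_idx r s :=
  if (r mod 4 =? 0) && (2 <=? s mod 4) then hb (s / 4) (r / 4)
  else if (r mod 4 =? 1) && (s mod 4 =? 3) then vb (s / 4) (r / 4) else 1.

End Zones.

Section WangStates.
Local Open Scope Z_scope.
Local Ltac Zify.zify_post_hook ::= Z.to_euclidean_division_equations.

Variables (nW nN nE : Z) (fE fN fW fS : Z -> Z).

Definition in_range n i := 1 <= i <= n.

(** Read upwards: the inner brick of row 1 picks a tile that fits the color below; row 2 repeats the
    tile on both halves and checks it against the west and east colors; row 3 keeps only the north
    color, which row 4 hands to the edge above. *)
Definition wang_rel (r s i' i : Z) : Prop :=
  if r mod 4 =? 1 then
    if s mod 4 =? 0 then i' = 1 /\ in_range nE i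
    else if s mod 4 =? 1 then i' = 1 /\ in_range nW i
    else if s mod 4 =? 2 then [/\ in_range nN i', in_range nW i & fS i = i']
    else in_range nN i' /\ in_range nE i
  else if r mod 4 =? 2 then
    if s mod 4 =? 0 then [/\ in_range nE i', in_range nW i & fW i = i']
    else if s mod 4 =? 3 then [/\ in_range nE i', in_range nW i & fE i = i']
    else i' = i /\ in_range nW i
  else if r mod 4 =? 3 then
    if s mod 4 =? 0 then in_range nW i' /\ i = 1
    else if s mod 4 =? 3 then in_range nW i' /\ i = 1
    else [/\ in_range nW i', in_range nN i & fN i' = i]
  else if s mod 4 =? 0 then i' = 1 /\ i = 1
    else if s mod 4 =? 1 then in_range nN i' /\ i = 1
    else if s mod 4 =? 2 then i' = i /\ in_range nN i
    else i' = 1 /\ in_range nN i.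

Lemma wang_rel_mod r s r' s' i' i : r mod 4 = r' mod 4 -> s mod 4 = s' mod 4 ->
  wang_rel r s i' i -> wang_rel r' s' i' i.
Proof. by rewrite /wang_rel => -> ->. Qed.

Lemma wang_rel_range I r s i' i : 1 <= I -> nW <= I -> nN <= I -> nE <= I ->
  wang_rel r s i' i -> 1 <= i' <= I /\ 1 <= i <= I.
Proof.
rewrite /wang_rel /in_range => H1 H2 H3 H4.
by do ![case: ifP => _]; case; lia.
Qed.

Variables (g : Z -> Z -> bool) (hb vb : Z -> Z -> Z).

Notation zact := (zone_act g).
Notation bidx := (boundary_idx hb vb).

Hypotheses (HfN : forall i, in_range nW i -> in_range nN (fN i))
  (HfE : forall i, in_range nW i -> in_range nE (fE i))
  (Hhb : forall x q, in_range nN (hb x q)) (Hvb : forall x q, in_range nE (vb x q)).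
Variable I : Z.
Hypotheses (I1 : 1 <= I) (IW : nW <= I) (IN : nN <= I) (IE : nE <= I).

Lemma boundary_idx_range r s : 1 <= bidx r s <= I.
Proof.
rewrite /boundary_idx; case: ifP => _; first by have := Hhb (s / 4) (r / 4); rewrite /in_range; lia.
by case: ifP => _; [have := Hvb (s / 4) (r / 4); rewrite /in_range; lia | lia].
Qed.

Definition wang_ok (tau : Z -> Z -> Z) : Prop := forall x q, g x q ->
  [/\ in_range nW (tau x q),
      fE (tau x q) = (if g (x + 1) q then fW (tau (x + 1) q) else vb x q),
      fN (tau x q) = (if g x (q + 1) then fS (tau x (q + 1)) else hb x (q + 1)),
      g (x - 1) q = false -> fW (tau x q) = vb (x - 1) q &
      g x (q - 1) = false -> fS (tau x q) = hb x q].

Definition wang_state (tau : Z -> Z -> Z) (r s : Z) : Z :=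
  if real zact r s then
    if r mod 4 =? 0 then if s mod 4 =? 0 then 1 else fN (tau (s / 4) (r / 4 - 1))
    else if r mod 4 =? 1 then
      if s mod 4 =? 1 then tau (s / 4) (r / 4) else fE (tau (s / 4) (r / 4))
    else if r mod 4 =? 2 then tau (s / 4) (r / 4)
    else if s mod 4 =? 1 then fN (tau (s / 4) (r / 4)) else 1
  else bidx r s.

Section Values.
Variables (tau : Z -> Z -> Z) (x q : Z).

Local Ltac eval_state := rewrite /wang_state /boundary_idx ?mod4E ?div4E //=; try lia.

Lemma state_Y0 : wang_state tau (4 * q) (4 * x) = 1.
Proof.
rewrite -(Z.add_0_r (4 * q)) -(Z.add_0_r (4 * x)); eval_state.
by case: real.
Qed.

Lemma state_Y1 : wang_state tau (4 * q) (4 * x + 2) =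
  if g x (q - 1) && g x q then fN (tau x (q - 1)) else hb x q.
Proof.
rewrite -(@real_Y g q x 2); last by right.
rewrite -(Z.add_0_r (4 * q)); eval_state.
Qed.

Lemma state_Xi : wang_state tau (4 * q + 1) (4 * x + 1) = if g x q then tau x q else 1.
Proof. by eval_state; rewrite real_in //; lia. Qed.

Lemma state_Xo : wang_state tau (4 * q + 1) (4 * x + 3) =
  if g x q && g (x + 1) q then fE (tau x q) else vb x q.
Proof. by eval_state; rewrite real_X //; left. Qed.

Lemma state_T0 : wang_state tau (4 * q + 2) (4 * x) = if g x q then tau x q else 1.
Proof. by rewrite -(Z.add_0_r (4 * x)); eval_state; rewrite real_in //; lia. Qed.

Lemma state_T1 : wang_state tau (4 * q + 2) (4 * x + 2) = if g x q then tau x q else 1.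
Proof. by eval_state; rewrite real_in //; lia. Qed.

Lemma state_X'i : wang_state tau (4 * q + 3) (4 * x + 1) = if g x q then fN (tau x q) else 1.
Proof. by eval_state; rewrite real_in //; lia. Qed.

Lemma state_X'o : wang_state tau (4 * q + 3) (4 * x + 3) = 1.
Proof. by eval_state; case: real. Qed.

End Values.

(* The relations imposed by the fillers in the block of a cell. *)
Definition block_rel (st : Z -> Z -> Z) (x q : Z) : Prop :=
  [/\ [/\ wang_rel 1 0 (st (4 * q) (4 * x)) (st (4 * q + 1) (4 * (x - 1) + 3)),
          wang_rel 1 1 (st (4 * q) (4 * x)) (st (4 * q + 1) (4 * x + 1)),
          wang_rel 1 2 (st (4 * q) (4 * x + 2)) (st (4 * q + 1) (4 * x + 1)) &
          wang_rel 1 3 (st (4 * q) (4 * x + 2)) (st (4 * q + 1) (4 * x + 3))],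
      [/\ wang_rel 2 0 (st (4 * q + 1) (4 * (x - 1) + 3)) (st (4 * q + 2) (4 * x)),
          wang_rel 2 1 (st (4 * q + 1) (4 * x + 1)) (st (4 * q + 2) (4 * x)),
          wang_rel 2 2 (st (4 * q + 1) (4 * x + 1)) (st (4 * q + 2) (4 * x + 2)) &
          wang_rel 2 3 (st (4 * q + 1) (4 * x + 3)) (st (4 * q + 2) (4 * x + 2))],
      [/\ wang_rel 3 0 (st (4 * q + 2) (4 * x)) (st (4 * q + 3) (4 * (x - 1) + 3)),
          wang_rel 3 1 (st (4 * q + 2) (4 * x)) (st (4 * q + 3) (4 * x + 1)),
          wang_rel 3 2 (st (4 * q + 2) (4 * x + 2)) (st (4 * q + 3) (4 * x + 1)) &
          wang_rel 3 3 (st (4 * q + 2) (4 * x + 2)) (st (4 * q + 3) (4 * x + 3))] &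
      [/\ wang_rel 0 0 (st (4 * q + 3) (4 * (x - 1) + 3)) (st (4 * (q + 1)) (4 * x)),
          wang_rel 0 1 (st (4 * q + 3) (4 * x + 1)) (st (4 * (q + 1)) (4 * x)),
          wang_rel 0 2 (st (4 * q + 3) (4 * x + 1)) (st (4 * (q + 1)) (4 * x + 2)) &
          wang_rel 0 3 (st (4 * q + 3) (4 * x + 3)) (st (4 * (q + 1)) (4 * x + 2))]].

Lemma rel_block (st : Z -> Z -> Z) :
  (forall r s, zact r s ->
     wang_rel r s (st (r - 1) (brick_at (r - 1) s)) (st r (brick_at r s))) <->
  (forall x q, g x q -> block_rel st x q).
Proof.
have key : forall r s k j r' b' r1 b, r mod 4 = j mod 4 -> s mod 4 = k mod 4 ->
    r' = r - 1 -> b' = brick_at (r - 1) s -> r1 = r -> b = brick_at r s ->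
    (wang_rel j k (st r' b') (st r1 b) <-> 
     wang_rel r s (st (r - 1) (brick_at (r - 1) s)) (st r (brick_at r s))).
  by move=> r s k j r' b' r1 b Hr Hs -> -> -> ->; split; apply: wang_rel_mod.
split=> [H x q Hg|H r s Ha].
  have H' : forall k j, 0 <= k < 4 -> 1 <= j <= 4 -> zact (4 * q + j) (4 * x + k).
    by move=> k j Hk Hj; rewrite zone_actE.
  by split; split; match goal with |- wang_rel ?j ?k _ _ =>
    let j' := constr:(if j =? 0 then 4 else j) in let j1 := eval compute in j' in
    apply/(@key (4 * q + j1) (4 * x + k)); [lia | lia | lia | rewrite /brick_at; lia | lia |
      rewrite /brick_at; lia | apply: H; apply: H'; lia] end.
pose x := s / 4; pose q := (r - 1) / 4.
have [[A0 A1 A2 A3] [B0 B1 B2 B3] [C0 C1 C2 C3] [D0 D1 D2 D3]] := H x q Ha.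
have Ek : s mod 4 = 0 \/ s mod 4 = 1 \/ s mod 4 = 2 \/ s mod 4 = 3 by lia.
have Ej : r mod 4 = 1 \/ r mod 4 = 2 \/ r mod 4 = 3 \/ r mod 4 = 0 by lia.
case: Ej => [Ej|[Ej|[Ej|Ej]]]; case: Ek => [Ek|[Ek|[Ek|Ek]]];
  match type of Ej with _ = ?j => match type of Ek with _ = ?k =>
    match goal with K : wang_rel j k _ _ |- _ =>
     apply: (proj1 (key r s k j _ _ _ _ _ _ _ _ _ _) K); rewrite /x /q;
       first [rewrite /brick_at; lia | lia] end end end.
Qed.

(** A shared edge takes its state from the cell on its left or below it; [wang_ok] makes the other
    cell agree. *)
Lemma wang_state_ok tau : wang_ok tau -> state_ok zact bidx wang_rel I (wang_state tau).
Proof.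
move=> Hw; split; last first.
  apply/rel_block => x q Hg.
  have [R1 EE EN EW ES] := Hw x q Hg.
  have HE := HfE R1; have HN := HfN R1; have V := Hvb (x - 1) q; have Hq := Hhb x q.
  have XoL : wang_state tau (4 * q + 1) (4 * (x - 1) + 3) = fW (tau x q) /\ in_range nE (fW (tau x q)).
    rewrite state_Xo (_ : x - 1 + 1 = x); last by lia.
    rewrite Hg andbT; case Eg: (g (x - 1) q); last by rewrite EW.
    have [R1' E' _ _ _] := Hw _ _ Eg; move: E'; rewrite (_ : x - 1 + 1 = x); last by lia.
    by rewrite Hg => <-; split=> //; apply: HfE.
  have XoR : wang_state tau (4 * q + 1) (4 * x + 3) = fE (tau x q).
    by rewrite state_Xo Hg /= EE; case: (g (x + 1) q).
  have YS : wang_state tau (4 * q) (4 * x + 2) = fS (tau x q) /\ in_range nN (fS (tau x q)).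
    rewrite state_Y1 Hg andbT; case Eg: (g x (q - 1)); last by rewrite ES.
    have [R1' _ E' _ _] := Hw _ _ Eg; move: E'; rewrite (_ : q - 1 + 1 = q); last by lia.
    by rewrite Hg => <-; split=> //; apply: HfN.
  have YN : wang_state tau (4 * (q + 1)) (4 * x + 2) = fN (tau x q).
    by rewrite state_Y1 (_ : q + 1 - 1 = q) ?Hg /= ?EN; [case: (g x (q + 1)) | lia].
  case: XoL => XL RL; case: YS => YS RS.
  rewrite /block_rel XL XoR YS YN !state_Y0 !state_Xi !state_T0 !state_T1 !state_X'i !state_X'o Hg.
  rewrite /wang_rel /= /in_range; rewrite /in_range in R1 HE HN RL RS.
  by repeat split; lia.
move=> r s Hrs; split; last by rewrite /wang_state => ->.
rewrite /wang_state; case Hr: (real zact r s); last exact: boundary_idx_range.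
have Hg : g (s / 4) (r / 4).
  move: Hr; rewrite /real => /and4P[_ _ Hr _]; move: Hr; rewrite /zone_act.
  by congr (is_true (g _ _)); lia.
have [R1 _ _ _ _] := Hw _ _ Hg; have HE := HfE R1; have HN := HfN R1.
case: Z.eqb_spec => Hr4.
  case: Z.eqb_spec => _; first by lia.
  have Hg' : g (s / 4) (r / 4 - 1).
    move: Hr; rewrite /real => /and4P[Hr _ _ _]; move: Hr; rewrite /zone_act.
    by congr (is_true (g _ _)); lia.
  by have [R1' _ _ _ _] := Hw _ _ Hg'; have := HfN R1'; rewrite /in_range; lia.
by move: R1 HE HN; rewrite /in_range; repeat case: Z.eqb_spec => _; lia.
Qed.

(** The tile of a cell is read off its inner brick in row [4 q + 1], and the relations in the block
    propagate it to all other bricks. *)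
Lemma state_wang_ok st : state_ok zact bidx wang_rel I st ->
  let tau := fun x q => st (4 * q + 1) (4 * x + 1) in
  wang_ok tau /\ forall r s, (s - r) mod 2 = 0 -> st r s = wang_state tau r s.
Proof.
move=> [Hv /rel_block Hrel] tau.
have Hvirt : forall r s, (s - r) mod 2 = 0 -> real zact r s = false -> st r s = bidx r s.
  by move=> r s Hrs Hr; have [_ ->] := Hv r s Hrs.
have VX : forall x q, g x q && g (x + 1) q = false -> st (4 * q + 1) (4 * x + 3) = vb x q.
  move=> x q Hg; rewrite Hvirt; first by rewrite /boundary_idx !mod4E ?div4E //=; lia.
    by lia.
  by rewrite real_X //; left.
have VY : forall x q, g x (q - 1) && g x q = false -> st (4 * q) (4 * x + 2) = hb x q.
  move=> x q Hg; rewrite Hvirt; last by rewrite real_Y //; right.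
    by rewrite -(Z.add_0_r (4 * q)) /boundary_idx !mod4E ?div4E //=; lia.
  by lia.
have U : forall x q, g x q -> [/\ in_range nW (tau x q),
    [/\ st (4 * q) (4 * x) = 1, st (4 * (q + 1)) (4 * x) = 1,
     st (4 * q + 2) (4 * x) = tau x q & st (4 * q + 2) (4 * x + 2) = tau x q],
    [/\ st (4 * q) (4 * x + 2) = fS (tau x q), st (4 * (q + 1)) (4 * x + 2) = fN (tau x q),
     st (4 * q + 1) (4 * (x - 1) + 3) = fW (tau x q) & st (4 * q + 1) (4 * x + 3) = fE (tau x q)] &
    [/\ st (4 * q + 3) (4 * x + 1) = fN (tau x q), st (4 * q + 3) (4 * (x - 1) + 3) = 1 &
     st (4 * q + 3) (4 * x + 3) = 1]].
  move=> x q Hg.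
  have [[A0 A1 A2 A3] [B0 B1 B2 B3] [C0 C1 C2 C3] [D0 D1 D2 D3]] := Hrel x q Hg.
  rewrite /wang_rel /= in A0 A1 A2 A3 B0 B1 B2 B3 C0 C1 C2 C3 D0 D1 D2 D3.
  rewrite -/(tau x q) in A1 A2 B1 B2.
  case: A1 => A1 R1; case: A2 => _ _ A2; case: B1 => B1 _; case: B2 => B2 _.
  rewrite -B1 in B0 C0 C1; rewrite -B2 in B3 C2 C3.
  case: B0 => _ _ B0; case: B3 => _ _ B3; case: C1 => _ _ C1; case: D0 => D0 D0'.
  case: D2 => D2 _; case: D3 => D3 _.
  by split=> //; split=> //; rewrite -?D2 -?C1.
split.
- move=> x q Hg; have [R1 [U1 U2 U3 U4] [U5 U6 U7 U8] _] := U x q Hg; split=> //.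
  + rewrite -U8; case Eg: (g (x + 1) q); last by rewrite VX // Hg Eg.
    have [_ _ [_ _ + _] _] := U _ _ Eg; rewrite (_ : x + 1 - 1 = x) //; lia.
  + rewrite -U6; case Eg: (g x (q + 1)); last by rewrite VY // Eg andbF.
    by have [_ _ [-> _ _ _] _] := U _ _ Eg.
  + by move=> Eg; rewrite -U7 VX // Eg.
  + by move=> Eg; rewrite -U5 VY // Eg.
- move=> r s Hrs; case Hr: (real zact r s); last by rewrite /wang_state Hr; apply: Hvirt.
  pose x := s / 4; pose q := r / 4.
  have Ek : s = 4 * x \/ s = 4 * x + 1 \/ s = 4 * x + 2 \/ s = 4 * x + 3 by rewrite /x; lia.
  have Ej : r = 4 * q \/ r = 4 * q + 1 \/ r = 4 * q + 2 \/ r = 4 * q + 3 by rewrite /q; lia.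
  move: x q Ek Ej => x q Ek Ej.
  case: Ej => [?|[?|[?|?]]]; case: Ek => [?|[?|[?|?]]]; subst r s; try (exfalso; lia).
  + rewrite -(Z.add_0_r (4 * x)) real_Y in Hr; last by left.
    case/andP: Hr => _ Hg; have [_ [-> _ _ _] _ _] := U _ _ Hg.
    by rewrite state_Y0.
  + rewrite real_Y in Hr; last by right.
    rewrite state_Y1 Hr; case/andP: Hr => Hg _; have [_ _ [_ + _ _] _] := U _ _ Hg.
    by rewrite (_ : q - 1 + 1 = q) //; lia.
  + rewrite real_in in Hr; try lia.
    by rewrite state_Xi Hr.
  + rewrite real_X in Hr; last by left.
    rewrite state_Xo Hr; case/andP: Hr => Hg _.
    by have [_ _ [_ _ _ ->] _] := U _ _ Hg.
  + rewrite -(Z.add_0_r (4 * x)) real_in in Hr; try lia.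
    by rewrite state_T0 Hr; have [_ [_ _ -> _] _ _] := U _ _ Hr.
  + rewrite real_in in Hr; try lia.
    by rewrite state_T1 Hr; have [_ [_ _ _ ->] _ _] := U _ _ Hr.
  + rewrite real_in in Hr; try lia.
    by rewrite state_X'i Hr; have [_ _ _ [-> _ _]] := U _ _ Hr.
  + rewrite real_X in Hr; last by right.
    case/andP: Hr => Hg _; rewrite state_X'o.
    by have [_ _ _ [_ _ ->]] := U _ _ Hg.
Qed.

End WangStates.

(** * The carved blocks have the required layout *)

Section Layout.
Local Open Scope Z_scope.
Local Ltac Zify.zify_post_hook ::= Z.to_euclidean_division_equations.

(** All rows are lowered by [Lw] so that each brick of row [4 q], in any state, lies across the line
    between two blocks; hence the bounds [e < Lw] and [Lw + e < t]. *)
Variables (S t G Lw : Z).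

Definition block_height : Z := 4 * (t + G).

(** A horizontal border follows the two bricks of row [4 q] that would lie across it: a neutral one
    of class 0 up to abscissa 17 = 8 + 9, then the one of class 1 that carries the color. *)
Definition strip_shift (i c : Z) : Z := if i <? 17 then shift S 0 1 else shift S 1 c.

(** The places of the bricks of rows 1 and 3 that would lie across a vertical border, of classes 3
    and 7. The first carries the color, the second is neutral. *)
Definition in_dent (c j : Z) : bool :=
  ((t + G - Lw + shift S 3 c <=? j) && (j <? t + G - Lw + shift S 3 c + t)) ||
  ((3 * (t + G) - Lw + shift S 7 1 <=? j) && (j <? 3 * (t + G) - Lw + shift S 7 1 + t)).

(* The cells kept in the block of a cell: [bE], [bN], [bW], [bS] tell which sides
   are on the boundary and [iE], [iN], [iW], [iS] are the states of their colors. *)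
Definition keep (bE bN bW bS : bool) (iE iN iW iS i j : Z) : bool :=
  [&& ~~ (bS && (j <? t - Lw + strip_shift i iS)),
      ~~ (bN && (block_height - Lw + strip_shift i iN <=? j)),
      ~~ [&& bE, 29 <=? i & in_dent iE j] & ~~ [&& bW, i <? 8 & in_dent iW j]].

Variables (g : Z -> Z -> bool) (hb vb : Z -> Z -> Z).

Definition block_cell (x y : Z) : bool :=
  let c := x / 40 in let q := y / block_height in
  g c q && keep (~~ g (c + 1) q) (~~ g c (q + 1)) (~~ g (c - 1) q) (~~ g c (q - 1))
    (vb c q) (hb c (q + 1)) (vb (c - 1) q) (hb c q) (x mod 40) (y mod block_height).

Variables (I e nW nN nE : Z) (rel : Z -> Z -> Z -> Z -> Prop).
Hypotheses (Hhb : forall x q, in_range nN (hb x q)) (Hvb : forall x q, in_range nE (vb x q)).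
Hypotheses (IN : nN <= I) (IE : nE <= I) (HLw : e < Lw) (HLw' : Lw + e < t).
Hypothesis HC : consts_ok (boundary_idx hb vb) rel S I t G e.

Definition dent_free c j :=
  (j < t + G - Lw + shift S 3 c \/ t + G - Lw + shift S 3 c + t <= j) /\
  (j < 3 * (t + G) - Lw + shift S 7 1 \/ 3 * (t + G) - Lw + shift S 7 1 + t <= j).

Lemma in_dentP c j : in_dent c j = false <-> dent_free c j.
Proof.
rewrite /in_dent /dent_free.
by rewrite Bool.orb_false_iff !Bool.andb_false_iff !Z.leb_gt !Z.ltb_ge.
Qed.

Lemma keepP bE bN bW bS iE iN iW iS i j : keep bE bN bW bS iE iN iW iS i j <->
  [/\ bS -> t - Lw + strip_shift i iS <= j, bN -> j < block_height - Lw + strip_shift i iN,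
      bE -> 29 <= i -> dent_free iE j & bW -> i < 8 -> dent_free iW j].
Proof.
rewrite /keep; split.
  case/and4P=> H1 H2 H3 H4; split.
  - by move=> Hb; move: H1; rewrite Hb /=; case: Z.ltb_spec.
  - by move=> Hb; move: H2; rewrite Hb /=; case: Z.leb_spec.
  - by move=> Hb /Z.leb_le Hi; move: H3; rewrite Hb Hi /= => /negbTE /in_dentP.
  - by move=> Hb /Z.ltb_lt Hi; move: H4; rewrite Hb Hi /= => /negbTE /in_dentP.
case=> H1 H2 H3 H4; apply/and4P; split.
- by case: bS H1 => //= /(_ isT); case: Z.ltb_spec => //= ? ?; exfalso; lia.
- by case: bN H2 => //= /(_ isT); case: Z.leb_spec => //= ? ?; exfalso; lia.
- by case: bE H3 => //= /(_ isT); case: Z.leb_spec => //= Hi /(_ Hi) /in_dentP ->.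
- by case: bW H4 => //= /(_ isT); case: Z.ltb_spec => //= Hi /(_ Hi) /in_dentP ->.
Qed.

Lemma block_cellP c q i j : 0 <= i < 40 -> 0 <= j < block_height ->
  block_cell (40 * c + i) (q * block_height + j) <->
  [/\ g c q,
    [/\ g c (q - 1) = false -> t - Lw + strip_shift i (hb c q) <= j &
        g c (q + 1) = false -> j < block_height - Lw + strip_shift i (hb c (q + 1))],
    g (c + 1) q = false -> 29 <= i -> dent_free (vb c q) j &
    g (c - 1) q = false -> i < 8 -> dent_free (vb (c - 1) q) j].
Proof.
move=> Hi Hj; rewrite /block_cell.
have -> : (40 * c + i) / 40 = c by lia.
have -> : (40 * c + i) mod 40 = i by lia.
have -> : (q * block_height + j) / block_height = q.
  by symmetry; apply: (Z.div_unique _ _ _ j); lia.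
have -> : (q * block_height + j) mod block_height = j.
  by symmetry; apply: (Z.mod_unique _ _ q); lia.
case: (g c q) => /=; last by split=> [//|[]].
rewrite keepP; split.
  by case=> H1 H2 H3 H4; split=> //; [split|..]; move=> Hg; [apply: H1|apply: H2|apply: H3|apply: H4]; rewrite Hg.
by case=> _ [H1 H2] H3 H4; split=> /negbTE.
Qed.

Let e0 := e_gt0 HC.
Let HG := const_G HC.
Let Ht := const_t HC.

Lemma shift_in c i : 1 <= i <= I -> 0 <= shift S c i <= e.
Proof. by case/(shift_ok HC c). Qed.

Lemma hb_in x q : 1 <= hb x q <= I.
Proof. by have := Hhb x q; rewrite /in_range; lia. Qed.

Lemma vb_in x q : 1 <= vb x q <= I.
Proof. by have := Hvb x q; rewrite /in_range; lia. Qed.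

Lemma strip_shift_in i x q : 0 <= strip_shift i (hb x q) <= e.
Proof.
rewrite /strip_shift; case: ifP => _; first by apply: shift_in; have := const_I HC; lia.
exact/shift_in/hb_in.
Qed.

Lemma slot_coord s x : slot_x s <= x < slot_x s + wd s -> exists c k i,
  [/\ s = 4 * c + k, x = 40 * c + i, 0 <= i < 40 &
   (k = 0 /\ i < 8) \/ (k = 1 /\ 8 <= i < 17) \/ (k = 2 /\ 17 <= i < 29) \/ (k = 3 /\ 29 <= i)].
Proof.
move=> Hx; exists (s / 4), (s mod 4), (x - 40 * (s / 4)).
by move: Hx; rewrite /slot_x /wd; repeat case: Z.eqb_spec => ?; split; lia.
Qed.

Lemma row_coord r : exists q j, [/\ r = 4 * q + j & j = 0 \/ j = 1 \/ j = 2 \/ j = 3].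
Proof. by exists (r / 4), (r mod 4); split; lia. Qed.

Lemma strip_shift_left i c : i < 17 -> strip_shift i c = shift S 0 1.
Proof. by rewrite /strip_shift; case: Z.ltb_spec => //; lia. Qed.

Lemma strip_shift_right i c : 17 <= i -> strip_shift i c = shift S 1 c.
Proof. by rewrite /strip_shift; case: Z.ltb_spec => //; lia. Qed.

Notation zact := (zone_act g).
Notation bidx := (boundary_idx hb vb).
Notation bt := (bot S t G Lw).

Lemma rows_mul q j : (4 * q + j) * (t + G) = q * block_height + j * (t + G).
Proof. by rewrite /block_height; lia. Qed.

(* The bottom of a brick relative to its block; for a brick outside the region it
   is the end of the corresponding strip or dent. *)
Lemma bot_Y q c k i st : k = 0 \/ k = 2 -> (k = 0 /\ i < 17) \/ (k = 2 /\ 17 <= i) ->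
  valid zact bidx I (4 * q) (4 * c + k) st ->
  exists v, [/\ bt (4 * q) (4 * c + k) st = q * block_height - Lw + v, 0 <= v <= e &
    g c (q - 1) && g c q = false -> v = strip_shift i (hb c q)].
Proof.
move=> Hk Hi [Hst Hv]; exists (shift S (k / 2) st); split.
- rewrite /bot -{1}(Z.add_0_r (4 * q)) rows_mul; congr (_ + shift S _ st); first by lia.
  by rewrite /brick_class; lia.
- exact: shift_in.
- rewrite -(@real_Y g q c k Hk) => /Hv ->.
  have E4 : (4 * q) mod 4 = 0 by lia.
  have D4 : 4 * q / 4 = q by lia.
  have E0 : (4 * c + 0) mod 4 = 0 by lia.
  have E2 : (4 * c + 2) mod 4 = 2 by lia.
  have E2' : (4 * c + 2) / 4 = c by lia.
  case: Hi => [[-> Hi]|[-> Hi]].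
    by rewrite (strip_shift_left _ Hi) /boundary_idx E4 E0.
  by rewrite (strip_shift_right _ Hi) /boundary_idx E4 E2 E2' D4.
Qed.

Lemma bot_X q c j st : j = 1 \/ j = 3 -> valid zact bidx I (4 * q + j) (4 * c + 3) st ->
  exists v, [/\ bt (4 * q + j) (4 * c + 3) st = q * block_height + j * (t + G) - Lw + v, 0 <= v <= e &
    g c q && g (c + 1) q = false -> v = if j =? 1 then shift S 3 (vb c q) else shift S 7 1].
Proof.
move=> Hj [Hst Hv]; exists (shift S (2 * j + 1) st); split.
- rewrite /bot rows_mul; congr (_ + shift S _ st).
  by rewrite /brick_class; lia.
- exact: shift_in.
- rewrite -(@real_X g q c j Hj) => /Hv ->.
  by case: Hj => ->; rewrite /boundary_idx !mod4E ?div4E //=; lia.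
Qed.

Lemma bot_in q b j st : 1 <= st <= I ->
  exists v, bt (4 * q + j) b st = q * block_height + j * (t + G) - Lw + v /\ 0 <= v <= e.
Proof.
move=> Hst; exists (shift S (brick_class (4 * q + j) b) st); split; last exact: shift_in.
by rewrite /bot rows_mul.
Qed.

(** Cases on the row and the slot modulo 4. A brick across a border has the state imposed by
    [boundary_idx], and the strip or dent was cut for exactly that state. *)
Lemma block_layout : layout_ok zact bidx S I t G Lw block_cell.
Proof.
have S7 : 0 <= shift S 7 1 <= e by apply: shift_in; have := const_I HC; lia.
have EN : block_height = 4 * (t + G) by [].
split.
- move=> r s st x y V Hx Hy.
  have [c [k [i [Es Ex Hi Hk]]]] := slot_coord Hx.
  have [q [j [Er Hj]]] := row_coord r; subst s r x; clear Hx.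
  rewrite /top in Hy.
  have SE : 0 <= shift S 3 (vb c q) <= e by apply/shift_in/vb_in.
  have SW : 0 <= shift S 3 (vb (c - 1) q) <= e by apply/shift_in/vb_in.
  case: Hj => [?|[?|[?|?]]]; subst j.
  + rewrite Z.add_0_r in V Hy *.
    have [k' [Hk' Eb Hik]] : exists k', [/\ k' = 0 \/ k' = 2, brick_at (4 * q) (4 * c + k) = 4 * c + k' &
        (k' = 0 /\ i < 17) \/ (k' = 2 /\ 17 <= i)].
      case: (Z_lt_le_dec i 17) => Hi17; [exists 0 | exists 2]; split; rewrite /brick_at; lia.
    rewrite Eb in V Hy *; rewrite (real_Y _ _ _ Hk').
    have [v [Ev Hv Hv']] := bot_Y Hk' Hik V.
    have Sq := strip_shift_in i c q.
    (* The lower part of a brick of row [4 q] belongs to the block underneath. *)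
    case: (Z_lt_le_dec y (q * block_height)) => Hyq.
      have -> : y = (q - 1) * block_height + (y - (q - 1) * block_height) by lia.
      rewrite block_cellP //; last by lia.
      have -> : q - 1 + 1 = q by lia.
      have Sq1 := strip_shift_in i c (q - 1).
      have SE1 : 0 <= shift S 3 (vb c (q - 1)) <= e by apply/shift_in/vb_in.
      have SW1 : 0 <= shift S 3 (vb (c - 1) (q - 1)) <= e by apply/shift_in/vb_in.
      case Eg: (g c (q - 1)); last by split=> [[]|].
      case Eg': (g c q) => /=; last first.
        by split=> // -[_ [_ /(_ erefl) H] _ _]; move: H; rewrite ?/dent_free -Hv' ?Eg ?Eg' //; lia.
      by split=> // _; split=> //; [split|..] => // *; rewrite ?/dent_free; lia.
    have -> : y = q * block_height + (y - q * block_height) by lia.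
    rewrite block_cellP //; last by lia.
    have Sq1 := strip_shift_in i c (q + 1).
    case Eg: (g c q); last by rewrite andbF; split=> [[]|].
    case Eg': (g c (q - 1)) => /=; last first.
      by split=> // -[_ [/(_ erefl) H _] _ _]; move: H; rewrite ?/dent_free -Hv' ?Eg ?Eg' //; lia.
    by split=> // _; split=> //; [split|..] => // *; rewrite ?/dent_free; lia.
  + have Sq := strip_shift_in i c q; have Sq1 := strip_shift_in i c (q + 1).
    case: (Z_lt_le_dec i 8) => Hi8; [|case: (Z_lt_le_dec i 29) => Hi29].
    * have Eb : brick_at (4 * q + 1) (4 * c + k) = 4 * (c - 1) + 3 by rewrite /brick_at; lia.
      rewrite Eb in V Hy *; have [v [Ev Hv Hv']] := bot_X (or_introl erefl) V.
      rewrite real_X; last by left.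
      have E1 : c - 1 + 1 = c by lia.
      rewrite E1 /= in Hv' *.
      have -> : y = q * block_height + (y - q * block_height) by lia.
      rewrite block_cellP //; last by lia.
      case Eg: (g c q); last by rewrite andbF; split=> [[]|].
      case Eg': (g (c - 1) q) => /=; last first.
        by split=> // -[_ _ _ /(_ erefl Hi8)]; rewrite ?/dent_free -Hv' ?Eg ?Eg' //; lia.
      by split=> // _; split=> //; [split|..] => // *; rewrite ?/dent_free; lia.
    * have Eb : brick_at (4 * q + 1) (4 * c + k) = 4 * c + 1 by rewrite /brick_at; lia.
      rewrite Eb in V Hy *; have [v [Ev Hv]] := @bot_in q (4 * c + 1) 1 _ V.1.
      rewrite real_in; try lia.
      have -> : y = q * block_height + (y - q * block_height) by lia.
      rewrite block_cellP //; last by lia.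
      by split=> [[]//|Hg]; split=> //; [split|..] => *; rewrite ?/dent_free; lia.
    * have Eb : brick_at (4 * q + 1) (4 * c + k) = 4 * c + 3 by rewrite /brick_at; lia.
      rewrite Eb in V Hy *; have [v [Ev Hv Hv']] := bot_X (or_introl erefl) V.
      rewrite real_X; last by left.
      rewrite /= in Hv'.
      have -> : y = q * block_height + (y - q * block_height) by lia.
      rewrite block_cellP //; last by lia.
      case Eg: (g c q); last by split=> [[]|].
      case Eg': (g (c + 1) q) => /=; last first.
        by split=> // -[_ _ /(_ erefl Hi29) H _]; move: H; rewrite ?/dent_free -Hv' ?Eg ?Eg' //; lia.
      by split=> // _; split=> //; [split|..] => // *; rewrite ?/dent_free; lia.
  + have Sq := strip_shift_in i c q; have Sq1 := strip_shift_in i c (q + 1).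
    have [k' [Hk' Eb]] : exists k', 0 <= k' < 3 /\ brick_at (4 * q + 2) (4 * c + k) = 4 * c + k'.
      case: (Z_lt_le_dec i 17) => Hi17; [exists 0 | exists 2]; split; rewrite /brick_at; lia.
    rewrite Eb in V Hy *; have [v [Ev Hv]] := @bot_in q (4 * c + k') 2 _ V.1.
    rewrite real_in; try lia.
    have -> : y = q * block_height + (y - q * block_height) by lia.
    rewrite block_cellP //; last by lia.
    by rewrite /dent_free; split=> [[]//|Hg]; split=> //; [split|..] => *; rewrite ?/dent_free; lia.
  + have Sq := strip_shift_in i c q; have Sq1 := strip_shift_in i c (q + 1).
    case: (Z_lt_le_dec i 8) => Hi8; [|case: (Z_lt_le_dec i 29) => Hi29].
    * have Eb : brick_at (4 * q + 3) (4 * c + k) = 4 * (c - 1) + 3 by rewrite /brick_at; lia.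
      rewrite Eb in V Hy *; have [v [Ev Hv Hv']] := bot_X (or_intror erefl) V.
      rewrite real_X; last by right.
      have E1 : c - 1 + 1 = c by lia.
      rewrite E1 /= in Hv' *.
      have -> : y = q * block_height + (y - q * block_height) by lia.
      rewrite block_cellP //; last by lia.
      case Eg: (g c q); last by rewrite andbF; split=> [[]|].
      case Eg': (g (c - 1) q) => /=; last first.
        by split=> // -[_ _ _ /(_ erefl Hi8)]; rewrite ?/dent_free -Hv' ?Eg ?Eg' //; lia.
      by split=> // _; split=> //; [split|..] => // *; rewrite ?/dent_free; lia.
    * have Eb : brick_at (4 * q + 3) (4 * c + k) = 4 * c + 1 by rewrite /brick_at; lia.
      rewrite Eb in V Hy *; have [v [Ev Hv]] := @bot_in q (4 * c + 1) 3 _ V.1.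
      rewrite real_in; try lia.
      have -> : y = q * block_height + (y - q * block_height) by lia.
      rewrite block_cellP //; last by lia.
      by split=> [[]//|Hg]; split=> //; [split|..] => *; rewrite ?/dent_free; lia.
    * have Eb : brick_at (4 * q + 3) (4 * c + k) = 4 * c + 3 by rewrite /brick_at; lia.
      rewrite Eb in V Hy *; have [v [Ev Hv Hv']] := bot_X (or_intror erefl) V.
      rewrite real_X; last by right.
      rewrite /= in Hv'.
      have -> : y = q * block_height + (y - q * block_height) by lia.
      rewrite block_cellP //; last by lia.
      case Eg: (g c q); last by split=> [[]|].
      case Eg': (g (c + 1) q) => /=; last first.
        by split=> // -[_ _ /(_ erefl Hi29) H _]; move: H; rewrite ?/dent_free -Hv' ?Eg ?Eg' //; lia.
      by split=> // _; split=> //; [split|..] => // *; rewrite ?/dent_free; lia.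
- move=> r s st' st x y V' V Hx Hy.
  have [c [k [i [Es Ex Hi Hk]]]] := slot_coord Hx.
  have [q [j [Er Hj]]] : exists q j, r = 4 * q + j /\ (j = 1 \/ j = 2 \/ j = 3 \/ j = 4).
    by exists ((r - 1) / 4), ((r - 1) mod 4 + 1); lia.
  subst s r x; clear Hx.
  rewrite zone_actE; try lia.
  rewrite /top in Hy.
  have SE : 0 <= shift S 3 (vb c q) <= e by apply/shift_in/vb_in.
  have SW : 0 <= shift S 3 (vb (c - 1) q) <= e by apply/shift_in/vb_in.
  have Sq := strip_shift_in i c q; have Sq1 := strip_shift_in i c (q + 1).
  have Ej : 4 * q + j - 1 = 4 * q + (j - 1) by lia.
  rewrite Ej in Hy V'.
  (* Next to a border the space starts or stops exactly at the end of the cut: [FY] for the south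
     strip, [FYN] for the north strip, [FX] for the dents. *)
  have FY : (j = 1 -> g c q -> g c (q - 1) = false -> exists v, 
       bt (4 * q + (j - 1)) (brick_at (4 * q + (j - 1)) (4 * c + k)) st' =
         q * block_height - Lw + v /\ v = strip_shift i (hb c q)).
    move=> ? Hg Hg1; subst j; rewrite (_ : 4 * q + (1 - 1) = 4 * q) in V' *; last by lia.
    have [k' [Hk' Eb Hik]] : exists k', [/\ k' = 0 \/ k' = 2, brick_at (4 * q) (4 * c + k) = 4 * c + k' &
        (k' = 0 /\ i < 17) \/ (k' = 2 /\ 17 <= i)].
      case: (Z_lt_le_dec i 17) => Hi17; [exists 0 | exists 2]; split; rewrite /brick_at; lia.
    rewrite Eb in V' *; have [v [Ev Hv Hv']] := bot_Y Hk' Hik V'.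
    by exists v; rewrite Ev Hv' // Hg1.
  have FYN : (j = 4 -> g c q -> g c (q + 1) = false -> exists v, 
       bt (4 * q + j) (brick_at (4 * q + j) (4 * c + k)) st =
         (q + 1) * block_height - Lw + v /\ v = strip_shift i (hb c (q + 1))).
    move=> ? Hg Hg1; subst j; rewrite (_ : 4 * q + 4 = 4 * (q + 1)) in V *; last by lia.
    have [k' [Hk' Eb Hik]] : exists k', [/\ k' = 0 \/ k' = 2, brick_at (4 * (q + 1)) (4 * c + k) = 4 * c + k' &
        (k' = 0 /\ i < 17) \/ (k' = 2 /\ 17 <= i)].
      case: (Z_lt_le_dec i 17) => Hi17; [exists 0 | exists 2]; split; rewrite /brick_at; lia.
    rewrite Eb in V *; have [v [Ev Hv Hv']] := bot_Y Hk' Hik V.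
    by exists v; rewrite Ev Hv' // Hg1 andbF.
  have FX : forall j0 st0, j0 = 1 \/ j0 = 3 ->
      valid zact bidx I (4 * q + j0) (brick_at (4 * q + j0) (4 * c + k)) st0 ->
      (g (c + 1) q = false -> 29 <= i -> exists d,
        bt (4 * q + j0) (brick_at (4 * q + j0) (4 * c + k)) st0 = q * block_height + j0 * (t + G) - Lw + d /\
        (j0 = 1 -> d = shift S 3 (vb c q)) /\ (j0 = 3 -> d = shift S 7 1)) /\
      (g (c - 1) q = false -> i < 8 -> exists d,
        bt (4 * q + j0) (brick_at (4 * q + j0) (4 * c + k)) st0 = q * block_height + j0 * (t + G) - Lw + d /\
        (j0 = 1 -> d = shift S 3 (vb (c - 1) q)) /\ (j0 = 3 -> d = shift S 7 1)).
    move=> j0 st0 Hj0 V0; split=> Hg Hi0.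
      have Eb : brick_at (4 * q + j0) (4 * c + k) = 4 * c + 3 by rewrite /brick_at; lia.
      rewrite Eb in V0 *; have [v [Ev Hv Hv']] := bot_X Hj0 V0.
      exists v; split=> //; rewrite Hv' ?Hg ?andbF //.
      by split=> ->.
    have Eb : brick_at (4 * q + j0) (4 * c + k) = 4 * (c - 1) + 3 by rewrite /brick_at; lia.
    rewrite Eb in V0 *; have [v [Ev Hv Hv']] := bot_X Hj0 V0.
    exists v; split=> //; rewrite Hv' ?Hg //.
    by split=> ->.
  have FX1 := FX j st; have FX2 := FX (j - 1) st'.
  have [v1 [Ev1 Hv1]] := @bot_in q (brick_at (4 * q + j) (4 * c + k)) j _ V.1.
  have [v2 [Ev2 Hv2]] := @bot_in q (brick_at (4 * q + (j - 1)) (4 * c + k)) (j - 1) _ V'.1.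
  have -> : y = q * block_height + (y - q * block_height) by lia.
  rewrite block_cellP //; last by case: Hj => [?|[?|[?|?]]]; subst j; lia.
  split=> [[]//|Hg]; split=> //; first split.
  + move=> Hgs; case: Hj => [?|Hj]; last by case: Hj => [?|[?|?]]; subst j; lia.
    by have [v [E1 E2]] := FY ltac:(lia) Hg Hgs; lia.
  + move=> Hgn; case: (Z.eq_dec j 4) => [?|Hj4].
      by have [v [E1 E2]] := FYN ltac:(lia) Hg Hgn; subst j; lia.
    by case: Hj => [?|[?|[?|?]]]; subst j; lia.
  + move=> Hge Hi29; case: Hj => [?|[?|[?|?]]]; subst j.
    * by have [/(_ Hge Hi29)[d [Ed [Hd1 Hd3]]] _] := FX1 ltac:(lia) V; rewrite /dent_free; lia.
    * by have [/(_ Hge Hi29)[d [Ed [Hd1 Hd3]]] _] := FX2 ltac:(lia) V'; rewrite /dent_free; lia.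
    * by have [/(_ Hge Hi29)[d [Ed [Hd1 Hd3]]] _] := FX1 ltac:(lia) V; rewrite /dent_free; lia.
    * by have [/(_ Hge Hi29)[d [Ed [Hd1 Hd3]]] _] := FX2 ltac:(lia) V'; rewrite /dent_free; lia.
  + move=> Hge Hi8; case: Hj => [?|[?|[?|?]]]; subst j.
    * by have [_ /(_ Hge Hi8)[d [Ed [Hd1 Hd3]]]] := FX1 ltac:(lia) V; rewrite /dent_free; lia.
    * by have [_ /(_ Hge Hi8)[d [Ed [Hd1 Hd3]]]] := FX2 ltac:(lia) V'; rewrite /dent_free; lia.
    * by have [_ /(_ Hge Hi8)[d [Ed [Hd1 Hd3]]]] := FX1 ltac:(lia) V; rewrite /dent_free; lia.
    * by have [_ /(_ Hge Hi8)[d [Ed [Hd1 Hd3]]]] := FX2 ltac:(lia) V'; rewrite /dent_free; lia.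
Qed.

End Layout.

Notation toZ := ssrZ.Z_of_int.
Notation toI := ssrZ.int_of_Z.

(** * The set of rectangles and its size *)

Section RectSets.
Local Open Scope Z_scope.
Local Ltac Zify.zify_post_hook ::= Z.to_euclidean_division_equations.

Variables (nW nN nE : nat) (fE fN fW fS : Z -> Z) (S t G : Z).
Notation rel := (wang_rel (Z.of_nat nW) (Z.of_nat nN) (Z.of_nat nE) fE fN fW fS).

Definition zseq (n : nat) : seq Z := [seq Z.of_nat k.+1 | k <- iota 0 n].

Lemma mem_zseq n z : (z \in zseq n) <-> in_range (Z.of_nat n) z.
Proof.
rewrite /in_range; split.
  by case/mapP => k; rewrite mem_iota => Hk ->; lia.
move=> H; apply/mapP; exists (Z.to_nat z).-1; first by rewrite mem_iota; lia.
by lia.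
Qed.

(** Candidates (row, slot, state below, state above), one list for each row and slot modulo 4. Only
    completeness matters, as [rects] keeps the related ones. The list of row 1, slot 3 has two free
    parameters and gives the quadratic term. *)
Definition quads : seq (Z * Z * Z * Z) :=
  [seq (1, 0, 1, i) | i <- zseq nE] ++ [seq (1, 1, 1, i) | i <- zseq nW] ++
  [seq (1, 2, fS i, i) | i <- zseq nW] ++ [seq (1, 3, i', i) | i' <- zseq nN, i <- zseq nE] ++
  [seq (2, 0, fW i, i) | i <- zseq nW] ++ [seq (2, 1, i, i) | i <- zseq nW] ++
  [seq (2, 2, i, i) | i <- zseq nW] ++ [seq (2, 3, fE i, i) | i <- zseq nW] ++
  [seq (3, 0, i, 1) | i <- zseq nW] ++ [seq (3, 1, i, fN i) | i <- zseq nW] ++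
  [seq (3, 2, i, fN i) | i <- zseq nW] ++ [seq (3, 3, i, 1) | i <- zseq nW] ++
  [seq (0, 1, i, 1) | i <- zseq nN] ++ [seq (0, 2, i, i) | i <- zseq nN] ++
  [seq (0, 3, 1, i) | i <- zseq nN] ++ [:: (0, 0, 1, 1)].

Local Ltac in_map := match goal with
  | H : in_range _ ?z |- _ => apply/mapP; exists z; [by apply/mem_zseq | by []]
  | H : in_range _ ?z, H' : in_range _ ?z' |- _ =>
      apply/allpairsP; exists (z, z'); split; [by apply/mem_zseq | by apply/mem_zseq | by []]
  end.
Local Ltac pick_list := rewrite mem_cat; apply/orP;
  first [solve [left; in_map] | right; first [pick_list | by rewrite inE]].

Lemma mod4_cases r : r mod 4 = 0 \/ r mod 4 = 1 \/ r mod 4 = 2 \/ r mod 4 = 3.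
Proof. by lia. Qed.

Lemma mem_quads r s i' i : rel r s i' i -> (r mod 4, s mod 4, i', i) \in quads.
Proof.
rewrite /wang_rel.
case: (mod4_cases r) => [->|[->|[->|->]]]; case: (mod4_cases s) => [->|[->|[->|->]]] /=;
  case=> *; subst; rewrite /quads; pick_list.
Qed.

Lemma size_quads : size quads = (nN * nE + nE + 3 * nN + 10 * nW + 1)%N.
Proof.
have sz n : size (zseq n) = n by rewrite size_map size_iota.
by rewrite /quads !size_cat size_allpairs !size_map !size_iota /=; lia.
Qed.

Definition rects : seq rect :=
  [seq (Z.to_nat (wd s + wd (s + 1)), Z.to_nat t) | s <- [:: 0; 1; 2; 3]] ++
  [seq (Z.to_nat (wd q.1.1.2), Z.to_nat (filler_height S G q.1.1.1 q.1.1.2 q.1.2 q.2))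
     | q <- [seq q <- quads | `[< rel q.1.1.1 q.1.1.2 q.1.2 q.2 >]]].

Definition size_ok w h := (h = t /\ exists s, w = wd s + wd (s + 1)) \/
  (exists r s i' i, [/\ w = wd s, h = filler_height S G r s i' i & rel r s i' i]).

Hypotheses (t_gt0 : 0 < t)
  (filler_gt0 : forall r s i' i, rel r s i' i -> 0 < filler_height S G r s i' i).

Lemma wd_gt0 s : 0 < wd s.
Proof. by rewrite /wd; do 3 case: Z.eqb. Qed.

Lemma wd_mod4 s : wd (s mod 4) = wd s.
Proof. by rewrite /wd Z.mod_mod. Qed.

Lemma wd_modS s : wd (s mod 4 + 1) = wd (s + 1).
Proof. by rewrite /wd Z.add_mod_idemp_l. Qed.

Lemma brick_class_mod r s k :
  brick_class (r mod 4 - k) (brick_at (r mod 4 - k) (s mod 4)) = brick_class (r - k) (brick_at (r - k) s).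
Proof.
have [a [r0 [-> Hr]]] : exists a r0, r = 4 * a + r0 /\ 0 <= r0 < 4.
  by exists (r / 4), (r mod 4); lia.
have [b [s0 [-> Hs]]] : exists b s0, s = 4 * b + s0 /\ 0 <= s0 < 4.
  by exists (s / 4), (s mod 4); lia.
have -> : (4 * a + r0) mod 4 = r0 by lia.
have -> : (4 * b + s0) mod 4 = s0 by lia.
rewrite /brick_class /brick_at.
have -> : (4 * b + s0 - (4 * a + r0 - k)) mod 2 = (s0 - (r0 - k)) mod 2 by lia.
have -> : (4 * a + r0 - k) mod 4 = (r0 - k) mod 4 by lia.
by move: ((s0 - (r0 - k)) mod 2) => d; have -> : (4 * b + s0 - d) mod 4 = (s0 - d) mod 4 by lia.
Qed.

Lemma filler_mod r s i' i : filler_height S G (r mod 4) (s mod 4) i' i = filler_height S G r s i' i.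
Proof.
by rewrite /filler_height brick_class_mod; have := brick_class_mod r s 0; rewrite !Z.sub_0_r => ->.
Qed.

Lemma mem_rects (w h : nat) : ((w, h) : rect) \in rects <-> size_ok (Z.of_nat w) (Z.of_nat h).
Proof.
split.
  rewrite mem_cat => /orP[/mapP[s _ [-> ->]]|/mapP[[[[r s] i'] i]]].
    left; split; first by lia.
    by exists s; have := wd_gt0 s; have := wd_gt0 (s + 1); lia.
  rewrite mem_filter => /andP[/asboolP /= Hr _] [-> ->].
  right; exists r, s, i', i; have := filler_gt0 Hr; have := wd_gt0 s.
  by split=> //; lia.
case=> [[Eh [s Ew]]|[r [s [i' [i [Ew Eh Hr]]]]]]; rewrite mem_cat; apply/orP.
  left; apply/mapP; exists (s mod 4).
    by case: (mod4_cases s) => [->|[->|[->|->]]].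
  by rewrite wd_mod4 wd_modS; congr pair; lia.
right; apply/mapP; exists (r mod 4, s mod 4, i', i).
  rewrite mem_filter; apply/andP; split; last exact: mem_quads.
  by apply/asboolP => /=; apply: wang_rel_mod Hr; rewrite Z.mod_mod.
by rewrite [_.1.1.1]/= [_.1.1.2]/= [_.1.2]/= [_.2]/= wd_mod4 filler_mod; congr pair; lia.
Qed.

Lemma size_rects : (size rects <= nN * nE + nE + 3 * nN + 10 * nW + 5)%N.
Proof.
rewrite size_cat !size_map size_filter /=.
have := count_size (fun q => `[< rel q.1.1.1 q.1.1.2 q.1.2 q.2 >]) quads.
by rewrite size_quads; lia.
Qed.

Lemma size_ok_gt0 w h : size_ok w h -> 0 < w /\ 0 < h.
Proof.
case=> [[-> [s ->]]|[r [s [i' [i [-> -> Hr]]]]]].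
  by have := wd_gt0 s; have := wd_gt0 (s + 1); lia.
by split; [exact: wd_gt0 | exact: filler_gt0 Hr].
Qed.

Variables (F : {fset cell}) (R : {fset rect}).
Hypothesis HR : forall w h : nat, ((w, h) : rect) \in R <-> size_ok (Z.of_nat w) (Z.of_nat h).

Definition in_region x y : Prop := ((toI x, toI y) : cell) \in F.

Definition placed (T : {fset placement}) a b w h := exists2 P : placement, P \in T &
  [/\ a = toZ P.1.1, b = toZ P.1.2, w = Z.of_nat P.2.1 & h = Z.of_nat P.2.2].

Lemma mem_placed_cells (P : placement) x y : ((toI x, toI y) : cell) \in placed_cells P <->
  in_tile (toZ P.1.1) (toZ P.1.2) (Z.of_nat P.2.1) (Z.of_nat P.2.2) x y.
Proof.
case: P => [[a b] [w h]]; rewrite /placed_cells /in_tile /=; split.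
  case/imfset2P => i /=; rewrite mem_iota => Hi [j /=]; rewrite mem_iota => Hj [Ex Ey].
  by lia.
move=> [Hx Hy]; apply/imfset2P; exists (Z.to_nat (x - toZ a)); first by rewrite /= mem_iota; lia.
exists (Z.to_nat (y - toZ b)); first by rewrite /= mem_iota; lia.
by rewrite /=; congr pair; lia.
Qed.

Lemma placement_eq (P Q : placement) : toZ P.1.1 = toZ Q.1.1 -> toZ P.1.2 = toZ Q.1.2 ->
  Z.of_nat P.2.1 = Z.of_nat Q.2.1 -> Z.of_nat P.2.2 = Z.of_nat Q.2.2 -> P = Q.
Proof.
case: P => [[a b] [w h]]; case: Q => [[a' b'] [w' h']] /= E1 E2 E3 E4.
by congr (_, _, (_, _)); lia.
Qed.

Lemma placed_mem (T : {fset placement}) (P : placement) : P \in T <->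
  placed T (toZ P.1.1) (toZ P.1.2) (Z.of_nat P.2.1) (Z.of_nat P.2.2).
Proof.
by split=> [HP|[Q HQ [E1 E2 E3 E4]]]; [exists P | rewrite (placement_eq E1 E2 E3 E4)].
Qed.

Lemma rect_tilingP T : is_rect_tiling R F T <-> tiling_ok rel S t G in_region (placed T).
Proof.
split.
- case/and3P=> /allP HR' /allP HD /eqP HU; split.
  + move=> x y; rewrite /in_region -HU => /bigfcupP[P /andP[HP _] Hc].
    exists (toZ P.1.1), (toZ P.1.2), (Z.of_nat P.2.1), (Z.of_nat P.2.2).
    by split; [exact/placed_mem | exact/mem_placed_cells].
  + move=> a b w h x y [P HP [-> -> -> ->]] /mem_placed_cells Hc.
    by rewrite /in_region -HU; apply/bigfcupP; exists P; rewrite ?HP.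
  + move=> a b w h a' b' w' h' x y [P HP [-> -> -> ->]] [Q HQ [-> -> -> ->]].
    move=> /mem_placed_cells h1 /mem_placed_cells h2.
    case: (eqVneq P Q) => [->//|PQ].
    have /allP/(_ Q HQ) := HD _ HP; rewrite PQ /= => /fdisjointP/(_ _ h1).
    by rewrite h2.
  + move=> a b w h [P HP [_ _ -> ->]].
    by apply/HR; rewrite -surjective_pairing; apply: HR'.
- case=> [Hcov Hsub Hdis Hsz]; apply/and3P; split.
  + apply/allP => P /placed_mem/Hsz/HR.
    by rewrite -surjective_pairing.
  + apply/allP => P HP; apply/allP => Q HQ; apply/implyP => PQ.
    apply/fdisjointP => -[x y] h1; apply/negP => h2.
    move: h1 h2; rewrite -(ssrZ.Z_of_intK x) -(ssrZ.Z_of_intK y).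
    move=> /mem_placed_cells h1 /mem_placed_cells h2.
    move/placed_mem: HP => HP; move/placed_mem: HQ => HQ.
    have [E1 E2 E3 E4] := Hdis _ _ _ _ _ _ _ _ _ _ HP HQ h1 h2.
    by rewrite (placement_eq E1 E2 E3 E4) eqxx in PQ.
  + apply/eqP/fsetP => -[x y]; apply/bigfcupP/idP.
      case=> P /andP[/placed_mem HP _]; rewrite -(ssrZ.Z_of_intK x) -(ssrZ.Z_of_intK y).
      by move=> /mem_placed_cells h1; exact: (Hsub _ _ _ _ _ _ HP h1).
    rewrite -(ssrZ.Z_of_intK x) -(ssrZ.Z_of_intK y) => hF.
    have [a [b [w [h [[P HP [-> -> -> ->]] h1]]]]] := Hcov _ _ hF.
    by exists P; [rewrite HP | apply/mem_placed_cells].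
Qed.

Lemma tile_in_product Tl (P : placement) : tiling_ok rel S t G in_region Tl ->
  Tl (toZ P.1.1) (toZ P.1.2) (Z.of_nat P.2.1) (Z.of_nat P.2.2) -> P \in (F `*` R)%fset.
Proof.
move=> HT HP; have Hs := tiling_size HT HP.
have [Hw Hh] := size_ok_gt0 Hs.
have : in_region (toZ P.1.1) (toZ P.1.2).
  by apply: (tiling_sub HT HP); rewrite /in_tile; lia.
move/HR: Hs; rewrite /in_region !ssrZ.Z_of_intK -!surjective_pairing => H1 H2.
by rewrite in_fsetM H1 H2.
Qed.

Definition tile_set (Tl : Z -> Z -> Z -> Z -> Prop) : {fset placement} :=
  [fset P in (F `*` R)%fset |
     `[< Tl (toZ P.1.1) (toZ P.1.2) (Z.of_nat P.2.1) (Z.of_nat P.2.2) >]]%fset.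

Lemma placed_tile_set Tl : tiling_ok rel S t G in_region Tl -> placed (tile_set Tl) = Tl.
Proof.
move=> HT; apply/funext => a; apply/funext => b; apply/funext => w; apply/funext => h.
apply/propext; split.
  by case=> P; rewrite !inE /= => /andP[_ /asboolP HP] [-> -> -> ->].
move=> H; have [Hw Hh] := size_ok_gt0 (tiling_size HT H).
pose P : placement := ((toI a, toI b), (Z.to_nat w, Z.to_nat h)).
have E : [/\ a = toZ P.1.1, b = toZ P.1.2, w = Z.of_nat P.2.1 & h = Z.of_nat P.2.2].
  by rewrite /P /=; split; lia.
case: E => E1 E2 E3 E4; rewrite E1 E2 E3 E4 in H.
exists P => //; rewrite !inE /=; apply/andP; split; last exact/asboolP.
by have := tile_in_product HT H; rewrite in_fsetM.
Qed.

Lemma tile_set_tiling Tl : tiling_ok rel S t G in_region Tl -> is_rect_tiling R F (tile_set Tl).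
Proof. by move=> HT; apply/rect_tilingP; rewrite placed_tile_set. Qed.

Lemma tiling_tile_set T : is_rect_tiling R F T -> T = tile_set (placed T).
Proof.
move/rect_tilingP => HT; apply/fsetP => P.
apply/idP/idP; rewrite !inE /=.
  move/placed_mem => HP; have := tile_in_product HT HP; rewrite in_fsetM => ->.
  exact/asboolP.
by case/andP=> _ /asboolP/placed_mem.
Qed.

Lemma tiling_in_powerset T : is_rect_tiling R F T -> T \in fpowerset (F `*` R)%fset.
Proof.
move/rect_tilingP => HT; rewrite fpowersetE; apply/fsubsetP => P /placed_mem HP.
exact: tile_in_product HT HP.
Qed.

End RectSets.

(** * Numbering of tiles and colors *)

Section WangSide.
Local Open Scope Z_scope.
Local Ltac Zify.zify_post_hook ::= Z.to_euclidean_division_equations.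

Lemma toZD1 x : toZ (x + 1)%R = toZ x + 1. Proof. lia. Qed.
Lemma toID1 x : toI (toZ x + 1) = (x + 1)%R. Proof. lia. Qed.
Lemma toIB1 x : toI (toZ x - 1) = (x - 1)%R. Proof. lia. Qed.

Lemma cell_eq (p q : cell) : p.1 = q.1 -> p.2 = q.2 -> p = q.
Proof. by case: p => x y; case: q => x' y' /= -> ->. Qed.

Lemma index_eq (T : eqType) (a b : T) l : a \in l -> index a l = index b l -> a = b.
Proof.
move=> Ha E; rewrite -(nth_index a Ha) E nth_index //.
by rewrite -index_mem -E index_mem.
Qed.

Lemma range_of_lt (i n : nat) : (i < n)%N -> in_range (Z.of_nat n) (Z.of_nat i.+1).
Proof. by rewrite /in_range; lia. Qed.

Variables (C : choiceType) (W : {fset wang_tile C}) (B : {fset C}).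

Definition palette_side (s : side) : side :=
  match s with East | West => East | North | South => North end.

(* The colors of [B] come first, so that the numbers of the input encoding can
   be used as states. *)
Definition palette (s : side) : seq C := enum_fset B ++
  [seq a <- undup [seq (w : wang_tile C) s | w <- enum_fset W] | a \notin enum_fset B].

Definition tile_state (s : side) (i : Z) : Z :=
  Z.of_nat (nth 0 [seq (index ((w : wang_tile C) s) (palette (palette_side s))).+1 | w <- enum_fset W]
    (Z.to_nat i).-1)%N.

Definition nW := size (enum_fset W).
Definition nN := size (palette North).
Definition nE := size (palette East).

Lemma tile_stateE s (w : wang_tile C) : w \in W ->
  tile_state s (Z.of_nat (index w (enum_fset W)).+1) =
  Z.of_nat (index (w s) (palette (palette_side s))).+1.
Proof.
move=> Hw; rewrite /tile_state; congr Z.of_nat.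
have -> : (Z.to_nat (Z.of_nat (index w (enum_fset W)).+1)).-1 = index w (enum_fset W) by lia.
by rewrite (nth_map w) ?index_mem // nth_index.
Qed.

Lemma mem_palette s (w : wang_tile C) : w \in W -> w s \in palette s.
Proof.
move=> Hw; rewrite mem_cat mem_filter mem_undup (map_f (fun w : wang_tile C => w s)) // andbT.
exact: orbN.
Qed.

Lemma index_palette s a : a \in B -> index a (palette s) = index a (enum_fset B).
Proof. by move=> Ha; rewrite index_cat Ha. Qed.

Lemma size_palette s : (size (palette s) <= #|` W| + #|` B|)%N.
Proof.
rewrite size_cat addnC leq_add //.
apply: leq_trans (size_subseq (filter_subseq _ _)) _.
by apply: leq_trans (size_undup _) _; rewrite size_map.
Qed.

Lemma state_tile i : in_range (Z.of_nat nW) i ->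
  exists2 w, w \in W & i = Z.of_nat (index w (enum_fset W)).+1.
Proof.
rewrite /in_range /nW => Hi; have Hj : ((Z.to_nat i).-1 < size (enum_fset W))%N by lia.
have w0 : wang_tile C by case: (enum_fset W) Hj.
exists (nth w0 (enum_fset W) (Z.to_nat i).-1); first exact: mem_nth.
by rewrite index_uniq ?fset_uniq //; lia.
Qed.

Lemma tile_state_range s i : palette_side s = s -> in_range (Z.of_nat nW) i ->
  in_range (Z.of_nat (size (palette s))) (tile_state s i).
Proof.
move=> Es /state_tile[w Hw ->]; rewrite tile_stateE // Es.
by apply: range_of_lt; rewrite index_mem; apply: mem_palette.
Qed.

Variable G : colored_region C.
Hypothesis HG : (codomf (color G) `<=` B)%fset.

Definition edge_code (d : edge) : nat :=
  if (color G).[? d]%fmap is Some a then (index a (enum_fset B)).+1 else 0%N.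

(** An edge that is not on the boundary has code 0; it is given the state 1 to stay within the
    range. *)
Definition code_state (k : nat) : Z := Z.max 1 (Z.of_nat k).

Lemma color_in d a : (color G).[? d]%fmap = Some a -> a \in B.
Proof. by move=> E; apply: (fsubsetP HG); apply/codomfP; exists d. Qed.

Lemma edge_code_lt d : (edge_code d < (size (enum_fset B)).+1)%N.
Proof.
rewrite /edge_code; case E: fnd => [a|] //.
by rewrite ltnS index_mem; apply: color_in E.
Qed.

Lemma edge_code_gt0 d : (edge_code d != 0%N) = boundary_edge (cells G) d.
Proof. by rewrite -color_dom /edge_code; case: fndP. Qed.

Lemma boundary_neighbor p s : p \in cells G ->
  boundary_edge (cells G) (cell_edge p s) = (neighbor s p \notin cells G).
Proof.
by case: p => x y Hp; case: s => /=; rewrite ?GRing.addrK ?Hp ?addbT.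
Qed.

Lemma boundary_color p s : p \in cells G -> neighbor s p \notin cells G ->
  exists a, [/\ a \in B, (color G).[? cell_edge p s]%fmap = Some a &
    code_state (edge_code (cell_edge p s)) = Z.of_nat (index a (enum_fset B)).+1].
Proof.
move=> Hp Hn; have := edge_code_gt0 (cell_edge p s); rewrite boundary_neighbor // Hn.
rewrite /edge_code; case E: fnd => [a|] // _; exists a; split=> //; first exact: color_in E.
by rewrite /code_state; lia.
Qed.

Definition in_cells (x q : Z) : bool := ((toI x, toI q) : cell) \in cells G.
Definition h_state (x q : Z) : Z := code_state (edge_code (true, (toI x, toI q))).
Definition v_state (x q : Z) : Z := code_state (edge_code (false, ((toI x + 1)%R, toI q))).

Lemma in_cells_neighbor (p : cell) : [/\ in_cells (toZ p.1) (toZ p.2) = (p \in cells G),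
  in_cells (toZ p.1 + 1) (toZ p.2) = (neighbor East p \in cells G),
  in_cells (toZ p.1) (toZ p.2 + 1) = (neighbor North p \in cells G),
  in_cells (toZ p.1 - 1) (toZ p.2) = (neighbor West p \in cells G) &
  in_cells (toZ p.1) (toZ p.2 - 1) = (neighbor South p \in cells G)].
Proof. by case: p => x y; rewrite /in_cells /= ?toID1 ?toIB1 !ssrZ.Z_of_intK. Qed.

Lemma edge_states (p : cell) : [/\ v_state (toZ p.1) (toZ p.2) = code_state (edge_code (cell_edge p East)),
  h_state (toZ p.1) (toZ p.2 + 1) = code_state (edge_code (cell_edge p North)),
  v_state (toZ p.1 - 1) (toZ p.2) = code_state (edge_code (cell_edge p West)) &
  h_state (toZ p.1) (toZ p.2) = code_state (edge_code (cell_edge p South))].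
Proof.
case: p => x y; rewrite /v_state /h_state /= ?toID1 ?toIB1 !ssrZ.Z_of_intK.
by rewrite GRing.subrK.
Qed.

Hypothesis B_gt0 : (0 < size (enum_fset B))%N.

Lemma code_state_range s d : in_range (Z.of_nat (size (palette s))) (code_state (edge_code d)).
Proof.
have := edge_code_lt d; rewrite /in_range /code_state /palette size_cat; lia.
Qed.

Definition tile_no (t : {ffun cells G -> W}) (p : cells G) : Z :=
  Z.of_nat (index (val (t p)) (enum_fset W)).+1.

Definition numbering (t : {ffun cells G -> W}) (x q : Z) : Z :=
  if insub ((toI x, toI q) : cell) is Some p then tile_no t p else 1.

Lemma numberingE t (p : cells G) : numbering t (toZ (val p).1) (toZ (val p).2) = tile_no t p.
Proof. by rewrite /numbering !ssrZ.Z_of_intK -surjective_pairing valK. Qed.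

Lemma tile_noE s t p :
  tile_state s (tile_no t p) = Z.of_nat (index (val (t p) s) (palette (palette_side s))).+1.
Proof. by rewrite /tile_no tile_stateE // (valP (t p)). Qed.

Lemma tile_no_range t p : in_range (Z.of_nat nW) (tile_no t p).
Proof.
by apply: range_of_lt; rewrite index_mem; apply: (valP (t p)).
Qed.

Lemma tile_no_inj t t' p : tile_no t p = tile_no t' p -> t p = t' p.
Proof.
move=> E; apply/val_inj/(@index_eq _ _ _ (enum_fset W)); first exact: (valP (t p)).
by move/Nat2Z.inj: E => -[->].
Qed.

Definition local_wang (t : {ffun cells G -> W}) : Prop :=
  [/\ forall p q : cells G, val q = neighbor East (val p) -> val (t p) East = val (t q) West,
      forall p q : cells G, val q = neighbor North (val p) -> val (t p) North = val (t q) South &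
      forall (p : cells G) s a, (color G).[? cell_edge (val p) s]%fmap = Some a -> val (t p) s = a].

Lemma local_wangP t : is_wang_tiling t <-> local_wang t.
Proof.
split.
  case/andP=> /forallP H1 /forallP H2; split.
  - move=> p q E; have /forallP/(_ q)/forallP/(_ East)/forallP/(_ West)/implyP H := H1 p.
    by apply/eqP/H; rewrite E.
  - move=> p q E; have /forallP/(_ q)/forallP/(_ North)/forallP/(_ South)/implyP H := H1 p.
    by apply/eqP/H; rewrite E.
  - by move=> p s a E; have /forallP/(_ s) := H2 p; rewrite E => /eqP.
case=> L1 L2 L3; apply/andP; split; last first.
  apply/forallP => p; apply/forallP => s.
  by case E: fnd => [a|] //; apply/eqP/L3.
apply/forallP => p; apply/forallP => q; apply/forallP => s; apply/forallP => s'.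
apply/implyP => /eqP E; apply/eqP; case: s s' E => -[] //= -[].
- by move=> /GRing.addIr E1 E2; have -> : p = q by apply/val_inj/cell_eq.
- by move=> E1; apply: L1; exact: esym E1.
- by move=> E1 /GRing.addIr E2; have -> : p = q by apply/val_inj/cell_eq.
- by move=> E1; apply: L2; exact: esym E1.
- by move=> E1; apply/esym/L1; exact: E1.
- by move=> E1; have -> : p = q by apply/val_inj.
- by move=> E1; apply/esym/L2; exact: E1.
- by move=> E1; have -> : p = q by apply/val_inj.
Qed.

Notation wok := (wang_ok (Z.of_nat nW) (tile_state East) (tile_state North)
  (tile_state West) (tile_state South) in_cells h_state v_state).

Lemma boundary_stateP t (p : cells G) s : neighbor s (val p) \notin cells G ->
  tile_state s (tile_no t p) = code_state (edge_code (cell_edge (val p) s)) <->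
  (forall a, (color G).[? cell_edge (val p) s]%fmap = Some a -> val (t p) s = a).
Proof.
move=> Hn; have [a [Ha Ec ->]] := boundary_color (valP p) Hn.
rewrite tile_noE; split.
  move=> E b; rewrite Ec => -[<-].
  apply/esym/(@index_eq _ _ _ (palette (palette_side s))); first by rewrite mem_cat Ha.
  by rewrite index_palette //; move: E; lia.
by move=> /(_ a Ec) ->; rewrite index_palette.
Qed.

Lemma inner_stateP t (p q : cells G) s s' : palette_side s = s -> palette_side s' = s ->
  tile_state s (tile_no t p) = tile_state s' (tile_no t q) <-> val (t p) s = val (t q) s'.
Proof.
move=> Es Es'; rewrite !tile_noE Es Es'; split=> [E|-> //].
apply: (@index_eq _ _ _ (palette s)); first exact/mem_palette/(valP (t p)).
by move: E; lia.
Qed.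

Lemma wang_ok_numbering t : is_wang_tiling t <-> wok (numbering t).
Proof.
rewrite local_wangP.
have nbE (p : cells G) s (Hn : neighbor s (val p) \in cells G) :
    numbering t (toZ (neighbor s (val p)).1) (toZ (neighbor s (val p)).2) = tile_no t [` Hn]%fset.
  by rewrite -(numberingE t [` Hn]%fset).
split.
  case=> L1 L2 L3 x q Hg.
  have [p [-> ->]] : exists p : cells G, x = toZ (val p).1 /\ q = toZ (val p).2.
    by exists [` Hg]%fset => /=; rewrite !ssrZ.int_of_ZK.
  have [_ -> -> -> ->] := in_cells_neighbor (val p).
  have [-> -> -> ->] := edge_states (val p).
  rewrite numberingE; split.
  - exact: tile_no_range.
  - case: (boolP (neighbor East _ \in _)) => Hn; last by apply/boundary_stateP => // a; apply: L3.
    by have := nbE p East Hn; rewrite /= toZD1 => ->; apply/inner_stateP => //; apply: L1.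
  - case: (boolP (neighbor North _ \in _)) => Hn; last by apply/boundary_stateP => // a; apply: L3.
    by have := nbE p North Hn; rewrite /= toZD1 => ->; apply/inner_stateP => //; apply: L2.
  - by move=> Hn; apply/boundary_stateP => [|a]; [rewrite Hn | apply: L3].
  - by move=> Hn; apply/boundary_stateP => [|a]; [rewrite Hn | apply: L3].
move=> H.
have {}H (p : cells G) := H _ _ (eq_trans (let: And5 e _ _ _ _ := in_cells_neighbor (val p) in e) (valP p)).
split.
- move=> p q E; have [_ + _ _ _] := H p; have [_ -> _ _ _] := in_cells_neighbor (val p).
  rewrite -E (valP q) numberingE.
  have -> : toZ (val p).1 + 1 = toZ (val q).1 by rewrite E /= toZD1.
  have -> : toZ (val p).2 = toZ (val q).2 by rewrite E.
  by rewrite numberingE => /inner_stateP ->.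
- move=> p q E; have [_ _ + _ _] := H p; have [_ _ -> _ _] := in_cells_neighbor (val p).
  rewrite -E (valP q) numberingE.
  have -> : toZ (val p).2 + 1 = toZ (val q).2 by rewrite E /= toZD1.
  have -> : toZ (val p).1 = toZ (val q).1 by rewrite E.
  by rewrite numberingE => /inner_stateP ->.
- move=> p s a Ea.
  have Hn : neighbor s (val p) \notin cells G.
    rewrite -boundary_neighbor ?(valP p) // -color_dom.
    by move: Ea; case: fndP.
  move: (a) Ea; apply/boundary_stateP => //.
  have [_ EE EN EW ES] := H p.
  have [_ gE gN gW gS] := in_cells_neighbor (val p); rewrite gE gN gW gS in EE EN EW ES.
  have [eE eN eW eS] := edge_states (val p); rewrite eE eN eW eS numberingE in EE EN EW ES.
  case: s Hn => Hn.
  + by rewrite EE (negbTE Hn).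
  + by rewrite EN (negbTE Hn).
  + by rewrite EW // (negbTE Hn).
  + by rewrite ES // (negbTE Hn).
Qed.

Lemma numbering_ex tau : wok tau -> exists t,
  forall x q, in_cells x q -> numbering t x q = tau x q.
Proof.
move=> Hw.
have H (p : cells G) : exists w : W, tau (toZ (val p).1) (toZ (val p).2) =
    Z.of_nat (index (val w) (enum_fset W)).+1.
  have [gp _ _ _ _] := in_cells_neighbor (val p).
  have [/state_tile[w w_in E] _ _ _ _] := Hw _ _ (eq_trans gp (valP p)).
  by exists [` w_in]%fset.
have [h Hh] := choice H.
exists [ffun p => h p] => x q Hg.
have [p [-> ->]] : exists p : cells G, x = toZ (val p).1 /\ q = toZ (val p).2.
  by exists [` Hg]%fset => /=; rewrite !ssrZ.int_of_ZK.
by rewrite numberingE /tile_no ffunE Hh.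
Qed.

End WangSide.

Section Extensionality.
Local Open Scope Z_scope.
Local Ltac Zify.zify_post_hook ::= Z.to_euclidean_division_equations.
Variables (nW : Z) (fE fN fW fS : Z -> Z) (g : Z -> Z -> bool) (hb vb : Z -> Z -> Z).
Variables (tau tau' : Z -> Z -> Z).
Hypothesis Htau : forall x q, g x q -> tau x q = tau' x q.

Lemma wang_ok_ext : wang_ok nW fE fN fW fS g hb vb tau' -> wang_ok nW fE fN fW fS g hb vb tau.
Proof.
move=> H x q Hg; have [H1 H2 H3 H4 H5] := H x q Hg; rewrite Htau //; split=> //.
- by rewrite H2; case E: (g (x + 1) q) => //; rewrite Htau.
- by rewrite H3; case E: (g x (q + 1)) => //; rewrite Htau.
Qed.

Lemma wang_state_ext r s : wang_state fE fN g hb vb tau r s = wang_state fE fN g hb vb tau' r s.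
Proof.
rewrite /wang_state; case: ifP => // /and4P[Hg _ _ _]; rewrite /zone_act in Hg.
case: Z.eqb_spec => Hr.
  by rewrite Htau //; have -> : r / 4 - 1 = (r - 1) / 4 by lia.
have Hg' : g (s / 4) (r / 4) by have <- : (r - 1) / 4 = r / 4 by lia.
by rewrite !Htau.
Qed.

Variables (act : Z -> Z -> bool) (S t G Lw : Z) (st st' : Z -> Z -> Z).

Lemma standard_ext : (forall r s, (s - r) mod 2 = 0 -> st r s = st' r s) ->
  standard act S t G Lw st = standard act S t G Lw st'.
Proof.
move=> E; have El : low S t G Lw st = low S t G Lw st'.
  apply/funext => r; apply/funext => s; rewrite /low E //; exact: brick_at_par.
by rewrite /standard El.
Qed.

End Extensionality.

(** * Choice of the constants *)

Section Bounds.
Local Open Scope Z_scope.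
Local Ltac Zify.zify_post_hook ::= Z.to_euclidean_division_equations.

Lemma cells_bounded (F : {fset cell}) :
  exists M : Z, forall p, p \in F -> - M < toZ p.1 < M /\ - M < toZ p.2 < M.
Proof.
have H (s : seq cell) : exists M : Z, forall p, p \in s -> - M < toZ p.1 < M /\ - M < toZ p.2 < M.
  elim: s => [|c s [M IH]]; first by exists 0.
  exists (Z.max M (Z.max (Z.abs (toZ c.1) + 1) (Z.abs (toZ c.2) + 1))) => p.
  by rewrite inE => /orP[/eqP ->|/IH]; lia.
exact: (H (enum_fset F)).
Qed.

(** Without colors there is no boundary edge, so the region would contain, with one cell, all cells
    to the west of it. *)
Lemma uncolored_region_false (K : realType) (C : choiceType) (G : colored_region C) :
  ~ input_region K fset0 G.
Proof.
move=> [[[G_ne _] _] HB].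
have nob d : boundary_edge (cells G) d = false.
  rewrite -color_dom; apply/negbTE/negP => Hd.
  have Hc : (color G).[Hd]%fmap \in codomf (color G) by apply/codomfP; exists d; rewrite in_fnd.
  by have := fsubsetP HB _ Hc; rewrite inE.
have [p Hp] := fset0Pn _ G_ne.
have H n : (((p.1 - Posz n)%R, p.2) : cell) \in cells G.
  elim: n => [|n IH]; first by rewrite GRing.subr0 -surjective_pairing.
  have := nob (cell_edge ((p.1 - Posz n)%R, p.2) West).
  rewrite boundary_neighbor // => /negbFE; rewrite /neighbor /=.
  by have -> : (p.1 - Posz n - 1)%R = (p.1 - Posz n.+1)%R by lia.
have [M HM] := cells_bounded (cells G).
have [h _] := HM _ (H (Z.to_nat (toZ p.1 + M))).
by move: h; cbn [fst]; lia.
Qed.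

Lemma constants_ex (nW nN nE : Z) (fE fN fW fS : Z -> Z) : 0 <= nW -> 0 <= nN -> 0 <= nE ->
  exists S I t G Lw e, [/\ [/\ nW <= I, nN <= I, nE <= I & 1 <= I],
    forall hb vb, (forall x q, in_range nN (hb x q)) -> (forall x q, in_range nE (vb x q)) ->
      consts_ok (boundary_idx hb vb) (wang_rel nW nN nE fE fN fW fS) S I t G e,
    [/\ 0 < e, 100 * e <= G, 20 * G <= t, 2 * e < Lw & Lw + e < t] &
    forall c i, 1 <= i <= I -> 0 <= shift S c i <= e].
Proof.
move=> hW hN hE; pose I := nW + nN + nE + 1; pose S := 3 * I + 2.
have S0 : 0 <= S by rewrite /S /I; lia.
have sh c i : 1 <= i <= I -> 0 <= shift S c i <= max_shift S I.
  by move=> Hi; have [] := @shift_facts S I c i S0; lia.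
have e0 : 0 < max_shift S I.
  have [h1 _] := @shift_facts S I 1 1 S0 ltac:(rewrite /I; lia).
  by rewrite (_ : 1 mod 2 = 1) //; lia.
set e := max_shift S I in sh e0 *.
(* Here [S = 3 I + 2] avoids carries, [G = 600 e] is divisible by 6, [t = 20 G + 4] is 4 modulo 6,
   and [Lw = G] lies well between [2 e] and [t]. *)
exists S, I, (20 * (600 * e) + 4), (600 * e), (600 * e), e.
have I1 : 1 <= I by rewrite /I; lia.
have IW : nW <= I by rewrite /I; lia.
have IN : nN <= I by rewrite /I; lia.
have IE : nE <= I by rewrite /I; lia.
split=> //; last by clear -e0; split; lia.
move=> hb vb Hhb Hvb; split.
- by rewrite /S; lia.
- by rewrite /S; lia.
- exact: I1.
- by [].
- by clear -e0; lia.
- by clear; lia.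
- by clear -e0; lia.
- by clear; lia.
- exact: (boundary_idx_range fW fS (fun _ _ => true) Hhb Hvb I1 IN IE).
- by move=> r s i' i; apply: wang_rel_range.
- by move=> r s r' s' i' i; apply: wang_rel_mod.
Qed.

End Bounds.

(** * The reduction *)

Section Reduction.
Local Open Scope Z_scope.
Local Ltac Zify.zify_post_hook ::= Z.to_euclidean_division_equations.

Variables (C : choiceType) (W : {fset wang_tile C}) (B : {fset C}).
Variables (S I t G Lw e : Z).

Notation rel := (wang_rel (Z.of_nat (nW W)) (Z.of_nat (nN W B)) (Z.of_nat (nE W B))
  (tile_state W B East) (tile_state W B North) (tile_state W B West) (tile_state W B South)).
Notation bh := (block_height t G).

Hypothesis B_gt0 : (0 < size (enum_fset B))%N.
Hypotheses (I_W : Z.of_nat (nW W) <= I) (I_N : Z.of_nat (nN W B) <= I) (I_E : Z.of_nat (nE W B) <= I).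
Hypothesis HC : forall hb vb, (forall x q, in_range (Z.of_nat (nN W B)) (hb x q)) ->
  (forall x q, in_range (Z.of_nat (nE W B)) (vb x q)) -> consts_ok (boundary_idx hb vb) rel S I t G e.
Hypotheses (I_gt0 : 1 <= I) (e_pos : 0 < e) (G_e : 100 * e <= G) (t_G : 20 * G <= t)
  (Lw_e : 2 * e < Lw) (Lw_t : Lw + e < t).
Hypothesis shift_le : forall c i, 1 <= i <= I -> 0 <= shift S c i <= e.

Definition height : nat := Z.to_nat bh.

Lemma bhE : bh = 4 * (t + G). Proof. by []. Qed.
Lemma heightE : Z.of_nat height = bh.
Proof. by rewrite /height bhE; lia. Qed.
Lemma bh_gt0 : 0 < bh. Proof. by rewrite bhE; lia. Qed.

Definition block_shape (ce cn cw cs : nat) : seq (nat * nat) :=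
  [seq o <- [seq (i, j) | i <- iota 0 40, j <- iota 0 height] |
    keep S t G Lw (ce != 0%N) (cn != 0%N) (cw != 0%N) (cs != 0%N)
      (code_state ce) (code_state cn) (code_state cw) (code_state cs)
      (Z.of_nat o.1) (Z.of_nat o.2)].

Definition base : nat := (size (enum_fset B)).+1.

Definition coded_shape (k : nat) : seq (nat * nat) :=
  block_shape (k %% base)%N (k %/ base %% base)%N (k %/ base %/ base %% base)%N
    (k %/ base %/ base %/ base)%N.

Lemma coded_shapeE ce cn cw cs : (ce < base)%N -> (cn < base)%N -> (cw < base)%N ->
  coded_shape (code base ce cn cw cs) = block_shape ce cn cw cs.
Proof.
have key a m : (a < base)%N -> ((a + base * m) %% base = a /\ (a + base * m) %/ base = m)%N.
  by move=> Ha; rewrite mulnC addnC modnMDl divnMDl // modn_small // divn_small // addn0.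
move=> He Hn Hw; rewrite /coded_shape /code.
have [-> ->] := key ce (cn + base * (cw + base * cs))%N He.
have [-> ->] := key cn (cw + base * cs)%N Hn.
by have [-> ->] := key cw cs Hw.
Qed.

Definition rect_set : {fset rect} := seq_fset tt (rects (nW W) (nN W B) (nE W B)
  (tile_state W B East) (tile_state W B North) (tile_state W B West) (tile_state W B South) S t G).

Lemma filler_pos r s i' i : rel r s i' i -> 0 < filler_height S G r s i' i.
Proof.
move=> Hr; have [Hi' Hi] := wang_rel_range I_gt0 I_W I_N I_E Hr.
rewrite /filler_height.
have := shift_le (brick_class r (brick_at r s)) Hi.
by have := shift_le (brick_class (r - 1) (brick_at (r - 1) s)) Hi'; lia.
Qed.

Lemma t_pos : 0 < t. Proof. by lia. Qed.

Lemma mem_rect_set (w h : nat) : ((w, h) : rect) \in rect_set <->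
  size_ok (nW W) (nN W B) (nE W B) (tile_state W B East) (tile_state W B North)
    (tile_state W B West) (tile_state W B South) S t G (Z.of_nat w) (Z.of_nat h).
Proof. by rewrite seq_fsetE; apply: mem_rects; [exact: t_pos | exact: filler_pos]. Qed.

Lemma rect_set_ok : rect_tile_set rect_set.
Proof.
case=> w h /mem_rect_set Hs; have := size_ok_gt0 t_pos filler_pos Hs.
by rewrite /=; lia.
Qed.

Section OneRegion.
Variable G0 : colored_region C.

Notation ec p s := (edge_code B G0 (cell_edge p s)).

Definition block_cells (p : cell) : seq cell :=
  [seq ((Posz 40 * p.1 + Posz o.1)%R, (Posz height * p.2 + Posz o.2)%R)
     | o <- block_shape (ec p East) (ec p North) (ec p West) (ec p South)].

Definition blow_up : {fset cell} := seq_fset tt (flatten [seq block_cells p | p <- cells G0]).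

Notation g := (in_cells G0).
Notation hb := (h_state B G0).
Notation vb := (v_state B G0).

Lemma block_cell_keep (p : cell) i j : 0 <= i < 40 -> 0 <= j < bh ->
  block_cell S t G Lw g hb vb (40 * toZ p.1 + i) (bh * toZ p.2 + j) =
  (p \in cells G0) && keep S t G Lw (ec p East != 0%N) (ec p North != 0%N) (ec p West != 0%N)
    (ec p South != 0%N) (code_state (ec p East)) (code_state (ec p North))
    (code_state (ec p West)) (code_state (ec p South)) i j.
Proof.
move=> Hi Hj; have b0 := bh_gt0; rewrite /block_cell.
have -> : (40 * toZ p.1 + i) / 40 = toZ p.1 by clear -Hi; lia.
have -> : (40 * toZ p.1 + i) mod 40 = i by clear -Hi; lia.
have -> : (bh * toZ p.2 + j) / bh = toZ p.2.
  by apply/esym/(Z.div_unique _ _ _ j) => //; left.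
have -> : (bh * toZ p.2 + j) mod bh = j.
  by apply/esym/(Z.mod_unique _ _ (toZ p.2)) => //; left.
have [-> -> -> -> ->] := in_cells_neighbor G0 p.
have [-> -> -> ->] := edge_states B G0 p.
case Hp: (p \in cells G0) => //.
by rewrite -!(boundary_neighbor _ Hp) -!(edge_code_gt0 B).
Qed.

Lemma block_cells_ex p x y : ((x, y) : cell) \in block_cells p <->
  exists i j, [/\ 0 <= i < 40, 0 <= j < bh, toZ x = 40 * toZ p.1 + i,
    toZ y = bh * toZ p.2 + j &
    keep S t G Lw (ec p East != 0%N) (ec p North != 0%N) (ec p West != 0%N)
    (ec p South != 0%N) (code_state (ec p East)) (code_state (ec p North))
    (code_state (ec p West)) (code_state (ec p South)) i j].
Proof.
have EN := heightE; split.
  case/mapP=> -[i j]; rewrite mem_filter => /andP[Hk /allpairsP[[i' j'] [Hi Hj Eo]]] E.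
  have [Ei Ej] : i = i' /\ j = j' by case: Eo.
  have [Ex Ey] : x = (Posz 40 * p.1 + Posz i)%R /\ y = (Posz height * p.2 + Posz j)%R.
    by case: E => -> ->.
  subst i' j'; have {}Hi : (i < 40)%N by move: Hi; rewrite mem_iota.
  have {}Hj : (j < height)%N by move: Hj; rewrite mem_iota add0n.
  exists (Z.of_nat i), (Z.of_nat j); split=> //; first by clear -Hi; lia.
  - by clear -Hj EN; lia.
  - by rewrite Ex; clear; lia.
  - by rewrite Ey -EN; clear; lia.
case=> i [j [Hi Hj Ex Ey Hk]]; apply/mapP; exists (Z.to_nat i, Z.to_nat j).
  have Hi' : Z.to_nat i \in iota 0 40 by rewrite mem_iota; clear -Hi; lia.
  have Hj' : Z.to_nat j \in iota 0 height by rewrite mem_iota; clear -Hj EN; lia.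
  rewrite mem_filter; apply/andP; split.
    by cbn [fst snd]; rewrite !Z2Nat.id; [exact: Hk | case: Hj | case: Hi].
  by apply/allpairsP; exists (Z.to_nat i, Z.to_nat j); split; [exact: Hi' | exact: Hj' |].
rewrite -EN in Ey; cbn [fst snd]; congr pair; first by clear -Ex Hi; lia.
by clear -Ey Hj; lia.
Qed.

Lemma block_cells_base p x y : ((x, y) : cell) \in block_cells p ->
  p = (toI (toZ x / 40), toI (toZ y / bh)).
Proof.
case/block_cells_ex => i [j [Hi Hj -> -> _]].
have -> : (40 * toZ p.1 + i) / 40 = toZ p.1 by clear -Hi; lia.
have -> : (bh * toZ p.2 + j) / bh = toZ p.2.
  by apply/esym/(Z.div_unique _ _ _ j) => //; left.
by rewrite !Z_of_intK -surjective_pairing.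
Qed.

Lemma mem_blow_up x y : ((x, y) : cell) \in blow_up <->
  block_cell S t G Lw g hb vb (toZ x) (toZ y).
Proof.
have b0 := bh_gt0; rewrite seq_fsetE; split.
  case/flatten_mapP=> p Hp /block_cells_ex[i [j [Hi Hj -> -> Hk]]].
  by rewrite block_cell_keep // Hp.
pose p : cell := (toI (toZ x / 40), toI (toZ y / bh)).
have Hi : 0 <= toZ x mod 40 < 40 by apply: Z.mod_pos_bound.
have Hj : 0 <= toZ y mod bh < bh by apply: Z.mod_pos_bound.
have Ex : toZ x = 40 * toZ p.1 + toZ x mod 40.
  by rewrite /p [_.1]/= int_of_ZK; apply: Z.div_mod.
have Ey : toZ y = bh * toZ p.2 + toZ y mod bh.
  by rewrite /p [_.2]/= int_of_ZK; apply: Z.div_mod => E; rewrite E in b0.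
rewrite Ex Ey block_cell_keep // => /andP[Hp Hk].
apply/flatten_mapP; exists p => //; apply/block_cells_ex.
by exists (toZ x mod 40), (toZ y mod bh).
Qed.

Lemma in_region_blow_up : in_region blow_up = (fun x y => block_cell S t G Lw g hb vb x y : Prop).
Proof.
apply/funext => x; apply/funext => y; apply/propext; rewrite /in_region mem_blow_up.
by rewrite !int_of_ZK.
Qed.

Lemma blow_up_uniq s : uniq s -> uniq (flatten [seq block_cells p | p <- s]).
Proof.
elim: s => [//|p s IH] /andP[Hp Hs].
change (uniq (block_cells p ++ flatten [seq block_cells p | p <- s])).
rewrite cat_uniq IH // andbT; apply/andP; split.
  rewrite map_inj_uniq; last first.
    by move=> [i j] [i' j'] /= [E1 E2]; congr pair; [clear -E1 | clear -E2]; lia.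
  apply: filter_uniq; apply: allpairs_uniq; rewrite ?iota_uniq //.
  by move=> [i j] [i' j'] _ _ /= [-> ->].
apply/hasPn => -[x y] /flatten_mapP[q Hq Hc]; apply/negP => Hc'.
by rewrite (block_cells_base Hc') -(block_cells_base Hc) Hq in Hp.
Qed.

Hypothesis HG : (codomf (color G0) `<=` B)%fset.

Lemma hb_range x q : in_range (Z.of_nat (nN W B)) (hb x q).
Proof. exact: code_state_range. Qed.

Lemma vb_range x q : in_range (Z.of_nat (nE W B)) (vb x q).
Proof. exact: code_state_range. Qed.

Let HC0 := HC hb_range vb_range.

Lemma region_layout : layout_ok (zone_act g) (boundary_idx hb vb) S I t G Lw (in_region blow_up).
Proof.
rewrite in_region_blow_up.
by apply: (block_layout _ hb_range vb_range I_N I_E _ _ HC0) => //; lia.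
Qed.

Lemma code_state_I d : 1 <= code_state (edge_code B G0 d) <= I.
Proof.
by have := @code_state_range C W B G0 HG B_gt0 North d; rewrite /in_range -/(nN W B); lia.
Qed.

Definition cut_S (p : cell) (b : bool) : int :=
  toI (t - Lw + (if b then shift S 1 (code_state (ec p South)) else shift S 0 1)).
Definition cut_N (p : cell) (b : bool) : int :=
  toI (bh - Lw + (if b then shift S 1 (code_state (ec p North)) else shift S 0 1)).
Definition cut_E (p : cell) (b : bool) : int :=
  toI (if b then 3 * (t + G) - Lw + shift S 7 1 else t + G - Lw + shift S 3 (code_state (ec p East))).
Definition cut_W (p : cell) (b : bool) : int :=
  toI (if b then 3 * (t + G) - Lw + shift S 7 1 else t + G - Lw + shift S 3 (code_state (ec p West))).

(** Links the two descriptions of the carving: [keep] over [Z], used for tilings, and [cut] over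
    [int], used for simple connectedness. *)
Lemma keep_cut (p : cell) (i j : int) : (0 <= i < Posz 40)%R -> (0 <= j < Posz height)%R ->
  p \in cells G0 ->
  keep S t G Lw (ec p East != 0%N) (ec p North != 0%N) (ec p West != 0%N)
    (ec p South != 0%N) (code_state (ec p East)) (code_state (ec p North))
    (code_state (ec p West)) (code_state (ec p South)) (toZ i) (toZ j) <->
  forall s b, neighbor s p \notin cells G0 ->
    ~~ cut (Posz height) (toI t) cut_S cut_N cut_E cut_W p s b i j.
Proof.
move=> Hi Hj Hp; have EN := heightE.
have bE s : (ec p s != 0%N) = (neighbor s p \notin cells G0) by rewrite edge_code_gt0 boundary_neighbor.
rewrite (keepP _ _ _ _ g) !bE.
have h1 := shift_le 0 (conj (Z.le_refl 1) I_gt0).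
split.
  move=> [kS kN kE kW] s b; case: s => Hn; apply/negP.
  - case/and3P=> h2 h3 h4; have := kE Hn ltac:(clear -h2; lia); rewrite /dent_free.
    by rewrite /cut_E in h3 h4; case: b h3 h4 => h3 h4; clear -h3 h4; lia.
  - move=> /and3P[h2 h3 h4]; have := kN Hn; rewrite /strip_shift; rewrite /cut_N in h3.
    by case: b h2 h3 => h2 h3; case: Z.ltb_spec => h5; clear -h2 h3 h5; lia.
  - case/and3P=> h2 h3 h4; have := kW Hn ltac:(clear -h2; lia); rewrite /dent_free.
    by rewrite /cut_W in h3 h4; case: b h3 h4 => h3 h4; clear -h3 h4; lia.
  - move=> /and3P[h2 h3 h4]; have := kS Hn; rewrite /strip_shift; rewrite /cut_S in h4.
    by case: b h2 h4 => h2 h4; case: Z.ltb_spec => h5; clear -h2 h4 h5; lia.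
move=> Hc; split=> Hn.
- have c1 := Hc South true Hn; have c2 := Hc South false Hn.
  rewrite /cut /cut_S in c1 c2; cbv beta iota in c1, c2; rewrite /strip_shift.
  by case: Z.ltb_spec => h5; [clear -c2 Hi Hj h5 | clear -c1 Hi Hj h5]; lia.
- have c1 := Hc North true Hn; have c2 := Hc North false Hn.
  rewrite /cut /cut_N in c1 c2; cbv beta iota in c1, c2; rewrite /strip_shift.
  by case: Z.ltb_spec => h5; [clear -c2 Hi Hj h5 | clear -c1 Hi Hj h5]; lia.
- move=> h5; have c1 := Hc East true Hn; have c2 := Hc East false Hn.
  rewrite /cut /cut_E in c1 c2; cbv beta iota in c1, c2; rewrite /dent_free.
  by split; [clear -c2 Hi Hj h5 | clear -c1 Hi Hj h5]; lia.
- move=> h5; have c1 := Hc West true Hn; have c2 := Hc West false Hn.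
  rewrite /cut /cut_W in c1 c2; cbv beta iota in c1, c2; rewrite /dent_free.
  by split; [clear -c2 Hi Hj h5 | clear -c1 Hi Hj h5]; lia.
Qed.

Lemma blow_up_region (K : realType) : simply_connected_region K (cells G0) ->
  simply_connected_region K blow_up.
Proof.
have EN := heightE; rewrite bhE in EN.
have s01 := shift_le 0 (conj (Z.le_refl 1) I_gt0).
have s71 := shift_le 7 (conj (Z.le_refl 1) I_gt0).
have sc c d := shift_le c (code_state_I d).
apply: (@block_region K (cells G0) blow_up (Posz height) (toI t) (toI (t - Lw)) (toI (t + G - Lw))
  (toI (3 * (t + G) - Lw)) (toI (bh - Lw)) (toI e) cut_S cut_N cut_E cut_W); rewrite ?bhE; try lia.
- by move=> p b; have := sc 1 (cell_edge p South); rewrite /cut_S; case: b; lia.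
- by move=> p b; have := sc 1 (cell_edge p North); rewrite /cut_N bhE; case: b; lia.
- by move=> p b; have := sc 3 (cell_edge p East); rewrite /cut_E; case: b; lia.
- by move=> p b; have := sc 3 (cell_edge p West); rewrite /cut_W; case: b; lia.
move=> p i j Hi Hj; rewrite /block mem_blow_up.
have -> : toZ (40 * p.1 + i)%R = 40 * toZ p.1 + toZ i by clear; lia.
have -> : toZ (Posz height * p.2 + j)%R = bh * toZ p.2 + toZ j.
  by rewrite bhE -EN; clear; lia.
rewrite block_cell_keep; [|clear -Hi; lia|rewrite bhE -EN; clear -Hj; lia].
have Hi' : (0 <= i < Posz 40)%R by clear -Hi; lia.
split.
  by case/andP=> Hp /(keep_cut Hi' Hj Hp).
by case=> Hp Hc; rewrite Hp /=; apply/(keep_cut Hi' Hj Hp).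
Qed.

Definition state_of (tau : Z -> Z -> Z) :=
  wang_state (tile_state W B East) (tile_state W B North) g hb vb tau.

Definition tiling_of (tl : {ffun cells G0 -> W}) : {fset placement} :=
  tile_set blow_up rect_set (standard (zone_act g) S t G Lw (state_of (numbering tl))).

Lemma state_of_ok (tl : {ffun cells G0 -> W}) : is_wang_tiling tl ->
  state_ok (zone_act g) (boundary_idx hb vb) rel I (state_of (numbering tl)).
Proof.
move/(wang_ok_numbering HG B_gt0) => Hw.
have HfN i := @tile_state_range C W B North i erefl.
have HfE i := @tile_state_range C W B East i erefl.
exact: (wang_state_ok HfN HfE hb_range vb_range I_gt0 I_W I_N I_E Hw).
Qed.

Lemma val_in_cells (p : cells G0) : g (toZ (val p).1) (toZ (val p).2).
Proof. by rewrite /in_cells !Z_of_intK -surjective_pairing; exact: (valP p). Qed.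

(** The tile of each cell is visible in the state of a brick inside the region, which makes
    [tiling_of] injective. *)
Lemma state_of_center (tl : {ffun cells G0 -> W}) (p : cells G0) :
  state_of (numbering tl) (4 * toZ (val p).2 + 1) (4 * toZ (val p).1 + 1) = tile_no tl p.
Proof.
rewrite /state_of state_Xi; [|exact: id|exact: id].
by rewrite numberingE ifT //; exact: val_in_cells.
Qed.

Lemma tiling_of_ok (tl : {ffun cells G0 -> W}) : is_wang_tiling tl -> is_rect_tiling rect_set blow_up (tiling_of tl).
Proof.
move/state_of_ok => Hst.
apply: (tile_set_tiling t_pos filler_pos mem_rect_set).
exact: (standard_tiling HC0 region_layout Hst).
Qed.

Lemma tiling_of_inj (tl tl' : {ffun cells G0 -> W}) : is_wang_tiling tl -> is_wang_tiling tl' ->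
  tiling_of tl = tiling_of tl' -> tl = tl'.
Proof.
move=> /state_of_ok H /state_of_ok H' E.
have HT := standard_tiling HC0 region_layout H.
have HT' := standard_tiling HC0 region_layout H'.
have Est := placed_tile_set t_pos filler_pos mem_rect_set HT.
have Est' := placed_tile_set t_pos filler_pos mem_rect_set HT'.
rewrite -/(tiling_of tl) E Est' in Est.
apply/ffunP => p; apply: tile_no_inj.
rewrite -!state_of_center; apply: (standard_state_inj HC0 region_layout H H').
- by move=> a b w h; rewrite Est.
- by clear; lia.
- by rewrite real_in; [exact: val_in_cells | left | lia].
Qed.

Lemma tiling_of_surj T : is_rect_tiling rect_set blow_up T ->
  exists2 tl : {ffun cells G0 -> W}, is_wang_tiling tl & T = tiling_of tl.
Proof.
move=> HT; have [M HM] := cells_bounded (cells G0).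
have Hb r s : zone_act g r s -> - (4 * M + 10) < r < 4 * M + 10 /\ - (4 * M + 10) < s < 4 * M + 10.
  rewrite /zone_act /in_cells => /HM; rewrite [_.1]/= [_.2]/= !int_of_ZK; clear; lia.
have /(rect_tilingP blow_up mem_rect_set) Tok := HT.
have [st [Hst Est]] := tiling_standard HC0 region_layout Hb Tok.
have [Hw Estw] := state_wang_ok Hst.
have [tl Htl] := numbering_ex Hw.
exists tl.
  by apply/(wang_ok_numbering HG B_gt0); exact: (wang_ok_ext Htl Hw).
have Ep : placed T = standard (zone_act g) S t G Lw (state_of (numbering tl)).
  have <- : standard (zone_act g) S t G Lw st = standard (zone_act g) S t G Lw (state_of (numbering tl)).
    by apply: standard_ext => r s /Estw ->; apply/esym/wang_state_ext.
  apply/funext => a; apply/funext => b; apply/funext => w; apply/funext => h.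
  exact/propext.
by rewrite (tiling_tile_set t_pos filler_pos mem_rect_set HT) Ep.
Qed.

Lemma nb_tilings : nb_wang_tilings W G0 = nb_rect_tilings rect_set blow_up.
Proof.
have -> : nb_rect_tilings rect_set blow_up =
    #|` seq_fset tt [seq tiling_of tl | tl <- enum [pred tl : {ffun cells G0 -> W} | is_wang_tiling tl]]|.
  congr (#|` _|); apply/fsetP => T; rewrite seq_fsetE !inE.
  apply/andP/mapP => [[_ /tiling_of_surj[tl Htl ->]]|[tl]].
    by exists tl; rewrite ?mem_enum.
  rewrite mem_enum => /tiling_of_ok Hok ->; split=> //.
  exact: (tiling_in_powerset t_pos filler_pos mem_rect_set Hok).
rewrite size_seq_fset undup_id; first by rewrite size_map -cardE.
have inj : {in enum [pred tl : {ffun cells G0 -> W} | is_wang_tiling tl] &, injective tiling_of}.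
  by move=> tl tl'; rewrite !mem_enum; exact: tiling_of_inj.
by rewrite (map_inj_in_uniq inj) enum_uniq.
Qed.

Lemma tileable_iff : wang_tileable W G0 <-> rect_tileable rect_set blow_up.
Proof.
split=> [[tl /tiling_of_ok H]|[T /tiling_of_surj[tl H _]]]; first by eexists; exact: H.
by exists tl.
Qed.

End OneRegion.

Lemma blow_up_linear (K : realType) :
  linear_time_computable B (input_region K B) blow_up.
Proof.
pose P := prog 40 height base coded_shape.
exists P, (size P), 1%N => G0 [_ HG] w [s Hs ->].
pose ec p d := edge_code B G0 (cell_edge p d).
pose xs s := [seq ((p : int * int), (ec p East, ec p North, ec p West, ec p South)) | p <- s].
have lt p d : (ec p d < base)%N := edge_code_lt HG _.
have [|t0 [M' [Ht E]]] := @prog_correct 40 height base coded_shape (xs s) (fun=> 0%R) [::].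
  by move=> k /mapP[p _ ->] /=; split; exact: lt.
have Ein : flatten [seq encode_colored_cell B G0 p | p <- s] =
    flatten [seq let: (e, n, w, s) := k.2 in
        [:: k.1.1; k.1.2; Posz e; Posz n; Posz w; Posz s] | k <- xs s].
  rewrite /xs -map_comp; congr flatten; apply: eq_map => p /=.
  have cc d : color_code B (color G0).[? cell_edge p d]%fmap = Posz (ec p d).
    by rewrite /color_code /ec /edge_code; case: fnd.
  by rewrite /encode_colored_cell /= -!cc.
have Eout : flatten [seq let: (e, n, w, s) := k.2 in flatten
      [seq [:: (Posz 40 * k.1.1 + Posz o.1)%R; (Posz height * k.1.2 + Posz o.2)%R]
         | o <- coded_shape (code base e n w s)] | k <- xs s] =
    flatten [seq [:: c.1; c.2] | c <- flatten [seq block_cells G0 p | p <- s]].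
  elim: {Hs Ht E Ein} s => [//|p s IH].
  change (flatten [seq block_cells G0 p | p <- p :: s])
    with (block_cells G0 p ++ flatten [seq block_cells G0 p | p <- s]).
  rewrite map_cat flatten_cat -IH /xs map_cons [flatten (_ :: _)]/=; congr cat.
  by rewrite coded_shapeE ?lt // /block_cells -map_comp.
exists t0, (flatten [seq [:: c.1; c.2] | c <- flatten [seq block_cells G0 p | p <- s]]).
split.
(* Every cell contributes six integers to the input, so the cells are at most as many as the input
   is long. *)
- apply: leq_trans Ht _; rewrite leq_add2r leq_mul2l size_map; apply/orP; right.
  by clear; elim: s => [//|p s IH]; rewrite /= ltnS; do 5 apply: leqW; exact: IH.
- by rewrite /outputs_within Ein E /= Eout.
exists (flatten [seq block_cells G0 p | p <- s]) => //.
apply: uniq_perm; [apply: blow_up_uniq|exact: fset_uniq|].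
  by rewrite (perm_uniq Hs) fset_uniq.
move=> c; rewrite seq_fsetE; apply/flatten_mapP/flatten_mapP => -[p Hp Hc]; exists p => //.
  by rewrite -(perm_mem Hs).
by rewrite (perm_mem Hs).
Qed.

End Reduction.

Theorem lemma3p3 (K : realType) (C : choiceType) (k c : nat)
    (W : {fset wang_tile C}) (B : {fset C}) :
  (#|` W| <= k)%N -> (#|` B| <= c)%N ->
  exists R : {fset rect},
    rect_tile_set R /\ (#|` R| <= 8 * (k + 4 * c) ^ 2)%N /\
    exists f : colored_region C -> {fset cell},
      linear_time_computable B (input_region K B) f /\
      forall G : colored_region C, input_region K B G ->
        simply_connected_region K (f G) /\
        (wang_tileable W G <-> rect_tileable R (f G)) /\
        nb_wang_tilings W G = nb_rect_tilings R (f G).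
Proof.
move=> kW cB; case: (posnP (size (enum_fset B))) => [B0|B_gt0].
  (* With no color there is no input region at all, and any [R] within the bound will do; the empty
     one works even for [k = 0]. *)
  have -> : B = fset0 by apply/eqP; rewrite -cardfs_eq0; apply/eqP.
  exists fset0; split; first by move=> r; rewrite inE.
  split; first by rewrite cardfs0.
  exists (fun=> fset0); split; last by move=> G /uncolored_region_false.
  by exists [::], 0%N, 0%N => G /uncolored_region_false.
have [S [I [t [G [Lw [e [[I_W I_N I_E I_gt0] HC [e_pos G_e t_G Lw_e Lw_t] shift_le]]]]]]] :=
  constants_ex (tile_state W B East) (tile_state W B North) (tile_state W B West)
    (tile_state W B South) (Zle_0_nat (nW W)) (Zle_0_nat (nN W B)) (Zle_0_nat (nE W B)).
exists (rect_set W B S t G); split.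
  by eapply rect_set_ok; eassumption.
split.
  rewrite size_seq_fset; apply: leq_trans (size_undup _) _.
  apply: leq_trans (size_rects _ _ _ _ _ _ _ _ _ _) _.
  have hN := size_palette W B North; have hE := size_palette W B East.
  rewrite -/(nN W B) in hN; rewrite -/(nE W B) in hE.
  have hW : (nW W <= k)%N by [].
  have {}hN : (nN W B <= k + c)%N by apply: leq_trans hN (leq_add kW cB).
  have {}hE : (nE W B <= k + c)%N by apply: leq_trans hE (leq_add kW cB).
  have c0 : (0 < c)%N by apply: leq_trans B_gt0 cB.
  have hNE : (nN W B * nE W B <= (k + c) * (k + c))%N by apply: leq_mul.
  move: hNE hN hE hW c0; clear.
  move: (nN W B) (nE W B) (nW W) => x y z hNE hN hE hW c0.
  (* Since [c] is positive, the linear and constant terms are absorbed by [k * c] and [c * c]. *)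
  have kc : (k <= k * c)%N by rewrite leq_pmulr.
  have cc : (c <= c * c)%N by rewrite leq_pmulr.
  by rewrite expnS expn1; move: hNE; move: (x * y)%N => xy; nia.
exists (blow_up B S t G Lw); split.
  by eapply blow_up_linear; eassumption.
move=> G0 [scG HG]; split.
  by eapply blow_up_region; eassumption.
split.
  by eapply tileable_iff; eassumption.
by eapply nb_tilings; eassumption.
Qed.
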